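(* Let the functions $f$ and $g^r$, $r=1,\ldots,m$, be admissible (as defined in the context) with constants $L\in(0,\infty)$, $\eta\in(1,\infty)$ and $q\in(1,\infty)$. Let $\overline{h}\in(0,L^{-1})$ with $\overline{h}\le T$. If the exact solution $X$ to the SODE $\mathrm{d}X(t)=f(t,X(t))\,\mathrm{d}t+\sum_{r=1}^m g^r(t,X(t))\,\mathrm{d}W^r(t)$, $X(0)=X_0$, satisfies $\sup_{\tau\in[0,T]}\|X(\tau)\|_{L^{4q-2}(\Omega;\mathbb{R}^d)}<\infty$, then the split-step backward Euler method $(\Psi^{\mathrm{SSBE}},\overline{h},X_0)$ is strongly convergent of order $\gamma=\frac12$; that is, there exists a constant $C$ such that for every $N\in\mathbb{N}$ and every vector of step sizes $h\in(0,\overline{h}]^N$ the generated grid function $X_h$ satisfies $\max_{n\in\{0,\ldots,N\}}\|X_h(t_n)-X(t_n)\|_{L^2(\Omega;\mathbb{R}^d)}\le C|h|^{1/2}$.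
   Context: Let $d,m\in\mathbb{N}$, $T\in(0,\infty)$, and let $(\Omega,\mathcal{F},(\mathcal{F}_t)_{t\in[0,T]},\mathbf{P})$ be a filtered probability space satisfying the usual conditions, with independent real-valued standard $(\mathcal{F}_t)$-Brownian motions $W^1,\ldots,W^m$. $|\cdot|$ and $\langle\cdot,\cdot\rangle$ are the Euclidean norm and inner product; $\|Y\|_{L^p(\Omega;\mathbb{R}^d)}=(\mathbb{E}|Y|^p)^{1/p}$. Admissible: $f,g^r\colon[0,T]\times\mathbb{R}^d\to\mathbb{R}^d$, $r=1,\ldots,m$, are admissible with constants $L>0$, $\eta\in(\frac12,\infty)$, $q\in(1,\infty)$ if they are continuous and for all $t,t_1,t_2\in[0,T]$, $x,x_1,x_2\in\mathbb{R}^d$ and $r=1,\ldots,m$: $\langle f(t,x_1)-f(t,x_2),x_1-x_2\rangle+\eta\sum_{r=1}^m|g^r(t,x_1)-g^r(t,x_2)|^2\le L|x_1-x_2|^2$; $|f(t,x)|\vee|g^r(t,x)|\le L(1+|x|^q)$; $|f(t_1,x)-f(t_2,x)|\vee|g^r(t_1,x)-g^r(t_2,x)|\le L(1+|x|^q)|t_1-t_2|^{1/2}$; $|f(t,x_1)-f(t,x_2)|\vee|g^r(t,x_1)-g^r(t,x_2)|\le L(1+|x_1|^{q-1}+|x_2|^{q-1})|x_1-x_2|$. The initial value $X_0$ is in $L^p(\Omega,\mathcal{F}_0,\mathbf{P};\mathbb{R}^d)$ for a sufficiently large $p\in[2,\infty)$. The exact solution $X$ is the unique almost surely continuous, $(\mathcal{F}_t)$-adapted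 process satisfying the integral form of the SODE $\mathbf{P}$-a.s. for all $t\in[0,T]$. A vector of step sizes is $h=(h_1,\ldots,h_N)\in(0,T]^N$ with $\sum_{i=1}^N h_i=T$; $t_n:=\sum_{i=1}^n h_i$, $|h|:=\max_i h_i$. Let $\mathbb{T}:=\{(t,\delta)\in[0,T)\times(0,\overline{h}]:t+\delta\le T\}$. SSBE one-step map: for $\delta\in(0,\overline{h}]$ with $\overline{h}<L^{-1}$ put $F_\delta(t,x)=x-\delta f(t,x)$; then $F_\delta(t,\cdot)\colon\mathbb{R}^d\to\mathbb{R}^d$ is a homeomorphism with inverse $F_\delta^{-1}(t,\cdot)$. For $x\in\mathbb{R}^d$, $(t,\delta)\in\mathbb{T}$ define $\Psi^{\mathrm{SSBE}}(x,t,\delta)=F_\delta^{-1}(t+\delta,x)+\sum_{r=1}^m g^r(t+\delta,F_\delta^{-1}(t+\delta,x))(W^r(t+\delta)-W^r(t))$. The grid function generated by $(\Psi^{\mathrm{SSBE}},\overline{h},X_0)$ with step sizes $h\in(0,\overline{h}]^N$ is $X_h(t_0)=X_0$, $X_h(t_i)=\Psi^{\mathrm{SSBE}}(X_h(t_{i-1}),t_{i-1},h_i)$, $1\le i\le N$. *)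

(* Defs.v *)
(* Sets, measures and topology come from MathComp-Analysis.  A process on
   [0, T] is a function of R (time) and Omega of which only the restriction to
   [0, T] matters; vectors of R^d are rows 'rV[R]_d. *)
From mathcomp Require Export all_boot all_order all_algebra.
From mathcomp Require Export all_classical all_reals all_analysis.
From mathcomp Require Export measurable_realfun.
Export Order.TTheory GRing.Theory Num.Theory.
Export numFieldNormedType.Exports.

Set Implicit Arguments.
Unset Strict Implicit.
Unset Printing Implicit Defensive.

Local Open Scope classical_set_scope.
Local Open Scope ring_scope.

Definition inner (R : realType) (d : nat) (x y : 'rV[R]_d) : R :=
  \sum_(i < d) x 0 i * y 0 i.

(* Euclidean norm; the library's `|x| of a matrix is the maximum norm, which induces the same
   topology. *)
Definition enorm (R : realType) (d : nat) (x : 'rV[R]_d) : R :=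
  Num.sqrt (inner x x).

Definition Lp_norm (disp : measure_display) (Omega : measurableType disp)
    (R : realType) (P : probability Omega R) (d : nat) (p : R)
    (Y : Omega -> 'rV[R]_d) : \bar R :=
  Lnorm P p%:E (fun w => (enorm (Y w))%:E).

Record admissible (R : realType) (d m : nat) (T : R)
    (f : R -> 'rV[R]_d -> 'rV[R]_d) (g : 'I_m -> R -> 'rV[R]_d -> 'rV[R]_d)
    (L eta q : R) : Prop := Admissible {
  adm_L : 0 < L;
  adm_eta : 2^-1 < eta;
  adm_q : 1 < q;
  adm_cont_f : {within [set z : R * 'rV[R]_d | 0 <= z.1 <= T],
    continuous (fun z => f z.1 z.2)};
  adm_cont_g : forall r, {within [set z : R * 'rV[R]_d | 0 <= z.1 <= T],
    continuous (fun z => g r z.1 z.2)};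
  adm_monotone : forall (t : R) x1 x2, 0 <= t <= T ->
    inner (f t x1 - f t x2) (x1 - x2)
      + eta * (\sum_(r < m) enorm (g r t x1 - g r t x2) ^+ 2)
    <= L * enorm (x1 - x2) ^+ 2;
  adm_growth : forall r (t : R) x, 0 <= t <= T ->
    Num.max (enorm (f t x)) (enorm (g r t x)) <= L * (1 + enorm x `^ q);
  adm_time : forall r (t1 t2 : R) x, 0 <= t1 <= T -> 0 <= t2 <= T ->
    Num.max (enorm (f t1 x - f t2 x)) (enorm (g r t1 x - g r t2 x))
    <= L * (1 + enorm x `^ q) * `|t1 - t2| `^ 2^-1;
  adm_space : forall r (t : R) x1 x2, 0 <= t <= T ->
    Num.max (enorm (f t x1 - f t x2)) (enorm (g r t x1 - g r t x2))
    <= L * (1 + enorm x1 `^ (q - 1) + enorm x2 `^ (q - 1)) * enorm (x1 - x2)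
}.

Definition measurable_wrt (Omega : Type) (R : realType) (G : set (set Omega))
    (Y : Omega -> R) : Prop :=
  forall B : set R, measurable B -> G (Y @^-1` B).

Definition vmeasurable_wrt (Omega : Type) (R : realType) (d : nat)
    (G : set (set Omega)) (Y : Omega -> 'rV[R]_d) : Prop :=
  forall i, measurable_wrt G (fun w => Y w 0 i).

(* The third and fourth conditions together force P to be complete. *)
Record usual_filtration (disp : measure_display) (Omega : measurableType disp)
    (R : realType) (P : probability Omega R) (T : R)
    (F : R -> set (set Omega)) : Prop := UsualFiltration {
  filt_sigma : forall t : R, 0 <= t <= T -> sigma_algebra setT (F t);
  filt_mono : forall s t : R, 0 <= s -> s <= t -> t <= T -> F s `<=` F t;
  filt_sub : forall t : R, 0 <= t <= T -> F t `<=` measurable;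
  filt_null : forall A, P.-negligible A -> F 0 A;
  filt_right : forall t : R, 0 <= t < T ->
    F t = [set A | forall s : R, t < s <= T -> F s A]
}.

Record brownian (disp : measure_display) (Omega : measurableType disp)
    (R : realType) (P : probability Omega R) (T : R)
    (F : R -> set (set Omega)) (W : R -> Omega -> R) : Prop := Brownian {
  bm_adapted : forall t : R, 0 <= t <= T -> measurable_wrt (F t) (W t);
  bm_start : {ae P, forall w, W 0 w = 0};
  bm_cont : {ae P, forall w, {within `[0, T], continuous (fun t => W t w)}};
  bm_normal : forall (s t : R) (B : set R), 0 <= s -> s < t -> t <= T ->
    measurable B ->
    P ((fun w => W t w - W s w) @^-1` B) = normal_prob 0 (Num.sqrt (t - s)) B;
  bm_indep : forall (s t : R) (A : set Omega) (B : set R),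
    0 <= s -> s < t -> t <= T -> F s A -> measurable B ->
    P (A `&` (fun w => W t w - W s w) @^-1` B)
    = (P A * P ((fun w => (W t w - W s w)%R) @^-1` B))%E
}.

Definition process_sigma (Omega : Type) (R : realType) (T : R)
    (W : R -> Omega -> R) : set (set Omega) :=
  <<s [set A | exists (t : R) (B : set R),
         [/\ 0 <= t <= T, measurable B & A = W t @^-1` B] ] >>.

(* Taking some of the A r to be the whole space gives the product rule for all
   subfamilies. *)
Definition independent_processes (disp : measure_display)
    (Omega : measurableType disp) (R : realType) (P : probability Omega R)
    (T : R) (m : nat) (W : 'I_m -> R -> Omega -> R) : Prop :=
  forall A : 'I_m -> set Omega, (forall r, process_sigma T (W r) (A r)) ->
    P (\bigcap_r A r) = (\prod_(r < m) P (A r))%E.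

(* Elementary integrands \sum_j xi_j 1_(tau_j, tau_{j+1}]. *)
Record simple_process (Omega : Type) (R : realType) (T : R)
    (F : R -> set (set Omega)) := SimpleProcess {
  sp_size : nat;
  sp_time : nat -> R;
  sp_coef : nat -> Omega -> R;
  sp_time_range : forall j, (j <= sp_size)%N -> 0 <= sp_time j <= T;
  sp_time_mono : forall j, (j < sp_size)%N -> sp_time j <= sp_time j.+1;
  sp_coef_adapted : forall j, (j < sp_size)%N ->
    measurable_wrt (F (sp_time j)) (sp_coef j);
  sp_coef_bounded : forall j, (j < sp_size)%N ->
    exists M : R, forall w, `|sp_coef j w| <= M
}.

Definition sp_val (Omega : Type) (R : realType) (T : R)
    (F : R -> set (set Omega)) (phi : simple_process T F) (s : R) (w : Omega) :
    R :=
  \sum_(j < sp_size phi)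
    sp_coef phi j w * \1_(`]sp_time phi j, sp_time phi j.+1]) s.

Definition sp_integral (Omega : Type) (R : realType) (T : R)
    (F : R -> set (set Omega)) (W : R -> Omega -> R) (phi : simple_process T F)
    (t : R) (w : Omega) : R :=
  \sum_(j < sp_size phi) sp_coef phi j w *
    (W (Num.min (sp_time phi j.+1) t) w - W (Num.min (sp_time phi j) t) w).

Definition cvg0_in_probability (disp : measure_display)
    (Omega : measurableType disp) (R : realType) (P : probability Omega R)
    (Y : nat -> Omega -> \bar R) : Prop :=
  (forall n, measurable_fun setT (Y n)) /\
  forall e : R, 0 < e ->
    (P [set w | (e%:E <= `|Y n w|)%E] @[n --> \oo] --> 0%E).

(* I is the (continuous version of the) Ito integral process of phi against W:
   the limit in probability of the integrals of elementary integrands phi_n with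
   \int_0^T |phi_n - phi|^2 ds -> 0 in probability.  Such phi_n exist whenever
   phi is progressively measurable with \int_0^T |phi|^2 ds < oo a.s., and I is
   then determined up to indistinguishability. *)
Definition is_ito_integral (disp : measure_display)
    (Omega : measurableType disp) (R : realType) (P : probability Omega R)
    (T : R) (F : R -> set (set Omega)) (W phi I : R -> Omega -> R) : Prop :=
  {ae P, forall w, {within `[0, T], continuous (fun t => I t w)}} /\
  exists phi_ : nat -> simple_process T F,
    cvg0_in_probability P (fun n w =>
      \int[lebesgue_measure]_(s in `[0%R, T])
        ((sp_val (phi_ n) s w - phi s w) ^+ 2)%:E)%E /\
    forall t : R, 0 <= t <= T ->
      cvg0_in_probability P (fun n w => (sp_integral W (phi_ n) t w - I t w)%:E).

Record sode_solution (disp : measure_display) (Omega : measurableType disp)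
    (R : realType) (P : probability Omega R) (d m : nat) (T : R)
    (F : R -> set (set Omega)) (W : 'I_m -> R -> Omega -> R)
    (f : R -> 'rV[R]_d -> 'rV[R]_d) (g : 'I_m -> R -> 'rV[R]_d -> 'rV[R]_d)
    (X0 : Omega -> 'rV[R]_d) (X : R -> Omega -> 'rV[R]_d) : Prop :=
  SodeSolution {
  sol_adapted : forall t : R, 0 <= t <= T -> vmeasurable_wrt (F t) (X t);
  sol_cont : {ae P, forall w, {within `[0, T], continuous (fun t => X t w)}};
  sol_eq : exists I : 'I_m -> R -> Omega -> 'rV[R]_d,
    (forall r i, is_ito_integral P T F (W r)
       (fun s w => g r s (X s w) 0 i) (fun t w => I r t w 0 i)) /\
    {ae P, forall w, forall t : R, 0 <= t <= T ->
       X t w = X0 w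
         + \row_(i < d) (\int[lebesgue_measure]_(s in `[0, t]) f s (X s w) 0 i)
         + \sum_(r < m) I r t w}
}.

(* A vector of step sizes (h_1, ..., h_N) is a sequence of length N, so that
   h_{i+1} is h`_i. *)
Definition grid_time (R : realType) (h : seq R) (n : nat) : R :=
  \sum_(i < n) h`_i.

Definition mesh (R : realType) (h : seq R) : R :=
  \big[Num.max/0]_(x <- h) x.

Definition one_step_map (Omega : Type) (R : realType) (d : nat) : Type :=
  'rV[R]_d -> R -> R -> Omega -> 'rV[R]_d.

Fixpoint grid_function (Omega : Type) (R : realType) (d : nat)
    (Psi : one_step_map Omega R d) (X0 : Omega -> 'rV[R]_d) (h : seq R)
    (n : nat) (w : Omega) : 'rV[R]_d :=
  if n is k.+1 then
    Psi (grid_function Psi X0 h k w) (grid_time h k) h`_k w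
  else X0 w.

Definition strongly_convergent (disp : measure_display)
    (Omega : measurableType disp) (R : realType) (P : probability Omega R)
    (d : nat) (T : R) (Psi : one_step_map Omega R d) (hbar : R)
    (X0 : Omega -> 'rV[R]_d) (X : R -> Omega -> 'rV[R]_d) (gamma : R) : Prop :=
  exists C : R, forall (N : nat) (h : N.-tuple R),
    (forall i : 'I_N, 0 < h`_i <= hbar) -> \sum_(i < N) h`_i = T ->
    (\big[maxe/0]_(n < N.+1)
       Lp_norm P 2
         (fun w => (grid_function Psi X0 h n w - X (grid_time h n) w)%R)
     <= (C * mesh h `^ gamma)%:E)%E.

Definition ssbe_F (R : realType) (d : nat) (f : R -> 'rV[R]_d -> 'rV[R]_d)
    (delta t : R) (x : 'rV[R]_d) : 'rV[R]_d :=
  x - delta *: f t x.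

(* The inverse of a bijective F_delta(t, .), and 0 off the range of F_delta(t, .)
   in general. *)
Definition ssbe_Finv (R : realType) (d : nat) (f : R -> 'rV[R]_d -> 'rV[R]_d)
    (delta t : R) : 'rV[R]_d -> 'rV[R]_d :=
  'pinv_(fun=> 0) setT (ssbe_F f delta t).

Definition ssbe (Omega : Type) (R : realType) (d m : nat)
    (f : R -> 'rV[R]_d -> 'rV[R]_d) (g : 'I_m -> R -> 'rV[R]_d -> 'rV[R]_d)
    (W : 'I_m -> R -> Omega -> R) : one_step_map Omega R d :=
  fun x t delta w =>
    let y := ssbe_Finv f delta (t + delta) x in
    y + \sum_(r < m) (W r (t + delta) w - W r t w) *: g r (t + delta) y.

(* Main.v *)
(* Write e_n = X_h(t_n) - X(t_n), and let y and z be the images of X_h(t_(n-1)) and X(t_(n-1))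
   under the inverse of F_h(t_n, .).  Strong monotonicity gives
     |y - z|^2 + 2 eta h sum_r |g r y - g r z|^2 <= (1 + C h) |e_(n-1)|^2,
   and since eta >= 1 the left side dominates the second moment of the propagated error.
   The local error compares f(t_n, z) and g r(t_n, z) with f(u, X u) and g r(u, X u) on
   [t_(n-1), t_n]; it is O(h) in mean square by Young's inequality, the moment of order 4q - 2
   of X and the increment bound E|X t - X s|^p <= C (t - s)^(p/2), p = (4q - 2)/q in (2, 4).
   Hence E|e_n|^2 <= (1 + C h) E|e_(n-1)|^2 + C h^2, and Gronwall's inequality concludes.

   The stochastic integral enters only through Riemann sums: Lenglart's inequality for sums
   over a grid shows that sum_j phi(tau_j) (W(tau_(j+1)) - W(tau_j)) tends to the Ito integral
   in probability, so every moment bound can be proved for discrete sums, step by step along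
   the grid (for exponent p by the second order expansion of |x|^p), and passed to the limit
   by Fatou's lemma. *)

Require Import Defs.
From mathcomp Require Import ring lra.

Set Implicit Arguments.
Unset Strict Implicit.
Unset Printing Implicit Defensive.

Local Open Scope classical_set_scope.
Local Open Scope ring_scope.

(** * Real powers and the Euclidean norm *)

(** The exact solution is compared through z because X(s) = z - h f(t, z): the new error is then y -
    z plus sums of g(t, y) - g(u, X u) and f(t, z) - f(u, X u) over a fine grid. The diffusion
    difference is split at g(t, z) by (a + b)^2 <= 2 a^2 + 2 b^2, and this factor 2 is what the
    coefficient 2 eta h has to pay for, whence eta >= 1. No constant may be lost there, so Brownian
    variances and the discrete Ito isometry are proved with constant exactly one. The moment 4q - 2
    arises as follows: z - X(s) = h f(t, z) grows like power q, the local Lipschitz weight like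
    power q - 1, and the product of order 2q - 1 is squared. The same moment puts f(X) and g(X) in
    L^p with p = (4q - 2)/q, exactly the exponent that Young's inequality asks of the increments. A
    consistency defect of mean square O(h) costs only O(h^2) per step: noise defects are orthogonal
    to the past, and drift defects are separated with Young weight h. One obstacle is that the past
    is known to be independent of each Brownian increment separately, not of all of them jointly, so
    E[xi dW^r dW^r'] = 0 needs an argument of its own. *)

Section PowR.
Context {R : realType}.
Implicit Types a b c q x y z r : R.

Lemma powR_le a b r : 0 <= r -> 0 <= a -> a <= b -> a `^ r <= b `^ r.
Proof.
by move=> r0 a0 ab; apply: ge0_ler_powR => //; rewrite nnegrE// (le_trans a0).
Qed.

Lemma powR_ge1 a r : 0 <= r -> 1 <= a -> 1 <= a `^ r.
Proof. by move=> r0 a1; rewrite -(powRr0 a) ler_powR. Qed.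

Lemma powRD_ge1 a r x : 1 <= a -> a `^ (r + x) = a `^ r * a `^ x.
Proof. by move=> a1; rewrite powRD//; apply/implyP => _; rewrite gt_eqF// (lt_le_trans ltr01). Qed.

(** Young's inequality for the conjugate pair (4q - 2)/(2q - 2) and (4q - 2)/(2q), with cruder
    constants. At b = a^q all three monomials equal a^(4q - 2), so comparing b with a^q decides
    which term on the right dominates. *)
Lemma young_powR q a b : 1 < q -> 1 <= a -> 0 <= b ->
  a `^ (2 * q - 2) * b ^+ 2 <= a `^ (4 * q - 2) + b `^ ((4 * q - 2) / q).
Proof.
move=> q1 a1 b0; have q0 : 0 < q by lra.
have a0 : 0 <= a by lra.
have [ba|ab] := leP b (a `^ q).
  apply: (@le_trans _ _ (a `^ (4 * q - 2))); last by rewrite lerDl powR_ge0.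
  have -> : 4 * q - 2 = (2 * q - 2) + q * 2%:R by ring.
  rewrite (@powRD_ge1 a (2 * q - 2) (q * 2%:R))// ler_wpM2l ?powR_ge0// powRrM powR_mulrn ?powR_ge0//.
  by apply: lerXn2r => //; rewrite nnegrE powR_ge0.
apply: (@le_trans _ _ (b `^ ((4 * q - 2) / q))); last by rewrite lerDr powR_ge0.
have b1 : 1 <= b by apply: le_trans (ltW ab); apply: powR_ge1 => //; lra.
have -> : (4 * q - 2) / q = q^-1 * (2 * q - 2) + 2%:R by field; rewrite gt_eqF.
rewrite (@powRD_ge1 b (q^-1 * (2 * q - 2)) 2%:R)// powR_mulrn// ler_wpM2r ?sqr_ge0// powRrM powR_le//; first lra.
have -> : a = (a `^ q) `^ q^-1 by rewrite -powRrM divff ?gt_eqF// powRr1.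
by apply: powR_le; rewrite ?powR_ge0 ?invr_ge0 ?ltW.
Qed.

Lemma powR_sum3_le x y z r : 0 <= r -> 0 <= x -> 0 <= y -> 0 <= z ->
  (x + y + z) `^ r <= 3 `^ r * (x `^ r + y `^ r + z `^ r).
Proof.
move=> r0 x0 y0 z0.
have px := powR_ge0 x r; have py := powR_ge0 y r; have pz := powR_ge0 z r.
suff aux w : 0 <= w -> x <= w -> y <= w -> z <= w -> w `^ r <= x `^ r + y `^ r + z `^ r ->
    (x + y + z) `^ r <= 3 `^ r * (x `^ r + y `^ r + z `^ r).
  have [xy|yx] := leP x y.
    have [yz|zy] := leP y z.
      by apply: (aux z) => //; [lra|lra].
    by apply: (aux y) => //; [lra|lra].
  have [xz|zx] := leP x z.
    by apply: (aux z) => //; [lra|lra].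
  by apply: (aux x) => //; lra.
move=> w0 xw yw zw h; apply: (@le_trans _ _ ((3 * w) `^ r)).
  by apply: powR_le => //; lra.
by rewrite powRM// ler_wpM2l ?powR_ge0.
Qed.

End PowR.

Section Euclid.
Context {R : realType} {d : nat}.
Implicit Types x y z : 'rV[R]_d.

Lemma innerC x y : inner x y = inner y x.
Proof. by apply: eq_bigr => i _; rewrite mulrC. Qed.

Lemma innerDl x y z : inner (x + y) z = inner x z + inner y z.
Proof. by rewrite -big_split; apply: eq_bigr => i _; rewrite !mxE mulrDl. Qed.

Lemma innerZl a x y : inner (a *: x) y = a * inner x y.
Proof. by rewrite mulr_sumr; apply: eq_bigr => i _; rewrite !mxE mulrA. Qed.

Lemma innerNl x y : inner (- x) y = - inner x y.
Proof. by rewrite -scaleN1r innerZl mulN1r. Qed.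

Lemma innerDr x y z : inner x (y + z) = inner x y + inner x z.
Proof. by rewrite innerC innerDl !(innerC x). Qed.

Lemma innerZr a x y : inner x (a *: y) = a * inner x y.
Proof. by rewrite innerC innerZl innerC. Qed.

Lemma innerNr x y : inner x (- y) = - inner x y.
Proof. by rewrite innerC innerNl innerC. Qed.

Lemma inner_ge0 x : 0 <= inner x x.
Proof. by apply: sumr_ge0 => i _; rewrite -expr2 sqr_ge0. Qed.

Lemma enorm_ge0 x : 0 <= enorm x.
Proof. exact: sqrtr_ge0. Qed.

Lemma enorm_sqr x : enorm x ^+ 2 = inner x x.
Proof. by rewrite sqr_sqrtr ?inner_ge0. Qed.

Lemma enorm_sqr_sum x : enorm x ^+ 2 = \sum_(i < d) x 0 i ^+ 2.
Proof. by rewrite enorm_sqr; apply: eq_bigr => i _; rewrite expr2. Qed.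

Lemma ler_coord_enorm x i : `|x 0 i| <= enorm x.
Proof.
rewrite -(@ler_pXn2r _ 2)// ?nnegrE ?enorm_ge0// enorm_sqr_sum real_normK ?num_real//.
by rewrite (bigD1 i)//= lerDl sumr_ge0// => j _; rewrite sqr_ge0.
Qed.

Lemma enorm_eq0 x : enorm x = 0 -> x = 0.
Proof.
move=> x0; apply/rowP => i; rewrite mxE; apply/eqP.
by rewrite -normr_le0 -x0 ler_coord_enorm.
Qed.

Lemma enorm0 : enorm (0 : 'rV[R]_d) = 0.
Proof. by rewrite /enorm /inner big1 ?sqrtr0// => i _; rewrite mxE mul0r. Qed.

Lemma enormN x : enorm (- x) = enorm x.
Proof. by rewrite /enorm innerNl innerNr opprK. Qed.

Lemma enormB x y : enorm (x - y) = enorm (y - x).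
Proof. by rewrite -enormN opprB. Qed.

Lemma enormZ a x : enorm (a *: x) = `|a| * enorm x.
Proof.
by rewrite /enorm innerZl innerZr mulrA -expr2 sqrtrM ?sqr_ge0// sqrtr_sqr.
Qed.

Lemma inner_le x y : inner x y <= enorm x * enorm y.
Proof.
have [/enorm_eq0 ->|x0] := eqVneq (enorm x) 0.
  by rewrite enorm0 mul0r /inner big1// => i _; rewrite mxE mul0r.
have [/enorm_eq0 ->|y0] := eqVneq (enorm y) 0.
  by rewrite enorm0 mulr0 innerC /inner big1// => i _; rewrite mxE mul0r.
have xy : 0 < enorm x * enorm y by rewrite mulr_gt0// lt0r ?x0 ?y0 enorm_ge0.
(* Expanding the square gives 2 |x||y| (|x||y| - <x, y>) >= 0, which is Cauchy-Schwarz after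
   division. *)
have := inner_ge0 (enorm y *: x - enorm x *: y).
rewrite innerDl !innerDr !innerNr !innerNl !innerZl !innerZr -!enorm_sqr.
rewrite (innerC y x) => H.
rewrite -subr_ge0 -(pmulr_rge0 _ xy).
move: H; set a := enorm x; set b := enorm y; set c := inner x y => H.
by nra.
Qed.

Lemma inner_le_sqr x y : 2 * inner x y <= enorm x ^+ 2 + enorm y ^+ 2.
Proof.
have := inner_ge0 (x - y); rewrite innerDl !innerDr !innerNr !innerNl -!enorm_sqr.
by rewrite (innerC y x); lra.
Qed.

Lemma enormD x y : enorm (x + y) <= enorm x + enorm y.
Proof.
rewrite -(@ler_pXn2r _ 2)// ?nnegrE ?addr_ge0 ?enorm_ge0//.
rewrite enorm_sqr innerDl !innerDr -!enorm_sqr (innerC y x).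
have := inner_le x y; lra.
Qed.

Lemma enorm_continuous : continuous (@enorm R d).
Proof.
move=> x; apply: (@continuous_comp _ _ _ (fun x => inner x x) Num.sqrt); last exact: sqrt_continuous.
apply: (@continuous_big _ _ +%R _ _ _ _ _ (fun i (x : 'rV[R]_d) => x 0 i * x 0 i)).
  exact: add_continuous.
move=> i _ y.
have cy := @coord_continuous R 1 d 0 i y.
exact: (cvgM cy cy).
Qed.

End Euclid.

(** * The resolvent of the implicit Euler step *)

Section Resolvent.
Context {R : realType} {d m : nat}.
Variables (T : R) (f : R -> 'rV[R]_d -> 'rV[R]_d) (g : 'I_m -> R -> 'rV[R]_d -> 'rV[R]_d).
Variables (L eta q : R).
Hypothesis m_gt0 : (0 < m)%N.
Hypothesis adm : admissible T f g L eta q.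

(** The bounds on [f] are only available inside a maximum with some [g r]; extracting them takes an
    index [r]. *)
Let r0 : 'I_m := Ordinal m_gt0.

Lemma adm_space_f (t : R) x1 x2 : 0 <= t <= T ->
  enorm (f t x1 - f t x2)
    <= L * (1 + enorm x1 `^ (q - 1) + enorm x2 `^ (q - 1)) * enorm (x1 - x2).
Proof. by move=> tT; apply: le_trans (adm_space adm r0 x1 x2 tT); rewrite le_max lexx. Qed.

Lemma adm_space_g r (t : R) x1 x2 : 0 <= t <= T ->
  enorm (g r t x1 - g r t x2)
    <= L * (1 + enorm x1 `^ (q - 1) + enorm x2 `^ (q - 1)) * enorm (x1 - x2).
Proof. by move=> tT; apply: le_trans (adm_space adm r x1 x2 tT); rewrite le_max lexx orbT. Qed.

Lemma adm_growth_f (t : R) x : 0 <= t <= T -> enorm (f t x) <= L * (1 + enorm x `^ q).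
Proof. by move=> tT; apply: le_trans (adm_growth adm r0 x tT); rewrite le_max lexx. Qed.

Lemma adm_growth_g r (t : R) x : 0 <= t <= T -> enorm (g r t x) <= L * (1 + enorm x `^ q).
Proof. by move=> tT; apply: le_trans (adm_growth adm r x tT); rewrite le_max lexx orbT. Qed.

Lemma adm_time_f (t1 t2 : R) x : 0 <= t1 <= T -> 0 <= t2 <= T ->
  enorm (f t1 x - f t2 x) <= L * (1 + enorm x `^ q) * `|t1 - t2| `^ 2^-1.
Proof. by move=> h1 h2; apply: le_trans (adm_time adm r0 x h1 h2); rewrite le_max lexx. Qed.

Lemma adm_time_g r (t1 t2 : R) x : 0 <= t1 <= T -> 0 <= t2 <= T ->
  enorm (g r t1 x - g r t2 x) <= L * (1 + enorm x `^ q) * `|t1 - t2| `^ 2^-1.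
Proof. by move=> h1 h2; apply: le_trans (adm_time adm r x h1 h2); rewrite le_max lexx orbT. Qed.

Lemma within_section_continuous (F : R * 'rV[R]_d -> 'rV[R]_d) (t : R) : 0 <= t <= T ->
  {within [set z : R * 'rV[R]_d | 0 <= z.1 <= T], continuous F} ->
  continuous (fun x => F (t, x)).
Proof.
move=> tT /subspace_continuousP cF x.
apply: (@cvg_comp _ _ _ (fun y => (t, y)) F _ _ _ _ (cF (t, x) tT)).
move=> U; rewrite withinE => -[V [[A B] /= [nA nB] AB] UV].
change (nbhs x [set y | U (t, y)]); apply: filterS nB => y /= By.
have : (U `&` [set z : R * 'rV[R]_d | 0 <= z.1 <= T]) (t, y).
  by rewrite UV; split => //; apply: AB; split => //; exact: nbhs_singleton.
by case.
Qed.

Lemma adm_continuous_f t : 0 <= t <= T -> continuous (f t).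
Proof. by move=> tT; exact: (@within_section_continuous (fun z => f z.1 z.2) t tT (adm_cont_f adm)). Qed.

Lemma adm_continuous_g r t : 0 <= t <= T -> continuous (g r t).
Proof. by move=> tT; exact: (@within_section_continuous (fun z => g r z.1 z.2) t tT (adm_cont_g adm (r:=r))). Qed.

Variables (delta t : R).
Hypothesis delta_gt0 : 0 < delta.
Hypothesis deltaL : delta * L < 1.
Hypothesis tT : 0 <= t <= T.
Local Notation G := (ssbe_F f delta t).
Local Notation H := (ssbe_Finv f delta t).
Let c_gt0 : 0 < 1 - delta * L. Proof. by rewrite subr_gt0. Qed.

(** The one-sided Lipschitz condition multiplied by [delta] and subtracted from |x - y|^2. The
    diffusion sum is kept on the left: it later absorbs the propagated noise. *)
Lemma ssbe_F_strongly_monotone x y :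
  (1 - delta * L) * enorm (x - y) ^+ 2
    + delta * eta * (\sum_(r < m) enorm (g r t x - g r t y) ^+ 2)
  <= inner (G x - G y) (x - y).
Proof.
have H1 := adm_monotone adm x y tT.
have -> : G x - G y = (x - y) - delta *: (f t x - f t y).
  by apply/rowP => i; rewrite /ssbe_F !mxE; ring.
rewrite innerDl innerNl innerZl -enorm_sqr.
have := ler_wpM2l (ltW delta_gt0) H1; rewrite mulrDr !mulrA; lra.
Qed.

Let sum_g_ge0 x y : 0 <= delta * eta * (\sum_(r < m) enorm (g r t x - g r t y) ^+ 2).
Proof.
apply: mulr_ge0; last by apply: sumr_ge0 => r _; exact: sqr_ge0.
apply: mulr_ge0; first exact: ltW.
by apply: le_trans (ltW (adm_eta adm)); rewrite invr_ge0.
Qed.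

Lemma ssbe_F_expanding x y : (1 - delta * L) * enorm (x - y) <= enorm (G x - G y).
Proof.
have [/eqP|xy] := eqVneq (enorm (x - y)) 0.
  by move/eqP => ->; rewrite mulr0 enorm_ge0.
have xy0 : 0 < enorm (x - y) by rewrite lt0r xy enorm_ge0.
rewrite -(ler_pM2r xy0) -mulrA -expr2.
apply: le_trans (inner_le _ _); apply: le_trans (ssbe_F_strongly_monotone x y).
by rewrite lerDl.
Qed.

Lemma ssbe_F_continuous : continuous G.
Proof.
move=> x; apply: (@continuousB R 'rV[R]_d 'rV[R]_d id (fun y => delta *: f t y)).
  exact: cvg_id.
by apply: continuousZl_tmp; exact: adm_continuous_f.
Qed.

(* A minimiser [y] of |G y - b| solves G y = b: otherwise strong monotonicity makes a
   short step against G y - b decrease that distance, with the local Lipschitz bound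
   controlling the second order term. *)
Lemma ssbe_F_surj b : exists y, G y = b.
Proof.
(* Outside the ball of radius [M] the expansion property gives |G y - G 0| > 2 |G 0 - b|, hence |G y
   - b| > |G 0 - b|; a minimiser over the ball is therefore global. *)
set M := (enorm (G 0 - b) + enorm (G 0 - b)) / (1 - delta * L).
have Mge0 : 0 <= M.
  apply: divr_ge0; last exact: ltW.
  by apply: addr_ge0; exact: enorm_ge0.
pose A := [set y : 'rV[R]_d | enorm y <= M].
have A0 : A !=set0 by exists 0; rewrite /A /= enorm0.
have cA : compact A.
  apply: bounded_closed_compact.
    exists M; split; first by rewrite num_real.
    move=> N MN y Ay; change (mx_norm y <= N); rewrite mx_normrE; apply/bigmax_leP; split => /=.
      by rewrite (le_trans Mge0)// ltW.
    move=> [i j] _ /=; rewrite (ord1 i); apply: le_trans (ler_coord_enorm y j) _.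
    by apply: le_trans Ay _; exact: ltW.
  apply: (@preimage_closed _ _ (@enorm R d) [set z | z <= M]).
    by move=> y _; exact: enorm_continuous.
  exact: closed_le.
pose V y := enorm (G y - b).
have cV : continuous V.
  move=> y; apply: (@continuous_comp _ _ _ (fun y => G y - b) (@enorm R d)); last exact: enorm_continuous.
  apply: (@continuousB R 'rV[R]_d 'rV[R]_d G (fun=> b)); last exact: cst_continuous.
  exact: ssbe_F_continuous.
have [y0 _ y0min] := EVT_min_rV A0 cA (continuous_subspaceT cV).
have y0glob y : V y0 <= V y.
  have [yA|yA] := leP (enorm y) M; first by apply: y0min; rewrite inE.
  apply: (@le_trans _ _ (V 0)); first by apply: y0min; rewrite inE /A/= enorm0.
  have h1 := ssbe_F_expanding y 0; rewrite subr0 in h1.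
  have h2 := enormD (G y - b) (b - G 0); rewrite addrA subrK (enormB b) in h2.
  have h3 : (1 - delta * L) * M <= (1 - delta * L) * enorm y by rewrite ler_wpM2l// ltW.
  rewrite /M mulrC divfK ?gt_eqF// in h3; rewrite /V; lra.
exists y0; apply/eqP; rewrite -subr_eq0; apply/eqP/enorm_eq0/eqP.
case: (eqVneq (enorm (G y0 - b)) 0) => // Vne0.
have Vgt0 : 0 < V y0 by rewrite lt0r Vne0 enorm_ge0.
set v := G y0 - b.
have V0E : V y0 = enorm v by [].
(* Lipschitz constant of [f t] between y0 and any point y0 - rho v with 0 <= rho <= 1, all of norm
   at most |y0| + |v|. *)
pose N := L * (1 + enorm y0 `^ (q - 1) + (enorm y0 + enorm v) `^ (q - 1)).
have L0 := adm_L adm.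
have N0 : 0 <= N.
  by rewrite /N mulr_ge0 ?(ltW L0)// !addr_ge0 ?powR_ge0.
pose K := 1 + delta * N.
have K1 : 1 <= K by rewrite /K lerDl mulr_ge0// ltW.
have lipG rho : 0 <= rho <= 1 -> enorm (G (y0 - rho *: v) - G y0) <= K * (rho * enorm v).
  move=> /andP[rho0 rho1].
  have -> : G (y0 - rho *: v) - G y0 = - (rho *: v) - delta *: (f t (y0 - rho *: v) - f t y0).
    by apply/rowP => i; rewrite /ssbe_F !mxE; ring.
  apply: le_trans (enormD _ _) _; rewrite !enormN !enormZ (ger0_norm rho0) (gtr0_norm delta_gt0).
  rewrite /K mulrDl mul1r lerD2l -mulrA ler_pM2l//.
  apply: le_trans (adm_space_f _ _ tT) _.
  have -> : y0 - rho *: v - y0 = - (rho *: v) by rewrite addrAC subrr add0r.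
  rewrite enormN enormZ (ger0_norm rho0) ler_wpM2r ?mulr_ge0 ?enorm_ge0//.
  rewrite /N ler_pM2l// addrAC lerD2l; apply: ge0_ler_powR.
  - by rewrite subr_ge0 ltW// (adm_q adm).
  - by rewrite nnegrE enorm_ge0.
  - by rewrite nnegrE addr_ge0 ?enorm_ge0.
  - apply: le_trans (enormD _ _) _; rewrite enormN enormZ (ger0_norm rho0) lerD2l.
    by rewrite ler_piMl ?enorm_ge0.
pose c := 1 - delta * L.
(* Moving by - rho v changes |G y - b|^2 by at most (- 2 c rho + rho^2 K^2) |v|^2. This [rho] lies
   in (0, 1] and satisfies rho K^2 < c, which makes the change negative. *)
pose rho := c / (c + K ^+ 2).
have cK : 0 < c + K ^+ 2 by rewrite addr_gt0 ?exprn_gt0// ?(lt_le_trans ltr01)//; exact: c_gt0.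
have rho0 : 0 < rho by rewrite /rho divr_gt0//; exact: c_gt0.
have rho1 : rho <= 1 by rewrite /rho ler_pdivrMr// mul1r lerDl sqr_ge0.
have rhoK : rho * K ^+ 2 < c.
  rewrite /rho mulrAC ltr_pdivrMr// ltr_pM2l// ltrDr; exact: c_gt0.
set y1 := y0 - rho *: v.
have h1 : enorm (G y1 - G y0) <= K * (rho * enorm v) by apply: lipG; rewrite ltW.
have h2 := ssbe_F_strongly_monotone y1 y0.
have h3 := sum_g_ge0 y1 y0.
have y10 : y1 - y0 = - (rho *: v) by rewrite /y1 addrAC subrr add0r.
rewrite y10 enormN enormZ (gtr0_norm rho0) innerNr innerZr in h2.
have h4 : V y1 ^+ 2 = enorm v ^+ 2 + 2 * inner (G y1 - G y0) v + enorm (G y1 - G y0) ^+ 2.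
  rewrite /V; have -> : G y1 - b = (G y1 - G y0) + v by rewrite addrA subrK.
  move: (G y1 - G y0) (v) => u w.
  by rewrite !enorm_sqr innerDl !innerDr (innerC w u); ring.
have h5 := y0glob y1; rewrite -(@ler_pXn2r _ 2)// ?nnegrE ?enorm_ge0// h4 V0E in h5.
have h6 : enorm (G y1 - G y0) ^+ 2 <= (K * (rho * enorm v)) ^+ 2.
  by rewrite ler_pXn2r ?nnegrE ?enorm_ge0//; exact: le_trans (enorm_ge0 _) h1.
have h7 : inner (G y1 - G y0) v <= - (c * rho * enorm v ^+ 2).
  have alg (c' r e i S : R) : 0 < r -> 0 <= S -> c' * (r * e) ^+ 2 + S <= - (r * i) ->
      i <= - (c' * r * e ^+ 2).
    move=> r_gt0 S0 h; rewrite -(ler_pM2l r_gt0).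
    have -> : r * - (c' * r * e ^+ 2) = - (c' * (r * e) ^+ 2) by ring.
    lra.
  exact: alg rho0 h3 h2.
have h8 : 0 < enorm v ^+ 2 by rewrite exprn_gt0.
have alg (c' r e k : R) : 0 < c' -> 0 < r -> 0 < e ^+ 2 -> r * k ^+ 2 < c' ->
    2 * (c' * r * e ^+ 2) <= (k * (r * e)) ^+ 2 -> False.
  move=> c0 r_gt0 e0 rk.
  have -> : (k * (r * e)) ^+ 2 = (r * k ^+ 2) * (r * e ^+ 2) by ring.
  have -> : 2 * (c' * r * e ^+ 2) = (2 * c') * (r * e ^+ 2) by ring.
  rewrite (ler_pM2r (mulr_gt0 r_gt0 e0)) => ?; lra.
have alg' (E i n a b' : R) : E <= E + 2 * i + n -> n <= a -> i <= - b' -> 2 * b' <= a.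
  by move=> ? ? ?; lra.
by exfalso; apply: (alg c rho (enorm v) K) => //; exact: alg' h5 h6 h7.
Qed.

Lemma ssbe_FK b : G (H b) = b.
Proof.
rewrite /ssbe_Finv pinvK// inE; have [y yb] := ssbe_F_surj b.
by exists y.
Qed.

Lemma ssbe_Finv_eq b : H b = b + delta *: f t (H b).
Proof. by rewrite -{2}(ssbe_FK b) /ssbe_F subrK. Qed.

Lemma ssbe_Finv_lipschitz a b : enorm (H a - H b) <= (1 - delta * L)^-1 * enorm (a - b).
Proof.
rewrite mulrC ler_pdivlMr// mulrC.
by have := ssbe_F_expanding (H a) (H b); rewrite !ssbe_FK.
Qed.

Lemma ssbe_Finv_continuous : continuous H.
Proof.
move=> a; have FF := @nbhs_filter 'rV[R]_d a; apply/cvgrPdist_lt => e e0.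
have : {for a, continuous (fun b : 'rV[R]_d => enorm (b - a))}.
  apply: (@continuous_comp _ _ _ (fun b : 'rV[R]_d => (b - a : 'rV[R]_d)) (@enorm R d)); last exact: enorm_continuous.
  apply: (@continuousB R 'rV[R]_d 'rV[R]_d id (fun=> a)); last exact: cst_continuous.
  exact: cvg_id.
rewrite /prop_for /continuous_at subrr enorm0.
move=> /cvgrPdist_lt/(_ (e * (1 - delta * L)) (mulr_gt0 e0 c_gt0)).
apply: filterS => b; rewrite sub0r normrN ger0_norm ?enorm_ge0// => ab.
change (mx_norm (H a - H b) < e); rewrite mx_normrE; apply/bigmax_ltP; split => //= -[i j] _ /=.
rewrite (ord1 i); apply: le_lt_trans (ler_coord_enorm _ j) _.
apply: le_lt_trans (ssbe_Finv_lipschitz _ _) _.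
by rewrite mulrC ltr_pdivrMr// enormB.
Qed.

(** Twice the strong monotonicity together with 2 <a - b, Ha - Hb> <= |a - b|^2 + |Ha - Hb|^2 leaves
    an excess 2 delta L |Ha - Hb|^2, which the Lipschitz bound of the inverse turns into a multiple
    of delta |a - b|^2. *)
Lemma ssbe_Finv_stable a b :
  enorm (H a - H b) ^+ 2
    + 2 * delta * eta * (\sum_(r < m) enorm (g r t (H a) - g r t (H b)) ^+ 2)
  <= (1 + 2 * delta * L / (1 - delta * L) ^+ 2) * enorm (a - b) ^+ 2.
Proof.
have h1 := ssbe_F_strongly_monotone (H a) (H b).
have h2 := inner_le_sqr (a - b) (H a - H b); rewrite !ssbe_FK in h1.
have h3 : enorm (H a - H b) ^+ 2 <= ((1 - delta * L)^-1 * enorm (a - b)) ^+ 2.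
  have lip := ssbe_Finv_lipschitz a b.
  by apply: lerXn2r; rewrite ?nnegrE ?enorm_ge0// (le_trans _ lip)// enorm_ge0.
have := ler_wpM2l (mulr_ge0 (ltW delta_gt0) (ltW (adm_L adm))) h3.
rewrite exprMn exprVn -!mulrA; move: h1 h2; set Y := \sum_(r < m) _.
rewrite -!mulrA; lra.
Qed.

(** Expansion between H a and 0, where |G 0| = delta |f t 0| <= delta L < 1. *)
Lemma ssbe_Finv_growth a : enorm (H a) <= (1 - delta * L)^-1 * (1 + enorm a).
Proof.
have dL := ltW deltaL; have := ssbe_F_expanding (H a) 0; rewrite ssbe_FK subr0 => h.
rewrite mulrC ler_pdivlMr// mulrC; apply: le_trans h _.
have -> : G 0 = - (delta *: f t 0) by rewrite /ssbe_F sub0r.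
rewrite opprK; apply: le_trans (enormD _ _) _; rewrite addrC lerD2r enormZ gtr0_norm//.
apply: le_trans dL; rewrite ler_pM2l//; apply: le_trans (adm_growth_f _ tT) _.
by rewrite enorm0 powR0 ?addr0 ?mulr1// gt_eqF// (lt_trans ltr01)// (adm_q adm).
Qed.

(** Insert [phi t x]. The spatial part is controlled by the weight a^(q - 1) times |z - x| <= delta
    |f t z| + |x - x0|, where [f] contributes a^q; the temporal part is the hypothesis on
    [phi t x - phi s x]. With a = 1 + |x0| + |x| everything is a power of [a], except for the
    increment, which needs Young's inequality. *)
Lemma ssbe_consistency (phi : R -> 'rV[R]_d -> 'rV[R]_d) (K s : R) (x0 x : 'rV[R]_d) :
  (forall x1 x2, enorm (phi t x1 - phi t x2)
    <= L * (1 + enorm x1 `^ (q - 1) + enorm x2 `^ (q - 1)) * enorm (x1 - x2)) ->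
  enorm (phi t x - phi s x) <= L * (1 + enorm x `^ q) * Num.sqrt delta ->
  (1 - delta * L)^-1 <= K -> Num.sqrt delta <= K ->
  enorm (phi t (H x0) - phi s x) ^+ 2
  <= (2 * (L * (2 + K `^ (q - 1)) * (L * (1 + K `^ q)) * K + 2 * L) ^+ 2
      + 2 * (L * (2 + K `^ (q - 1))) ^+ 2) * delta
     * ((1 + enorm x0 + enorm x) `^ (4 * q - 2)
        + (enorm (x - x0) / Num.sqrt delta) `^ ((4 * q - 2) / q)).
Proof.
move=> spc tim K1 K2.
have L0 := adm_L adm; have q1 := adm_q adm.
set a := 1 + enorm x0 + enorm x; set z := H x0; set rd := Num.sqrt delta.
have e0 := enorm_ge0 x0; have e1 := enorm_ge0 x.
have a1 : 1 <= a by rewrite /a; lra.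
have K0 : 0 <= K by apply: le_trans K1; rewrite invr_ge0 ltW.
have q0 : 0 <= q by lra.
have q10 : 0 <= q - 1 by lra.
have rd0 : 0 < rd by rewrite sqrtr_gt0.
have rd2 : rd ^+ 2 = delta by rewrite sqr_sqrtr// ltW.
have zK : enorm z <= K * a.
  apply: le_trans (ssbe_Finv_growth x0) _; apply: ler_pM => //.
  - by rewrite invr_ge0 ltW.
  - lra.
  - by rewrite /a; lra.
have pw r : 0 <= r -> enorm z `^ r <= K `^ r * a `^ r.
  move=> r_ge0; rewrite -powRM//; last lra.
  by apply: powR_le => //; exact: enorm_ge0.
have pa r : 0 <= r -> enorm x `^ r <= a `^ r.
  by move=> r_ge0; apply: powR_le => //; rewrite /a; lra.
have aq1 := powR_ge1 q10 a1; have aq := powR_ge1 q0 a1.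
have aqq : a `^ q * a `^ (q - 1) = a `^ (2 * q - 1).
  by rewrite -powRD_ge1//; congr (_ `^ _); ring.
have D0 := enorm_ge0 (x - x0).
set A := L * (2 + K `^ (q - 1)); set B := L * (1 + K `^ q).
have A0 : 0 <= A by rewrite /A mulr_ge0 ?(ltW L0)// addr_ge0 ?powR_ge0.
have B0 : 0 <= B by rewrite /B mulr_ge0 ?(ltW L0)// addr_ge0 ?powR_ge0.
have zx0 : enorm (z - x0) <= delta * (B * a `^ q).
  have -> : z - x0 = delta *: f t z by rewrite {1}/z ssbe_Finv_eq addrC addKr.
  rewrite enormZ gtr0_norm// ler_pM2l//; apply: le_trans (adm_growth_f _ tT) _.
  rewrite /B -mulrA ler_pM2l// mulrDl mul1r; have := pw q q0; lra.
have zx : enorm (z - x) <= delta * (B * a `^ q) + enorm (x - x0).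
  have -> : z - x = (z - x0) + (x0 - x) by rewrite addrA subrK.
  by apply: le_trans (enormD _ _) _; rewrite (enormB x0) lerD2r.
have main : enorm (phi t z - phi s x)
    <= (A * B * K + 2 * L) * rd * a `^ (2 * q - 1) + A * (a `^ (q - 1) * enorm (x - x0)).
  have -> : phi t z - phi s x = (phi t z - phi t x) + (phi t x - phi s x).
    by rewrite addrA subrK.
  apply: le_trans (enormD _ _) _.
  have s1 : enorm (phi t z - phi t x) <= A * a `^ (q - 1) * (delta * (B * a `^ q) + enorm (x - x0)).
    apply: le_trans (spc _ _) _; apply: ler_pM => //.
    - by rewrite mulr_ge0 ?(ltW L0)// ?addr_ge0 ?powR_ge0.
    - exact: enorm_ge0.
    - rewrite /A -mulrA ler_pM2l// mulrDl.
      by have := pw _ q10; have := pa _ q10; lra.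
  have s2 : enorm (phi t x - phi s x) <= 2 * L * rd * a `^ (2 * q - 1).
    apply: le_trans tim _; rewrite -mulrA -[leRHS]mulrA [2 * L]mulrC -[leRHS]mulrA ler_pM2l//.
    rewrite mulrCA mulrC ler_pM2l//.
    apply: (@le_trans _ _ (2 * a `^ q)); first by have := pa _ q0; lra.
    by rewrite ler_pM2l// -aqq ler_peMr// powR_ge0.
  have s3 : delta * (A * B * a `^ (2 * q - 1)) <= rd * K * (A * B * a `^ (2 * q - 1)).
    apply: ler_wpM2r; first exact: mulr_ge0 (mulr_ge0 A0 B0) (powR_ge0 _ _).
    by rewrite -rd2 expr2 ler_pM2l.
  have s4 : A * a `^ (q - 1) * (delta * (B * a `^ q)) = delta * (A * B * a `^ (2 * q - 1)).
    by rewrite -aqq; ring.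
  rewrite mulrDr s4 in s1; lra.
(* The increment is divided by sqrt delta, its natural size over a time of order delta, so that both
   terms on the right are of order one. *)
have yg := young_powR q1 a1 (divr_ge0 D0 (ltW rd0)).
have sq : enorm (phi t z - phi s x) ^+ 2 <= ((A * B * K + 2 * L) * rd * a `^ (2 * q - 1)
    + A * (a `^ (q - 1) * enorm (x - x0))) ^+ 2.
  by apply: lerXn2r => //; rewrite nnegrE ?enorm_ge0// (le_trans _ main)// enorm_ge0.
apply: le_trans sq _; apply: le_trans (_ : _ <= 2 * ((A * B * K + 2 * L) * rd * a `^ (2 * q - 1)) ^+ 2
   + 2 * (A * (a `^ (q - 1) * enorm (x - x0))) ^+ 2) _.
  move: ((A * B * K + 2 * L) * rd * a `^ (2 * q - 1)) (A * (a `^ (q - 1) * enorm (x - x0))) => u v.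
  by have := sqr_ge0 (u - v); nra.
have -> : (A * (a `^ (q - 1) * enorm (x - x0))) ^+ 2
    = A ^+ 2 * delta * (a `^ (2 * q - 2) * (enorm (x - x0) / rd) ^+ 2).
  have <- : (a `^ (q - 1)) ^+ 2 = a `^ (2 * q - 2).
    by rewrite -powR_mulrn ?powR_ge0// -powRrM; congr (_ `^ _); ring.
  by rewrite -rd2; field; rewrite gt_eqF.
have -> : ((A * B * K + 2 * L) * rd * a `^ (2 * q - 1)) ^+ 2
    = (A * B * K + 2 * L) ^+ 2 * delta * a `^ (4 * q - 2).
  have <- : (a `^ (2 * q - 1)) ^+ 2 = a `^ (4 * q - 2).
    by rewrite -powR_mulrn ?powR_ge0// -powRrM; congr (_ `^ _); ring.
  by rewrite -rd2; ring.
have dA : 0 <= A ^+ 2 * delta by rewrite mulr_ge0 ?sqr_ge0// ltW.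
have dB : 0 <= (A * B * K + 2 * L) ^+ 2 * delta by rewrite mulr_ge0 ?sqr_ge0// ltW.
have h1 := ler_wpM2l dA yg.
have h2 := mulr_ge0 dB (powR_ge0 (enorm (x - x0) / rd) ((4 * q - 2) / q)).
rewrite -/A -/B.
move: h1 h2 ; clear.
move: (a `^ (2 * q - 2) * _) (a `^ (4 * q - 2)) (_ `^ ((4 * q - 2) / q)) => Y U V.
have -> : (2 * (A * B * K + 2 * L) ^+ 2 + 2 * A ^+ 2) * delta * (U + V)
  = 2 * ((A * B * K + 2 * L) ^+ 2 * delta * U) + 2 * ((A * B * K + 2 * L) ^+ 2 * delta * V)
   + 2 * (A ^+ 2 * delta * (U + V)) by ring.
move: (A ^+ 2 * delta * _) (A ^+ 2 * delta * _) (_ * U) (_ * V) => x1 x2 x3 x4 h1 h2.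
lra.
Qed.

End Resolvent.

(** * Measurability and expectations *)

Section MeasurableWrt.
Context {disp : measure_display} {Omega : measurableType disp} {R : realType}.
Implicit Types (G : set (set Omega)) (Y Z : Omega -> R).

(** Bridge to measurable functions on [Omega] equipped with [G], through which the closure
    properties below are inherited. *)
Lemma measurable_wrtP G Y : sigma_algebra setT G ->
  measurable_wrt G Y <-> measurable_fun setT (Y : g_sigma_algebraType G -> R).
Proof.
move=> sG; split=> [mY _ B mB|mY B mB].
  by rewrite setTI measurable_g_measurableTypeE//; exact: mY.
by have := mY measurableT B mB; rewrite setTI measurable_g_measurableTypeE.
Qed.

Lemma measurable_wrt_sub G1 G2 Y : G1 `<=` G2 -> measurable_wrt G1 Y -> measurable_wrt G2 Y.
Proof. by move=> G12 mY B /mY /G12. Qed.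

Lemma measurable_wrt_fun G Y : G `<=` measurable -> measurable_wrt G Y -> measurable_fun setT Y.
Proof. by move=> GF mY _ B mB; rewrite setTI; apply: GF; exact: mY. Qed.

Section closure.
Variable G : set (set Omega).
Hypothesis sG : sigma_algebra setT G.

Lemma measurable_wrt_cst a : measurable_wrt G (fun=> a : R).
Proof. by apply/measurable_wrtP. Qed.

Lemma measurable_wrtD Y Z : measurable_wrt G Y -> measurable_wrt G Z ->
  measurable_wrt G (fun w => Y w + Z w).
Proof.
move=> /(measurable_wrtP _ sG) mY /(measurable_wrtP _ sG) mZ; apply/measurable_wrtP => //.
exact: measurable_funD.
Qed.

Lemma measurable_wrtB Y Z : measurable_wrt G Y -> measurable_wrt G Z ->
  measurable_wrt G (fun w => Y w - Z w).
Proof.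
move=> /(measurable_wrtP _ sG) mY /(measurable_wrtP _ sG) mZ; apply/measurable_wrtP => //.
exact: measurable_funB.
Qed.

Lemma measurable_wrtM Y Z : measurable_wrt G Y -> measurable_wrt G Z ->
  measurable_wrt G (fun w => Y w * Z w).
Proof.
move=> /(measurable_wrtP _ sG) mY /(measurable_wrtP _ sG) mZ; apply/measurable_wrtP => //.
exact: measurable_funM.
Qed.

Lemma measurable_wrt_sum (I : Type) (s : seq I) (Q : pred I) (h : I -> Omega -> R) :
  (forall i, Q i -> measurable_wrt G (h i)) ->
  measurable_wrt G (fun w => \sum_(i <- s | Q i) h i w).
Proof.
elim: s => [_|i s ih hs].
  have -> : (fun w => \sum_(i <- [::] | Q i) h i w) = fun=> 0.
    by apply/funext => w; rewrite big_nil.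
  exact: measurable_wrt_cst.
have -> : (fun w => \sum_(j <- i :: s | Q j) h j w) =
    fun w => (if Q i then h i w else 0) + \sum_(j <- s | Q j) h j w.
  by apply/funext => w; rewrite big_cons; case: ifP => //; rewrite add0r.
apply: measurable_wrtD; last exact: ih.
by case Qi : (Q i); [exact: hs|exact: measurable_wrt_cst].
Qed.

Lemma measurable_wrt_comp (k : R -> R) Y : measurable_fun setT k -> measurable_wrt G Y ->
  measurable_wrt G (fun w => k (Y w)).
Proof.
by move=> mk mY B mB; rewrite -/(k \o Y) comp_preimage; apply: mY; rewrite -[_ @^-1` _]setTI; exact: mk.
Qed.

End closure.

(* Every open set of row vectors is a countable union of rational boxes. *)
Lemma measurable_wrt_continuous (d : nat) G (phi : 'rV[R]_d -> R) (Y : Omega -> 'rV[R]_d) :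
  sigma_algebra setT G -> continuous phi -> vmeasurable_wrt G Y ->
  measurable_wrt G (fun w => phi (Y w)).
Proof.
move=> sG cphi mY; apply/measurable_wrtP => //.
pose box (c : 'rV[rat]_d * nat) : set 'rV[R]_d :=
  [set x | forall i, `|x 0 i - ratr (c.1 0 i)| < c.2.+1%:R^-1].
have mbox c : @measurable _ (g_sigma_algebraType G) (Y @^-1` box c).
  have -> : Y @^-1` box c = \bigcap_(i in [set: 'I_d])
      ((fun w => Y w 0 i) @^-1` [set x | `|x - ratr (c.1 0 i)| < c.2.+1%:R^-1]).
    by apply/seteqP; split => [w h i _|w h i]; exact: h.
  apply: fin_bigcap_measurable => // i _.
  rewrite measurable_g_measurableTypeE//; apply: mY.
  have -> : [set x : R | `|x - ratr (c.1 0 i)| < c.2.+1%:R^-1] = ball (ratr (c.1 0 i) : R) c.2.+1%:R^-1.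
    by apply/seteqP; split => x; rewrite /ball/= distrC.
  exact: measurable_ball.
apply: (measurability _ (RGenOpens.measurableE R)).
move=> _ [_ [a [b ->]] <-]; rewrite setTI.
have -> : (fun w => phi (Y w)) @^-1` `]a, b[ =
    \bigcup_(c in [set: 'rV[rat]_d * nat])
      (if `[< box c `<=` phi @^-1` `]a, b[ >] then Y @^-1` box c else set0).
  apply/seteqP; split => [w /= wab|w [c _]]; last first.
    by case: ifPn => // /asboolP h /h.
  have : nbhs (Y w) (phi @^-1` `]a, b[).
    by apply: cphi; apply: open_nbhs_nbhs; split => //; exact: interval_open.
  move=> /nbhs_ballP[e /= e0 be].
  (* Two points of one box are less than 2/(k + 1) < e apart in the maximum norm, so any box of this
     size containing Y w lies in the ball of radius e. *)
  have [k ke] : exists k : nat, k.+1%:R^-1 < e / 2.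
    have e20 : 0 < e / 2 by rewrite divr_gt0.
    have := near_infty_natSinv_lt (PosNum e20).
    by move=> [k _ /(_ k (leqnn k))]; exists k.
  have kpos : 0 < k.+1%:R^-1 :> R by rewrite invr_gt0.
  have q_ex i : exists q : rat, `|Y w 0 i - ratr q| < k.+1%:R^-1.
    have [q] : exists q, ratr q \in `](Y w 0 i - k.+1%:R^-1), (Y w 0 i + k.+1%:R^-1)[.
      by apply: rat_in_itvoo; move: kpos; move: (k.+1%:R^-1) => u; lra.
    by rewrite in_itv/= => /andP[h1 h2]; exists q; rewrite ltr_norml; apply/andP; split; move: h1 h2; move: (k.+1%:R^-1) => u; lra.
  pose c := (\row_i projT1 (cid (q_ex i)), k).
  have cw : box c (Y w) by move=> i; rewrite mxE/=; exact: projT2 (cid (q_ex i)).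
  exists c => //; rewrite ifT//; apply/asboolP => x xc; apply: be; split => // i j.
  rewrite (ord1 i); have h1 := cw j; have h2 := xc j; rewrite /= in h1 h2.
  rewrite /ball/= (splitr e) -(subrKA (ratr (c.1 0 j) : R)).
  apply: le_lt_trans (ler_normD _ _) _; apply: ltrD; first exact: lt_trans h1 ke.
  by rewrite distrC; exact: lt_trans h2 ke.
apply: countable_bigcupT_measurable; first exact: countableP.
by move=> c; case: ifP.
Qed.

Lemma measurable_wrt_coord d (G : set (set Omega)) (phi : 'rV[R]_d -> 'rV[R]_d)
    (Y : Omega -> 'rV[R]_d) i :
  sigma_algebra setT G -> continuous phi -> vmeasurable_wrt G Y ->
  measurable_wrt G (fun w => phi (Y w) 0 i).
Proof.
move=> sG cphi mY; apply: (@measurable_wrt_continuous d G (fun y => phi y 0 i)) => // y.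
apply: (@cvg_comp _ _ _ phi (fun y : 'rV[R]_d => y 0 i) _ _ _ (cphi y)).
exact: coord_continuous.
Qed.

End MeasurableWrt.

Section Expectation.
Context {disp : measure_display} {Omega : measurableType disp} {R : realType}.
Variable P : probability Omega R.
Implicit Types (X Y Z : Omega -> R).

(** [Ex] is a real number also for a variable that is not integrable, where its value means nothing.
    Moment bounds are therefore stated as pairs of [intg] and an inequality for [Ex]. *)
Definition intg Y : Prop := P.-integrable setT (EFin \o Y).
Definition Ex Y : R := (\int[P]_w Y w)%R.

Lemma intgD Y Z : intg Y -> intg Z -> intg (fun w => Y w + Z w).
Proof. by move=> iY iZ; exact: (@integrableD _ _ _ _ _ measurableT _ _ iY iZ). Qed.

Lemma intgZ a Y : intg Y -> intg (fun w => a * Y w).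
Proof. by move=> iY; exact: (@integrableZl _ _ _ _ _ measurableT a _ iY). Qed.

Lemma intgN Y : intg Y -> intg (fun w => - Y w).
Proof. by move=> iY; exact: (@integrableN _ _ _ _ _ _ iY). Qed.

Lemma intgB Y Z : intg Y -> intg Z -> intg (fun w => Y w - Z w).
Proof. by move=> iY /intgN; exact: intgD. Qed.

Lemma intg_cst a : intg (fun=> a).
Proof. exact: (@finite_measure_integrable_cst _ _ _ P _ a measurableT). Qed.

Lemma intg_sum (I : Type) (s : seq I) (Q : pred I) (h : I -> Omega -> R) :
  (forall i, Q i -> intg (h i)) -> intg (fun w => \sum_(i <- s | Q i) h i w).
Proof.
move=> ih; rewrite /intg.
have -> : EFin \o (fun w => \sum_(i <- s | Q i) h i w) =
    (fun w => \sum_(i <- s | Q i) (EFin \o h i) w)%E.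
  by apply/funext => w /=; rewrite sumEFin.
by apply: integrable_sum => // i /ih.
Qed.

Lemma intg_le Y Z : measurable_fun setT Y -> (forall w, `|Y w| <= Z w) -> intg Z -> intg Y.
Proof.
move=> mY YZ; apply: le_integrable => //; first exact/measurable_EFinP.
by move=> w _ /=; rewrite lee_fin (le_trans (YZ w))// ler_norm.
Qed.

Lemma intg_norm Y : intg Y -> intg (fun w => `|Y w|).
Proof.
move=> iY; rewrite /intg; have := integrable_abse iY.
by apply: eq_integrable.
Qed.

Lemma intg_mul X Y : measurable_fun setT X -> measurable_fun setT Y ->
  intg (fun w => X w ^+ 2) -> intg (fun w => Y w ^+ 2) -> intg (fun w => X w * Y w).
Proof.
move=> mX mY iX iY; apply: (@intg_le _ (fun w => X w ^+ 2 + Y w ^+ 2)).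
- exact: measurable_funM.
- move=> w; rewrite ler_norml; have := sqr_ge0 (X w - Y w); have := sqr_ge0 (X w + Y w).
  by have := sqr_ge0 (X w); have := sqr_ge0 (Y w); nra.
- exact: intgD.
Qed.

Lemma intg_sqrD X Y : measurable_fun setT X -> measurable_fun setT Y ->
  intg (fun w => X w ^+ 2) -> intg (fun w => Y w ^+ 2) -> intg (fun w => (X w + Y w) ^+ 2).
Proof.
move=> mX mY iX iY.
have -> : (fun w => (X w + Y w) ^+ 2) = fun w => X w ^+ 2 + 2 * (X w * Y w) + Y w ^+ 2.
  by apply/funext => w; ring.
by apply: intgD => //; apply: intgD => //; apply: intgZ; exact: intg_mul.
Qed.

Lemma Ex_EFin Y : intg Y -> ((Ex Y)%:E = \int[P]_w (Y w)%:E)%E.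
Proof. by move=> iY; rewrite /Ex /Rintegral fineK//; exact: integrable_fin_num. Qed.

Lemma ExD Y Z : intg Y -> intg Z -> Ex (fun w => Y w + Z w) = Ex Y + Ex Z.
Proof. by move=> iY iZ; exact: RintegralD. Qed.

Lemma ExB Y Z : intg Y -> intg Z -> Ex (fun w => Y w - Z w) = Ex Y - Ex Z.
Proof. by move=> iY iZ; exact: RintegralB. Qed.

Lemma ExZ a Y : intg Y -> Ex (fun w => a * Y w) = a * Ex Y.
Proof. by move=> iY; exact: RintegralZl. Qed.

Lemma Ex_cst a : Ex (fun=> a) = a.
Proof.
rewrite /Ex Rintegral_cst// -[RHS]mulr1; congr (_ * _).
exact: (congr1 fine (@probability_setT _ _ _ P)).
Qed.

Lemma Ex_sum (I : Type) (s : seq I) (Q : pred I) (h : I -> Omega -> R) :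
  (forall i, Q i -> intg (h i)) ->
  Ex (fun w => \sum_(i <- s | Q i) h i w) = \sum_(i <- s | Q i) Ex (h i).
Proof.
elim: s => [_|i s ih hs].
  by rewrite big_nil -[RHS](Ex_cst 0); congr Ex; apply/funext => w; rewrite big_nil.
rewrite big_cons; case: ifPn => Qi.
  rewrite -ih// -ExD; [|exact: hs|exact: intg_sum].
  by congr Ex; apply/funext => w; rewrite big_cons Qi.
by rewrite -ih//; congr Ex; apply/funext => w; rewrite big_cons (negbTE Qi).
Qed.

Lemma Ex_le Y Z : intg Y -> intg Z -> (forall w, Y w <= Z w) -> Ex Y <= Ex Z.
Proof. by move=> iY iZ YZ; apply: le_Rintegral. Qed.

Lemma Ex_ge0 Y : (forall w, 0 <= Y w) -> 0 <= Ex Y.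
Proof. by move=> Y0; apply: Rintegral_ge0. Qed.

Lemma Ex_norm_le Y : intg Y -> `|Ex Y| <= Ex (fun w => `|Y w|).
Proof. by move=> iY; exact: le_normr_Rintegral. Qed.

Lemma intg_ge0_le Y c : measurable_fun setT Y -> (forall w, 0 <= Y w) ->
  (\int[P]_w (Y w)%:E <= c%:E)%E -> intg Y /\ Ex Y <= c.
Proof.
move=> mY Y0 Yc.
have iY : intg Y.
  apply/integrableP; split; first exact/measurable_EFinP.
  apply: (@le_lt_trans _ _ c%:E); last exact: ltry.
  by under eq_integral do rewrite /= ger0_norm//.
by split => //; rewrite -lee_fin Ex_EFin.
Qed.

Lemma Ex_indic A : measurable A -> (Ex (\1_A))%:E = P A.
Proof.
move=> mA; rewrite Ex_EFin; last exact: integrable_indic.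
by rewrite integral_indic// setIT.
Qed.

Lemma intg_indic A : measurable A -> intg \1_A.
Proof. by move=> mA; exact: integrable_indic. Qed.

Lemma Ex_dominated (Y_ : nat -> Omega -> R) Y Z c :
  (forall n, measurable_fun setT (Y_ n)) -> measurable_fun setT Y ->
  (forall n w, `|Y_ n w| <= Z w) -> intg Z ->
  (forall w, Y_ n w @[n --> \oo] --> Y w) -> (forall n, Ex (Y_ n) = c) -> Ex Y = c.
Proof.
move=> mY_ mY YZ iZ YY Yc.
have iY n : intg (Y_ n) by exact: intg_le (YZ n) iZ.
have mE_ n : measurable_fun setT (EFin \o Y_ n) by exact/measurable_EFinP.
have mE : measurable_fun setT (EFin \o Y) by exact/measurable_EFinP.
have ae1 : {ae P, forall w, setT w -> (EFin \o Y_ n) w @[n --> \oo] --> (EFin \o Y) w}.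
  by apply: aeW => w _; apply: cvg_EFin; [exact: nearW|exact: YY].
have ae2 : {ae P, forall w n, setT w -> (`|(EFin \o Y_ n) w| <= (EFin \o Z) w)%E}.
  by apply: aeW => w n _ /=; rewrite lee_fin.
have [i _] := dominated_convergence measurableT mE_ mE ae1 iZ ae2.
have -> : [sequence (\int[P]_x (EFin \o Y_ n) x)%E]_n = fun=> c%:E.
  by apply/funext => n /=; rewrite -Ex_EFin// Yc.
move=> /(cvg_unique (@ereal_hausdorff R)) h.
by apply: EFin_inj; rewrite Ex_EFin//; apply: h; exact: cvg_cst.
Qed.

End Expectation.

(** * Products of independent random variables *)

Section Independence.
Context {disp : measure_display} {Omega : measurableType disp} {R : realType}.
Variable P : probability Omega R.
Variables X Y : Omega -> R.
Hypotheses (mX : measurable_fun setT X) (mY : measurable_fun setT Y).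
Hypothesis XY : forall A B : set R, measurable A -> measurable B ->
  (P (X @^-1` A `&` Y @^-1` B) = P (X @^-1` A) * P (Y @^-1` B))%E.

Let Xm : {RV P >-> R} := MeasurableFun.Pack (MeasurableFun.Class (isMeasurableFun.Build _ _ _ _ X mX)).
Let Ym : {RV P >-> R} := MeasurableFun.Pack (MeasurableFun.Class (isMeasurableFun.Build _ _ _ _ Y mY)).
Let mXY : measurable_fun setT (fun w => (X w, Y w)).
Proof. exact: measurable_fun_pair. Qed.
Let XYm : {RV P >-> (R * R)%type} :=
  MeasurableFun.Pack (MeasurableFun.Class (isMeasurableFun.Build _ _ _ _ _ mXY)).

(** Independence is the product rule on rectangles, and a measure on the plane that agrees with the
    product law on rectangles is the product law. Tonelli then factorises integrals. *)
Let XY_law (A : set (R * R)) : measurable A ->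
  (distribution P Xm \x distribution P Ym)%E A = distribution P XYm A.
Proof. by move=> mA; apply: product_measure_unique => // B C mB mC; exact: XY. Qed.

Let ge0_int_mul (h : R * R -> R) : measurable_fun setT h -> (forall z, 0 <= h z) ->
  (\int[P]_w (h (X w, Y w))%:E
   = \int[distribution P Xm]_x \int[distribution P Ym]_y (h (x, y))%:E)%E.
Proof.
move=> mh h0.
have h0' z : (0 <= (EFin \o h) z)%E by rewrite /= lee_fin.
have mh' : measurable_fun setT (EFin \o h) by exact/measurable_EFinP.
rewrite -(@fubini_tonelli1 _ _ _ _ _ (distribution P Xm) (distribution P Ym) (EFin \o h) mh' h0').
transitivity (\int[distribution P XYm]_z (EFin \o h) z)%E.
  by rewrite ge0_integral_distribution.
by apply: eq_measure_integral => A mA _; exact/esym/XY_law.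
Qed.

Lemma indep_ge0 (u v : R -> R) : measurable_fun setT u -> measurable_fun setT v ->
  (forall x, 0 <= u x) -> (forall x, 0 <= v x) ->
  (\int[P]_w (u (X w) * v (Y w))%:E = (\int[P]_w (u (X w))%:E) * \int[P]_w (v (Y w))%:E)%E.
Proof.
move=> mu mv u0 v0.
have mh : measurable_fun setT (fun z : R * R => u z.1 * v z.2).
  by apply: measurable_funM; exact: measurableT_comp.
have h0 (z : R * R) : 0 <= u z.1 * v z.2 by rewrite mulr_ge0.
have mu' : measurable_fun setT (EFin \o u) by exact/measurable_EFinP.
have mv' : measurable_fun setT (EFin \o v) by exact/measurable_EFinP.
have u0' x : (0 <= (EFin \o u) x)%E by rewrite /= lee_fin.
have v0' x : (0 <= (EFin \o v) x)%E by rewrite /= lee_fin.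
rewrite (ge0_int_mul mh h0) /=.
have <- : (\int[distribution P Ym]_y (EFin \o v) y = \int[P]_w (v (Y w))%:E)%E.
  by rewrite ge0_integral_distribution.
have <- : (\int[distribution P Xm]_x (EFin \o u) x = \int[P]_w (u (X w))%:E)%E.
  by rewrite ge0_integral_distribution.
rewrite -ge0_integralZr//; last exact: integral_ge0.
apply: eq_integral => x _.
under eq_integral do rewrite EFinM.
by rewrite ge0_integralZl_EFin// => y _; rewrite lee_fin.
Qed.

Lemma indep_ge0_Ex (u v : R -> R) : measurable_fun setT u -> measurable_fun setT v ->
  (forall x, 0 <= u x) -> (forall x, 0 <= v x) ->
  intg P (fun w => u (X w)) -> intg P (fun w => v (Y w)) ->
  intg P (fun w => u (X w) * v (Y w)) /\
  Ex P (fun w => u (X w) * v (Y w)) = Ex P (fun w => u (X w)) * Ex P (fun w => v (Y w)).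
Proof.
move=> mu mv u0 v0 iu iv.
have H := indep_ge0 mu mv u0 v0.
rewrite -(Ex_EFin iu) -(Ex_EFin iv) -EFinM in H.
have [i le] : intg P (fun w => u (X w) * v (Y w)) /\
    Ex P (fun w => u (X w) * v (Y w)) <= Ex P (fun w => u (X w)) * Ex P (fun w => v (Y w)).
  apply: intg_ge0_le; last by rewrite H.
    by apply: measurable_funM; exact: measurableT_comp.
  by move=> w; rewrite mulr_ge0.
by split => //; apply: EFin_inj; rewrite Ex_EFin.
Qed.

Lemma indep_Ex : intg P X -> intg P Y ->
  intg P (fun w => X w * Y w) /\ Ex P (fun w => X w * Y w) = Ex P X * Ex P Y.
Proof.
move=> iX iY.
pose u (x : R) := Num.max x 0; pose v (x : R) := Num.max (- x) 0.
have mu : measurable_fun setT u by exact: measurable_maxr.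
have mv : measurable_fun setT v by apply: measurable_maxr => //; exact: measurable_funN.
have u0 x : 0 <= u x by rewrite le_max lexx orbT.
have v0 x : 0 <= v x by rewrite le_max lexx orbT.
have uv x : x = u x - v x.
  rewrite /u /v; have [x0|/ltW x0] : 0 <= x \/ x < 0 by case: (leP 0 x); [left|right].
    by rewrite (max_l x0) max_r; lra.
  by rewrite (max_r x0) max_l; lra.
have un x : `|u x| <= `|x|.
  by rewrite ger0_norm// /u ge_max normr_ge0 ler_norm.
have vn x : `|v x| <= `|x|.
  by rewrite ger0_norm// /v ge_max normr_ge0 andbT -normrN ler_norm.
have iuX : intg P (fun w => u (X w)).
  by apply: (@intg_le _ _ _ _ _ (fun w => `|X w|)) => //; [exact: measurableT_comp|exact: intg_norm].
have ivX : intg P (fun w => v (X w)).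
  by apply: (@intg_le _ _ _ _ _ (fun w => `|X w|)) => //; [exact: measurableT_comp|exact: intg_norm].
have iuY : intg P (fun w => u (Y w)).
  by apply: (@intg_le _ _ _ _ _ (fun w => `|Y w|)) => //; [exact: measurableT_comp|exact: intg_norm].
have ivY : intg P (fun w => v (Y w)).
  by apply: (@intg_le _ _ _ _ _ (fun w => `|Y w|)) => //; [exact: measurableT_comp|exact: intg_norm].
have [i1 e1] := indep_ge0_Ex mu mu u0 u0 iuX iuY.
have [i2 e2] := indep_ge0_Ex mu mv u0 v0 iuX ivY.
have [i3 e3] := indep_ge0_Ex mv mu v0 u0 ivX iuY.
have [i4 e4] := indep_ge0_Ex mv mv v0 v0 ivX ivY.
have -> : (fun w => X w * Y w) = fun w => (u (X w) * u (Y w) - u (X w) * v (Y w))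
    - (v (X w) * u (Y w) - v (X w) * v (Y w)).
  by apply/funext => w; rewrite {1}(uv (X w)) {1}(uv (Y w)); ring.
split; first by apply: intgB; apply: intgB.
have -> : Ex P X = Ex P (fun w => u (X w)) - Ex P (fun w => v (X w)).
  by rewrite -ExB//; congr Ex; apply/funext.
have -> : Ex P Y = Ex P (fun w => u (Y w)) - Ex P (fun w => v (Y w)).
  by rewrite -ExB//; congr Ex; apply/funext.
rewrite ExB; [|exact: intgB..].
by rewrite !ExB// e1 e2 e3 e4; ring.
Qed.

End Independence.

(** * Gaussian moments and Brownian increments *)

Section Gaussian.
Context {R : realType}.
Local Notation mu := (@lebesgue_measure R).

(** The Radon-Nikodym derivative of the normal law and the explicit density have the same integral
    over every measurable set, hence agree almost everywhere. *)
Lemma integral_normal_prob (a s : R) (h : R -> \bar R) : s != 0 ->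
  measurable_fun setT h -> (forall x, 0 <= h x)%E ->
  (\int[normal_prob a s]_x h x = \int[mu]_x (h x * (normal_pdf a s x)%:E))%E.
Proof.
move=> s0 mh h0.
have dom := @normal_prob_dominates R a s.
rewrite -(Radon_Nikodym_SigmaFinite.change_of_variables dom)//.
apply: ae_eq_integral => //.
- apply: emeasurable_funM => //; apply: (measurable_int mu).
  exact: Radon_Nikodym_SigmaFinite.f_integrable.
- apply: emeasurable_funM => //; apply/measurable_EFinP; exact: measurable_normal_pdf.
- apply: ae_eqe_mul2l; apply: integral_ae_eq => //.
  + exact: Radon_Nikodym_SigmaFinite.f_integrable.
  + by apply/measurable_EFinP; exact: measurable_normal_pdf.
  + by move=> E _ mE; rewrite -Radon_Nikodym_SigmaFinite.f_integral.
Qed.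

(** Completing the square: an exponential tilt shifts the mean to a s^2. *)
Lemma normal_pdf_exp (s a x : R) : s != 0 ->
  expR (a * x) * normal_pdf 0 s x
  = expR (a ^+ 2 * s ^+ 2 / 2) * normal_pdf (a * s ^+ 2) s x.
Proof.
move=> s0; rewrite !normal_pdfE// mulrCA [RHS]mulrCA; congr (_ * _).
rewrite /normal_fun -!expRD; congr expR.
by field; rewrite s0.
Qed.

(** A quadratic tilt rescales the variance to s^2/(1 - l); the prefactor restores the normalisation
    of the density. *)
Lemma normal_pdf_exp_sqr (s l x : R) : 0 < s -> 0 <= l < 1 ->
  expR (l * x ^+ 2 / (2 * s ^+ 2)) * normal_pdf 0 s x
  = (Num.sqrt (1 - l))^-1 * normal_pdf 0 (s / Num.sqrt (1 - l)) x.
Proof.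
move=> s_gt0 /andP[l0 l1].
have u0 : 0 < Num.sqrt (1 - l) by rewrite sqrtr_gt0; lra.
have u2 : Num.sqrt (1 - l) ^+ 2 = 1 - l by rewrite sqr_sqrtr//; lra.
move: (Num.sqrt (1 - l)) u0 u2 => u u0 u2.
have s0 : s != 0 by rewrite gt_eqF.
have su0 : s / u != 0 by rewrite gt_eqF// divr_gt0.
rewrite !normal_pdfE// [RHS]mulrA mulrCA; congr (_ * _).
  rewrite /normal_peak -invfM; congr (_^-1).
  have pi0 := @pi_gt0 R.
  apply/eqP; rewrite -(@eqrXn2 _ 2)// ?mulr_ge0 ?sqrtr_ge0 ?(ltW u0)//.
  rewrite exprMn !sqr_sqrtr; last 2 first.
    by rewrite mulrn_wge0// mulr_ge0 ?sqr_ge0// ltW.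
    by rewrite mulrn_wge0// mulr_ge0 ?sqr_ge0// ltW.
  by apply/eqP; field; rewrite gt_eqF.
rewrite /normal_fun -expRD; congr expR.
have -> : l = 1 - u ^+ 2 by rewrite u2; ring.
by field; rewrite s0 gt_eqF.
Qed.


Context {disp : measure_display} {Omega : measurableType disp}.
Variables (P : probability Omega R) (D : Omega -> R) (s : R).
Hypothesis s_gt0 : 0 < s.
Hypothesis mD : measurable_fun setT D.
Hypothesis D_law : forall B, measurable B -> P (D @^-1` B) = normal_prob 0 s B.

Let s0 : s != 0. Proof. by rewrite gt_eqF. Qed.

Let mD' : @measurable_fun _ _ Omega (measurableTypeR R) setT D. Proof. exact: mD. Qed.

Let Dm : {RV P >-> measurableTypeR R} :=
  @MeasurableFun.Pack _ _ Omega (measurableTypeR R) D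
    (MeasurableFun.Class (@isMeasurableFun.phant_Build _ _ Omega (measurableTypeR R) D mD')).

Let integral_D (h : R -> R) : measurable_fun setT h -> (forall x, 0 <= h x) ->
  (\int[P]_w (h (D w))%:E = \int[mu]_x (h x * normal_pdf 0 s x)%:E)%E.
Proof.
move=> mh h0.
have mh' : measurable_fun setT (EFin \o h) by exact/measurable_EFinP.
have h0' x : (0 <= (EFin \o h) x)%E by rewrite /= lee_fin.
rewrite -(ge0_integral_distribution Dm mh' h0').
under [RHS]eq_integral do rewrite EFinM.
rewrite -(integral_normal_prob 0 s0 mh' h0').
by apply: eq_measure_integral => A mA _; rewrite /= /distribution /pushforward D_law.
Qed.

Lemma gaussian_exp (a : R) : intg P (fun w => expR (a * D w)) /\
  Ex P (fun w => expR (a * D w)) <= expR (a ^+ 2 * s ^+ 2 / 2).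
Proof.
have mh : measurable_fun setT (fun x : R => expR (a * x)).
  by apply: measurableT_comp => //; exact: measurable_funM.
apply: intg_ge0_le => [|w|]; [exact: (measurableT_comp mh)|exact: expR_ge0|].
rewrite (integral_D mh) => [|x]; last exact: expR_ge0.
under eq_integral do rewrite normal_pdf_exp// EFinM.
rewrite ge0_integralZl_EFin ?expR_ge0//=.
- by rewrite integral_normal_pdf mule1.
- by move=> x _; rewrite lee_fin normal_pdf_ge0.
- by apply/measurable_EFinP; exact: measurable_normal_pdf.
Qed.

Lemma gaussian_exp_sqr (l : R) : 0 <= l < 1 ->
  intg P (fun w => expR (l * D w ^+ 2 / (2 * s ^+ 2))) /\
  Ex P (fun w => expR (l * D w ^+ 2 / (2 * s ^+ 2))) <= (Num.sqrt (1 - l))^-1.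
Proof.
move=> l01.
have mh : measurable_fun setT (fun x : R => expR (l * x ^+ 2 / (2 * s ^+ 2))).
  apply: measurableT_comp => //; apply: measurable_funM => //; apply: measurable_funM => //.
apply: intg_ge0_le => [|w|]; [exact: (measurableT_comp mh)|exact: expR_ge0|].
rewrite (integral_D mh) => [|x]; last exact: expR_ge0.
under eq_integral do rewrite normal_pdf_exp_sqr// EFinM.
rewrite ge0_integralZl_EFin ?invr_ge0 ?sqrtr_ge0//=.
- by rewrite integral_normal_pdf mule1.
- by move=> x _; rewrite lee_fin normal_pdf_ge0.
- by apply/measurable_EFinP; exact: measurable_normal_pdf.
Qed.

(** With y = |D|/s, either y^p <= 1 or y^p <= y^4 <= 64 (1 + y^2/8)^2 <= 64 exp(y^2/4), and
    exp(y^2/4) is the quadratic tilt with l = 1/2. Its expectation is at most sqrt 2 < 2, whence 130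
    = 65 * 2. *)
Lemma gaussian_powR (p : R) : 0 <= p <= 4 ->
  intg P (fun w => `|D w| `^ p) /\ Ex P (fun w => `|D w| `^ p) <= 130 * s `^ p.
Proof.
move=> /andP[p0 p4].
have half01 : (0 : R) <= (2^-1 : R) < 1 by lra.
have [i1 e1] := gaussian_exp_sqr half01.
have bnd w : `|D w| `^ p <= 65 * s `^ p * expR (2^-1 * D w ^+ 2 / (2 * s ^+ 2)).
  pose y := `|D w| / s.
  have y0 : 0 <= y by rewrite divr_ge0// ltW.
  have -> : `|D w| = s * y by rewrite /y mulrCA divff ?mulr1.
  rewrite powRM ?(ltW s_gt0)// -mulrA mulrCA ler_wpM2l ?powR_ge0//.
  have -> : 2^-1 * D w ^+ 2 / (2 * s ^+ 2) = y ^+ 2 / 4.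
    by rewrite /y expr_div_n real_normK ?num_real//; field.
  have -> : expR (y ^+ 2 / 4) = expR (y ^+ 2 / 8) ^+ 2.
    by rewrite expr2 -[RHS]expRD; congr expR; field.
  have e0 := expR_ge1Dx (y ^+ 2 / 8).
  have y2 := sqr_ge0 y.
  have sq : (1 + y ^+ 2 / 8) ^+ 2 <= expR (y ^+ 2 / 8) ^+ 2.
    by apply: lerXn2r; rewrite ?nnegrE ?expR_ge0//; lra.
  have [y1|y1] := leP y 1.
    apply: (@le_trans _ _ (1 `^ p)); first exact: powR_le.
    rewrite powR1; nra.
  apply: (@le_trans _ _ (y `^ 4%:R)); first by apply: ler_powR => //; exact: ltW.
  rewrite powR_mulrn//; have -> : y ^+ 4 = (y ^+ 2) ^+ 2 by ring.
  nra.
have i2 := intgZ (65 * s `^ p) i1.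
have iD : intg P (fun w => `|D w| `^ p).
  apply: intg_le i2.
    by apply: (measurableT_comp (measurable_powR p)); exact: measurableT_comp.
  by move=> w; rewrite ger0_norm ?powR_ge0.
split => //; apply: le_trans (Ex_le iD i2 bnd) _; rewrite ExZ//.
have h2 := powR_ge0 s p; have h1 : (Num.sqrt (1 - 2^-1 : R))^-1 <= 2.
  have hh : 0 < 1 - 2^-1 :> R by lra.
  have u0 : 0 < Num.sqrt (1 - 2^-1 : R) by rewrite sqrtr_gt0.
  have u2 : Num.sqrt (1 - 2^-1 : R) ^+ 2 = 1 - 2^-1 by rewrite sqr_sqrtr// ltW.
  rewrite -div1r ler_pdivrMr//; move: (Num.sqrt _) u0 u2 => u u0 u2.
  by rewrite -(@ler_pXn2r _ 2)// ?nnegrE ?ler01 ?mulr_ge0 ?(ltW u0)// exprMn u2; lra.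
have h3 : Ex P (fun w => expR (2^-1 * D w ^+ 2 / (2 * s ^+ 2))) <= 2.
  exact: le_trans h1.
have := ler_wpM2l (mulr_ge0 (ler0n R 65) h2) h3; lra.
Qed.

(** The constant one is essential, as [eta] may be arbitrarily close to 1. It comes from 1 + l x/(2
    s^2) <= (1 - l)^(-1/2) for small l, where x is the second moment: this implies x (1 - l) <= s^2
    for every l in (0, 1). *)
Lemma gaussian_sqr : intg P (fun w => D w ^+ 2) /\ Ex P (fun w => D w ^+ 2) <= s ^+ 2.
Proof.
have i2 : intg P (fun w => D w ^+ 2).
  have [] := @gaussian_powR 2%:R; first by apply/andP; split; lra.
  move=> + _; congr intg; apply/funext => w.
  by rewrite powR_mulrn// real_normK ?num_real.
split => //; set x := Ex _ _.
have x0 : 0 <= x by apply: Ex_ge0 => w; exact: sqr_ge0.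
have s2 : 0 < s ^+ 2 by rewrite exprn_gt0.
have key l : 0 < l -> l < 1 -> x * (1 - l) <= s ^+ 2.
  move=> l0 l1; have l01 : 0 <= l < 1 by rewrite (ltW l0).
  have [i1 e1] := gaussian_exp_sqr l01.
  have u0 : 0 < Num.sqrt (1 - l) by rewrite sqrtr_gt0; lra.
  have u2 : Num.sqrt (1 - l) ^+ 2 = 1 - l by rewrite sqr_sqrtr//; lra.
  move: (Num.sqrt (1 - l)) u0 u2 e1 => u u0 u2 e1.
  have ic := intg_cst P 1.
  have i3 : intg P (fun w => 1 + l / (2 * s ^+ 2) * D w ^+ 2) by apply: intgD => //; exact: intgZ.
  have := Ex_le i3 i1; rewrite ExD//; last exact: intgZ.
  rewrite Ex_cst ExZ// -/x => /(_ _)/le_trans-/(_ _ _ e1) h.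
  have {}h : 1 + l / (2 * s ^+ 2) * x <= u^-1.
    apply: h => w; rewrite (_ : l / (2 * s ^+ 2) * D w ^+ 2 = l * D w ^+ 2 / (2 * s ^+ 2)); last by ring.
    exact: expR_ge1Dx.
  have u1 : u < 1.
    by rewrite -(@ltr_pXn2r _ 2)// ?nnegrE ?ler01 ?(ltW u0)// u2 expr1n; lra.
  have : (1 + l / (2 * s ^+ 2) * x) * u <= 1 by rewrite -ler_pdivlMr// div1r.
  rewrite -u2 (_ : l = 1 - u ^+ 2); last by rewrite u2; ring.
  have -> : (1 + (1 - u ^+ 2) / (2 * s ^+ 2) * x) * u = u + (1 - u) * (x * u * (1 + u)) / (2 * s ^+ 2).
    by field.
  rewrite -lerBrDl ler_pdivrMr ?mulr_gt0// -[X in _ <= X]mulrC.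
  rewrite [leRHS]mulrC ler_pM2l ?subr_gt0// => h2.
  apply: (@le_trans _ _ (x * u * (1 + u) / 2)); last lra.
  have -> : x * u ^+ 2 = x * u * (u + u) / 2 by field.
  by rewrite ler_wpM2r ?invr_ge0// ler_wpM2l ?mulr_ge0 ?(ltW u0)// lerD2r ltW.
rewrite leNgt; apply/negP => sx.
have xp : 0 < x by lra.
(* Makes x (1 - l) the midpoint of x and s^2, which exceeds s^2 if x does. *)
pose l := (x - s ^+ 2) / (2 * x).
have l0 : 0 < l by rewrite divr_gt0// ?subr_gt0// mulr_gt0.
have l1 : l < 1 by rewrite ltr_pdivrMr ?mulr_gt0//; lra.
have := key l l0 l1.
have -> : x * (1 - l) = (x + s ^+ 2) / 2 by rewrite /l; field; rewrite gt_eqF.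
lra.
Qed.

(** From 1 + a E D <= E exp(a D) <= exp(a^2 s^2/2) one gets a E D <= a^2 s^2 for small a of either
    sign, which forces E D = 0. *)
Lemma gaussian_mean : intg P D /\ Ex P D = 0.
Proof.
have iD : intg P D.
  apply: (@intg_le _ _ _ _ _ (fun w => 1 + D w ^+ 2)) => //.
    by move=> w; rewrite ler_norml; apply/andP; split; have := sqr_ge0 (D w - 1); have := sqr_ge0 (D w + 1); nra.
  by apply: intgD; [exact: intg_cst|case: gaussian_sqr].
split => //.
have s2 : 0 < s ^+ 2 by rewrite exprn_gt0.
have key a : a ^+ 2 * s ^+ 2 <= 1 -> a * Ex P D <= a ^+ 2 * s ^+ 2.
  move=> a1; have [i1 e1] := gaussian_exp a.
  have i3 : intg P (fun w => 1 + a * D w) by apply: intgD; [exact: intg_cst|exact: intgZ].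
  have := Ex_le i3 i1; rewrite ExD//; [|exact: intg_cst|exact: intgZ].
  rewrite Ex_cst ExZ// => /(_ (fun w => expR_ge1Dx (a * D w))) h.
  have {}h := le_trans h e1.
  move: h a1; have : 0 <= a ^+ 2 * s ^+ 2 by rewrite mulr_ge0 ?sqr_ge0.
  move: (a ^+ 2 * s ^+ 2) (a * Ex P D) => v y v0 h v1.
  have := expR_ge1Dx (- (v / 2)); rewrite expRN.
  have e0 := expR_gt0 (v / 2); move: (expR (v / 2)) e0 h => e e0 h h2.
  have : (1 - v / 2) * e <= 1 by rewrite -ler_pdivlMr// div1r.
  nra.
apply/eqP; apply/negPn/negP => E0.
pose e := `|Ex P D|; have e0 : 0 < e by rewrite normr_gt0.
pose sg := Num.sg (Ex P D).
have sgE : sg * Ex P D = e by rewrite /sg -normrEsg.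
(* Small enough for t s <= 1, so that the estimate applies, and for t s^2 < e, which contradicts its
   conclusion e <= t s^2. *)
pose t := e / (2 * s ^+ 2 + e * s).
have den : 0 < 2 * s ^+ 2 + e * s by rewrite addr_gt0 ?mulr_gt0.
have t0 : 0 < t by rewrite divr_gt0.
have ts : t * s <= 1 by rewrite /t mulrAC ler_pdivrMr// mul1r lerDr; lra.
have ts2 : t * s ^+ 2 < e.
  by rewrite /t mulrAC ltr_pdivrMr// ltr_pM2l//; have := mulr_gt0 e0 s_gt0; lra.
have sg2 : sg ^+ 2 = 1 by rewrite /sg sqr_sg E0.
have h : t ^+ 2 * s ^+ 2 <= 1 -> t * e <= t ^+ 2 * s ^+ 2.
  by have := key (t * sg); rewrite (exprMn _ t sg) sg2 mulr1 -(mulrA t sg) sgE.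
have tsq : t ^+ 2 * s ^+ 2 <= 1.
  by rewrite -exprMn -[leRHS](expr1n _ 2); apply: lerXn2r; rewrite ?nnegrE// mulr_ge0// ltW.
have := h tsq; rewrite (expr2 t) -mulrA ler_pM2l//; lra.
Qed.
End Gaussian.

Section Increments.
Context {disp : measure_display} {Omega : measurableType disp} {R : realType}.
Variables (P : probability Omega R) (T : R) (F : R -> set (set Omega)).
Hypothesis F_usual : usual_filtration P T F.

Lemma filt_measurable t (Y : Omega -> R) : 0 <= t <= T ->
  measurable_wrt (F t) Y -> measurable_fun setT Y.
Proof. by move=> tT; apply: measurable_wrt_fun; exact: (filt_sub F_usual tT). Qed.

Lemma filt_le s t (Y : Omega -> R) : 0 <= s -> s <= t -> t <= T ->
  measurable_wrt (F s) Y -> measurable_wrt (F t) Y.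
Proof. by move=> s0 st tT; apply: measurable_wrt_sub; exact: (filt_mono F_usual). Qed.

Section single.
Variable W : R -> Omega -> R.
Hypothesis BW : brownian P T F W.
Variables s t : R.
Hypotheses (s0 : 0 <= s) (st : s <= t) (tT : t <= T).
Local Notation D := (fun w => W t w - W s w).

Let sT01 : 0 <= s <= T. Proof. by rewrite s0 (le_trans st). Qed.
Let tT01 : 0 <= t <= T. Proof. by rewrite (le_trans s0 st). Qed.

Lemma incr_adapted : measurable_wrt (F t) D.
Proof.
apply: measurable_wrtB; [exact: (filt_sigma F_usual)|exact: (bm_adapted BW)|].
by apply: (filt_le s0 st tT); exact: (bm_adapted BW).
Qed.

Lemma incr_measurable : measurable_fun setT D.
Proof. exact: filt_measurable tT01 incr_adapted. Qed.

Let dts : Num.sqrt (t - s) ^+ 2 = t - s. Proof. by rewrite sqr_sqrtr ?subr_ge0. Qed.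

(** The law of an increment is given only for s < t. The degenerate case is included here and below
    because the grids used later may repeat points. *)
Lemma incr_mean : intg P D /\ Ex P D = 0.
Proof.
have [st'|<-] : s < t \/ s = t by move: st; rewrite le_eqVlt => /predU1P[|]; [right|left].
  apply: (@gaussian_mean _ _ _ P D (Num.sqrt (t - s))).
  - by rewrite sqrtr_gt0 subr_gt0.
  - exact: incr_measurable.
  - by move=> B mB; exact: (bm_normal BW).
have -> : (fun w => W s w - W s w) = fun=> 0 by apply/funext => w; rewrite subrr.
by rewrite Ex_cst; split => //; exact: intg_cst.
Qed.

Lemma incr_sqr : intg P (fun w => D w ^+ 2) /\ Ex P (fun w => D w ^+ 2) <= t - s.
Proof.
have [st'|<-] : s < t \/ s = t by move: st; rewrite le_eqVlt => /predU1P[|]; [right|left].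
  rewrite -[X in _ /\ _ <= X]dts.
  apply: (@gaussian_sqr _ _ _ P D (Num.sqrt (t - s))).
  - by rewrite sqrtr_gt0 subr_gt0.
  - exact: incr_measurable.
  - by move=> B mB; exact: (bm_normal BW).
have -> : (fun w => (W s w - W s w) ^+ 2) = fun=> 0.
  by apply/funext => w; rewrite subrr expr0n.
by rewrite Ex_cst subrr; split => //; exact: intg_cst.
Qed.

Lemma incr_powR (p : R) : 0 < p <= 4 ->
  intg P (fun w => `|D w| `^ p) /\ Ex P (fun w => `|D w| `^ p) <= 130 * (t - s) `^ (p / 2).
Proof.
move=> /andP[p0 p4].
have [st'|<-] : s < t \/ s = t by move: st; rewrite le_eqVlt => /predU1P[|]; [right|left].
  have -> : (t - s) `^ (p / 2) = Num.sqrt (t - s) `^ p.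
    by rewrite -powR12_sqrt ?subr_ge0// -powRrM mulrC.
  apply: (@gaussian_powR _ _ _ P D (Num.sqrt (t - s))).
  - by rewrite sqrtr_gt0 subr_gt0.
  - exact: incr_measurable.
  - by move=> B mB; exact: (bm_normal BW).
  - by rewrite p4 ltW.
have -> : (fun w => `|W s w - W s w| `^ p) = fun=> 0.
  by apply/funext => w; rewrite subrr normr0 powR0 ?gt_eqF.
rewrite Ex_cst subrr powR0 ?mulr0 ?gt_eqF ?divr_gt0//.
by split => //; exact: intg_cst.
Qed.

Lemma incr_indep (xi : Omega -> R) (k : R -> R) : measurable_wrt (F s) xi -> intg P xi ->
  measurable_fun setT k -> intg P (fun w => k (D w)) ->
  intg P (fun w => xi w * k (D w)) /\
  Ex P (fun w => xi w * k (D w)) = Ex P xi * Ex P (fun w => k (D w)).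
Proof.
move=> mxi ixi mk ik.
have [st'|<-] : s < t \/ s = t by move: st; rewrite le_eqVlt => /predU1P[|]; [right|left].
  apply: (@indep_Ex _ _ _ P xi (fun w => k (D w))) => //.
  - exact: filt_measurable sT01 mxi.
  - exact: (measurableT_comp mk incr_measurable).
  - move=> A B mA mB; rewrite -[X in _ `&` X]/(D @^-1` (k @^-1` B)).
    apply: (bm_indep BW) => //; first exact: mxi.
    by rewrite -[_ @^-1` _]setTI; exact: mk.
have -> : (fun w => xi w * k (W s w - W s w)) = fun w => k 0 * xi w.
  by apply/funext => w; rewrite subrr mulrC.
have -> : (fun w => k (W s w - W s w)) = fun=> k 0.
  by apply/funext => w; rewrite subrr.
by rewrite Ex_cst ExZ// mulrC; split => //; exact: intgZ.
Qed.

Lemma incr_mul0 (xi : Omega -> R) : measurable_wrt (F s) xi -> intg P xi ->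
  intg P (fun w => xi w * D w) /\ Ex P (fun w => xi w * D w) = 0.
Proof.
move=> mxi ixi; have [iD ED] := incr_mean.
by have [i e] := @incr_indep xi id mxi ixi (@measurable_id _ _ _) iD; rewrite e ED mulr0.
Qed.

Lemma incr_mul_sqr (xi : Omega -> R) : measurable_wrt (F s) xi -> intg P xi ->
  (forall w, 0 <= xi w) ->
  intg P (fun w => xi w * D w ^+ 2) /\ Ex P (fun w => xi w * D w ^+ 2) <= (t - s) * Ex P xi.
Proof.
move=> mxi ixi xi0; have [iD ED] := incr_sqr.
have [i e] := @incr_indep xi (fun x => x ^+ 2) mxi ixi (@exprn_measurable _ _ 2) iD.
by split => //; rewrite e mulrC ler_wpM2r// Ex_ge0.
Qed.

Lemma incr_mul_powR (p : R) (xi : Omega -> R) : 0 < p <= 4 ->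
  measurable_wrt (F s) xi -> intg P xi -> (forall w, 0 <= xi w) ->
  intg P (fun w => xi w * `|D w| `^ p) /\
  Ex P (fun w => xi w * `|D w| `^ p) <= 130 * (t - s) `^ (p / 2) * Ex P xi.
Proof.
move=> p04 mxi ixi xi0; have [iD ED] := incr_powR p04.
have mk : measurable_fun setT (fun x : R => `|x| `^ p).
  by apply: (measurableT_comp (measurable_powR p)).
have [i e] := @incr_indep xi _ mxi ixi mk iD.
by split => //; rewrite e mulrC ler_wpM2r// Ex_ge0.
Qed.

End single.
End Increments.

(** * Products of increments of two different Brownian motions *)

Section CrossTerms.
Context {disp : measure_display} {Omega : measurableType disp} {R : realType}.
Variables (P : probability Omega R) (T : R) (F : R -> set (set Omega)).
Hypothesis F_usual : usual_filtration P T F.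
Variables (m : nat) (W : 'I_m -> R -> Omega -> R).
Hypothesis BW : forall r, brownian P T F (W r).
Hypothesis W_indep : independent_processes P T W.

Let process_sigma_incr r u v : 0 <= u <= T -> 0 <= v <= T ->
  measurable_wrt (process_sigma T (W r)) (fun w => W r v w - W r u w).
Proof.
move=> uT vT; apply: measurable_wrtB; first exact: smallest_sigma_algebra.
- by move=> B mB; apply: sub_sigma_algebra; exists v, B.
- by move=> B mB; apply: sub_sigma_algebra; exists u, B.
Qed.

Lemma process_sigma_indep r r' (X Y : Omega -> R) : r != r' ->
  measurable_wrt (process_sigma T (W r)) X -> measurable_wrt (process_sigma T (W r')) Y ->
  forall A B : set R, measurable A -> measurable B ->
  (P (X @^-1` A `&` Y @^-1` B) = P (X @^-1` A) * P (Y @^-1` B))%E.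
Proof.
move=> rr' mX mY A B mA mB.
pose Z r'' := if r'' == r then X @^-1` A else if r'' == r' then Y @^-1` B else setT.
have -> : X @^-1` A `&` Y @^-1` B = \bigcap_r'' Z r''.
  apply/seteqP; split => [w [Xw Yw] r'' _|w h].
    by rewrite /Z; case: ifP => // _; case: ifP.
  by split; [have := h r I|have := h r' I]; rewrite /Z eqxx// eq_sym (negbTE rr').
rewrite W_indep; last first.
  move=> r''; rewrite /Z; case: eqP => [->|_]; first exact: mX.
  case: eqP => [->|_]; first exact: mY.
  have [sg0 sgC _] : sigma_algebra setT (process_sigma T (W r'')).
    exact: smallest_sigma_algebra.
  by rewrite -setC0 -setTD; exact: sgC.
rewrite (bigD1 r)//= (bigD1 r')/= 1?eq_sym//= big1 => [|i /andP[i1 i2]].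
  by rewrite /Z !eqxx eq_sym (negbTE rr') mule1.
by rewrite /Z (negbTE i1) (negbTE i2) probability_setT.
Qed.

Section interval.
Variables (r r' : 'I_m) (s t : R).
Hypotheses (s0 : 0 <= s) (st : s <= t) (tT : t <= T).
Local Notation D k := (fun w => W k t w - W k s w).
Let sT01 : 0 <= s <= T. Proof. by rewrite s0 (le_trans st). Qed.

(** |D r * D r'| is bounded by the sum of the two squares, each of which is integrable against
    |xi|. *)
Lemma incr_cross_intg (xi : Omega -> R) : measurable_wrt (F s) xi -> intg P xi ->
  intg P (fun w => xi w * (D r w * D r' w)).
Proof.
move=> mxi ixi.
have mxi' : measurable_wrt (F s) (fun w => `|xi w|).
  exact: (@measurable_wrt_comp _ _ _ _ (fun x : R => `|x|)).
have ixi' := intg_norm ixi.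
have [i1 _] := incr_mul_sqr F_usual (BW r) s0 st tT mxi' ixi' (fun w => normr_ge0 _).
have [i2 _] := incr_mul_sqr F_usual (BW r') s0 st tT mxi' ixi' (fun w => normr_ge0 _).
apply: intg_le (intgD i1 i2).
  apply: measurable_funM; first exact: (filt_measurable F_usual sT01 mxi).
  by apply: measurable_funM; [exact: (incr_measurable F_usual (BW r) s0 st tT)|exact: (incr_measurable F_usual (BW r') s0 st tT)].
move=> w; rewrite normrM -mulrDr ler_wpM2l// ler_norml; apply/andP; split.
  by have := sqr_ge0 (D r w + D r' w); have := sqr_ge0 (D r w); have := sqr_ge0 (D r' w); nra.
by have := sqr_ge0 (D r w - D r' w); have := sqr_ge0 (D r w); have := sqr_ge0 (D r' w); nra.
Qed.

End interval.

Section orthogonal.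
Variables (r r' : 'I_m) (s t : R).
Hypothesis rr' : r != r'.
Hypotheses (s0 : 0 <= s) (st : s <= t) (tT : t <= T).
Local Notation D k := (fun w => W k t w - W k s w).
Let sT01 : 0 <= s <= T. Proof. by rewrite s0 (le_trans st). Qed.

Let incr_sum (G : R -> R) (u : nat -> R) n :
  \sum_(i < n) (G (u i.+1) - G (u i)) = G (u n) - G (u 0%N).
Proof. by elim: n => [|n ih]; rewrite ?big_ord0 ?subrr// big_ord_recr/= ih addrC subrKA. Qed.

(* xi is independent of each of the two increments but not assumed to be independent of
   the pair.  Cut [s, t] into n pieces: the off-diagonal products of small increments have
   mean zero by conditioning on the earlier time, and the sum of the diagonal ones tends
   to 0 in L^2 because W r and W r' are independent. *)
Let incr_cross_bounded (xi : Omega -> R) (M : R) : measurable_wrt (F s) xi ->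
  (forall w, `|xi w| <= M) -> Ex P (fun w => xi w * (D r w * D r' w)) = 0.
Proof.
move=> mxi xiM.
have M0 (w : Omega) : 0 <= M := le_trans (normr_ge0 _) (xiM w).
have ixi : intg P xi.
  apply: (intg_le _ xiM); last exact: intg_cst.
  exact: (filt_measurable F_usual sT01 mxi).
pose N (n : nat) : R := n.+1%:R.
pose u (n i : nat) : R := s + i%:R * ((t - s) / N n).
have N0 n : 0 < N n by rewrite ltr0n.
have u0 n : u n 0%N = s by rewrite /u mul0r addr0.
have un n : u n n.+1 = t by rewrite /u mulrCA divff ?gt_eqF// mulr1 subrKC.
have du n i : u n i.+1 - u n i = (t - s) / N n by rewrite /u mulrSr; ring.
have h0 n : 0 <= (t - s) / N n by rewrite divr_ge0 ?subr_ge0// ltW.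
have umono n i j : (i <= j)%N -> u n i <= u n j.
  by move=> ij; rewrite lerD2l ler_wpM2r// ler_nat.
have us n i : s <= u n i by rewrite -(u0 n); exact: umono.
have ut n i : (i <= n.+1)%N -> u n i <= t by move=> ij; rewrite -(un n); exact: umono.
have uT n i : (i <= n.+1)%N -> 0 <= u n i <= T.
  by move=> ij; rewrite (le_trans s0 (us n i)) (le_trans (ut n i ij)).
pose dl (k : 'I_m) (n i : nat) (w : Omega) : R := W k (u n i.+1) w - W k (u n i) w.
have Ddl k n w : D k w = \sum_(i < n.+1) dl k n i w.
  by rewrite (incr_sum (fun x => W k x w) (u n)) un u0.
have Fdl k n i j : (i < j)%N -> (j <= n.+1)%N -> measurable_wrt (F (u n j)) (dl k n i).
  move=> ij jn; apply: (@filt_le _ _ _ _ _ _ F_usual (u n i.+1)).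
  - by have /andP[] := uT n i.+1 (leq_trans ij jn).
  - exact: umono.
  - by have /andP[] := uT n j jn.
  - apply: (incr_adapted F_usual (BW k)).
    + by have /andP[] := uT n i (ltnW (leq_trans ij jn)).
    + exact: umono.
    + by have /andP[] := uT n i.+1 (leq_trans ij jn).
have Fxi n i : (i <= n.+1)%N -> measurable_wrt (F (u n i)) xi.
  move=> ij; apply: (@filt_le _ _ _ _ _ _ F_usual s) => //.
  by have /andP[] := uT n i ij.
have bdl n i : (i < n.+1)%N -> [/\ 0 <= u n i, u n i <= u n i.+1 & u n i.+1 <= T].
  move=> ij; have /andP[? _] := uT n i (ltnW ij); have /andP[_ ?] := uT n i.+1 ij.
  by split => //; exact: umono.
have idl k n i : (i < n.+1)%N -> intg P (dl k n i) /\ Ex P (dl k n i) = 0.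
  by move=> /bdl[? ? ?]; exact: (incr_mean F_usual (BW k)).
have idl2 k n i : (i < n.+1)%N -> intg P (fun w => dl k n i w ^+ 2) /\
    Ex P (fun w => dl k n i w ^+ 2) <= (t - s) / N n.
  by move=> /bdl[? ? ?]; rewrite -(du n i); exact: (incr_sqr F_usual (BW k)).
have mdl k n i : (i < n.+1)%N -> measurable_fun setT (dl k n i).
  by move=> /bdl[? ? ?]; exact: (incr_measurable F_usual (BW k)).
have off k k' n i j (y : Omega -> R) M' : (i < j)%N -> (j < n.+1)%N ->
    measurable_wrt (F s) y -> (forall w, `|y w| <= M') ->
    intg P (fun w => y w * dl k n i w * dl k' n j w) /\
    Ex P (fun w => y w * dl k n i w * dl k' n j w) = 0.
  move=> ij jn my yM; have [? ? ?] := bdl n j jn.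
  have jT := uT n j (ltnW jn).
  have my' : measurable_wrt (F (u n j)) (fun w => y w * dl k n i w).
    apply: measurable_wrtM; first exact: (filt_sigma F_usual).
      by apply: (@filt_le _ _ _ _ _ _ F_usual s) => //; case/andP: jT.
    exact: Fdl ij (ltnW jn).
  apply: (incr_mul0 F_usual (BW k')) => //.
  apply: (@intg_le _ _ _ _ _ (fun w => M' * `|dl k n i w|)).
  - exact: (filt_measurable F_usual jT my').
  - by move=> w; rewrite normrM ler_wpM2r.
  - by apply: intgZ; apply: intg_norm; case: (idl k n i (ltn_trans ij jn)).
have one_ad : measurable_wrt (F s) (fun=> 1 : R).
  exact: measurable_wrt_cst (filt_sigma F_usual sT01) 1.
have one_le (w : Omega) : `|1 : R| <= 1 by rewrite normr1.
have diag k n i j : (i < n.+1)%N -> (j < n.+1)%N ->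
    intg P (fun w => dl k n i w * dl k n j w) /\
    (i != j -> Ex P (fun w => dl k n i w * dl k n j w) = 0).
  move=> iN jN; split.
    by apply: intg_mul; [exact: mdl|exact: mdl|case: (idl2 k n i iN)|case: (idl2 k n j jN)].
  move=> ij.
  wlog : i j iN jN ij / (i < j)%N => [wl|lij].
    move: (ij); rewrite neq_ltn => /orP[lij|lji]; first exact: wl.
    under [X in Ex P X]eq_fun do rewrite mulrC.
    by apply: wl => //; rewrite eq_sym.
  have [_] := off k k n i j (fun=> 1) 1 lij jN one_ad one_le.
  by under [X in Ex P X]eq_fun do rewrite mul1r.
pose Z n w : R := \sum_(i < n.+1) dl r n i w * dl r' n i w.
(* Independence of the two processes factorises this fourth order product; each factor vanishes off
   the diagonal and is at most the cell length on it. *)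
have quad n i j : (i < n.+1)%N -> (j < n.+1)%N ->
    intg P (fun w => (dl r n i w * dl r n j w) * (dl r' n i w * dl r' n j w)) /\
    Ex P (fun w => (dl r n i w * dl r n j w) * (dl r' n i w * dl r' n j w))
      <= (if i == j then ((t - s) / N n) ^+ 2 else 0).
  move=> iN jN.
  have mp k : measurable_wrt (process_sigma T (W k)) (fun w => dl k n i w * dl k n j w).
    apply: measurable_wrtM; first exact: smallest_sigma_algebra.
      by apply: process_sigma_incr; apply: uT => //; exact: ltnW.
    by apply: process_sigma_incr; apply: uT => //; exact: ltnW.
  have mp' k : measurable_fun setT (fun w => dl k n i w * dl k n j w).
    by apply: measurable_funM; exact: mdl.
  have [i1 e1] := diag r n i j iN jN; have [i2 e2] := diag r' n i j iN jN.
  have [i3 ->] := indep_Ex (mp' r) (mp' r') (process_sigma_indep rr' (mp r) (mp r')) i1 i2.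
  split => //; case: eqVneq => [ij|/e1 ->]; last by rewrite mul0r.
  have sqE k : Ex P (fun w => dl k n i w * dl k n j w) = Ex P (fun w => dl k n i w ^+ 2).
    by congr Ex; apply/funext => w; rewrite ij expr2.
  rewrite !sqE expr2; apply: ler_pM; rewrite ?Ex_ge0//; try by move=> w; exact: sqr_ge0.
    by case: (idl2 r n i iN).
  by case: (idl2 r' n i iN).
(* Of the (n + 1)^2 terms only the n + 1 diagonal ones survive, so the second moment is of order
   1/n. *)
have Z2 n : intg P (fun w => Z n w ^+ 2) /\ Ex P (fun w => Z n w ^+ 2) <= (t - s) ^+ 2 / N n.
  have -> : (fun w => Z n w ^+ 2) = fun w => \sum_(i < n.+1) \sum_(j < n.+1)
      (dl r n i w * dl r n j w) * (dl r' n i w * dl r' n j w).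
    apply/funext => w; rewrite expr2 mulr_suml; apply: eq_bigr => i _.
    by rewrite mulr_sumr; apply: eq_bigr => j _; ring.
  split; first by apply: intg_sum => i _; apply: intg_sum => j _; case: (quad n i j).
  rewrite Ex_sum => [|i _]; last by apply: intg_sum => j _; case: (quad n i j).
  have -> : (t - s) ^+ 2 / N n = \sum_(i < n.+1) ((t - s) / N n) ^+ 2.
    by rewrite sumr_const card_ord -[RHS]mulr_natl; rewrite -/(N n); field; rewrite gt_eqF.
  apply: ler_sum => i _; rewrite Ex_sum => [|j _]; last by case: (quad n i j).
  rewrite (bigD1 i)//= -[leRHS]addr0; apply: lerD.
    by have [_] := quad n i i (ltn_ord i) (ltn_ord i); rewrite eqxx.
  apply: sumr_le0 => j ji; have [_] := quad n i j (ltn_ord i) (ltn_ord j).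
  by rewrite eq_sym (negbTE (_ : val j != val i)).
have EZ n : intg P (fun w => xi w * Z n w) /\
    Ex P (fun w => xi w * (D r w * D r' w)) = Ex P (fun w => xi w * Z n w).
  have term (i j : 'I_n.+1) : intg P (fun w => xi w * dl r n i w * dl r' n j w).
    have [->|] := eqVneq i j; last first.
      rewrite neq_ltn => /orP[ij|ji]; first by case: (off r r' n i j xi M ij (ltn_ord j) mxi xiM).
      have [+ _] := off r' r n j i xi M ji (ltn_ord i) mxi xiM.
      by congr intg; apply/funext => w; rewrite mulrAC.
    have [b1 b2 b3] := bdl n j (ltn_ord j).
    have H : intg P (fun w => xi w * (dl r n j w * dl r' n j w)).
      exact: (incr_cross_intg r r' b1 b2 b3 (Fxi n j (ltnW (ltn_ord j))) ixi).
    by move: H; congr intg; apply/funext => w; rewrite mulrA.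
  have E : (fun w => xi w * (D r w * D r' w)) =
      fun w => \sum_(i < n.+1) \sum_(j < n.+1) xi w * dl r n i w * dl r' n j w.
    apply/funext => w; rewrite (Ddl r n) (Ddl r' n) mulr_suml mulr_sumr.
    by apply: eq_bigr => i _; rewrite !mulr_sumr; apply: eq_bigr => j _; rewrite mulrA.
  have EZ : (fun w => xi w * Z n w) = fun w => \sum_(i < n.+1) xi w * dl r n i w * dl r' n i w.
    by apply/funext => w; rewrite mulr_sumr; apply: eq_bigr => i _; rewrite mulrA.
  rewrite E EZ; split; first by apply: intg_sum => i _.
  rewrite !Ex_sum => [|i _|i _]; [|by []|by apply: intg_sum => j _].
  apply: eq_bigr => i _; rewrite Ex_sum// (bigD1 i)//= big1 ?addr0// => j ji.
  move: ji; rewrite neq_ltn => /orP[ji|ij].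
    have [_ <-] := off r' r n j i xi M ji (ltn_ord i) mxi xiM.
    by congr Ex; apply/funext => w; rewrite mulrAC.
  by have [_ ->] := off r r' n i j xi M ij (ltn_ord j) mxi xiM.
apply/eqP/negPn/negP => x0.
set x := `|Ex P (fun w => xi w * (D r w * D r' w))|.
have xgt0 : 0 < x by rewrite normr_gt0.
have Mge0 : 0 <= M.
  rewrite leNgt; apply/negP => M_lt0; move: x0.
  rewrite (_ : (fun w => _) = fun=> 0) ?Ex_cst ?eqxx//.
  by apply/funext => w; have := M0 w; rewrite leNgt M_lt0.
clear M0 one_le.
(* |Z| <= e + Z^2/e bounds x by M e plus a term of order 1/n. This [e] brings the first below x/4,
   and [A] below is the number of cells that brings the second there too, so that x <= x/2. *)
pose e := x / (4 * (M + 1)).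
have M1 : 0 < 4 * (M + 1) by lra.
have e0 : 0 < e by rewrite divr_gt0.
have Me : M * e <= x / 4.
  have : (M + 1) * e = x / 4 by rewrite /e; field; rewrite gt_eqF//; lra.
  by have := ltW e0; lra.
have bound n : x <= M * e + M * ((t - s) ^+ 2 / N n / e).
  have [iZ EZn] := EZ n; have [iZ2 EZ2] := Z2 n.
  rewrite /x EZn; apply: le_trans (Ex_norm_le iZ) _.
  have ib : intg P (fun w => M * e + M / e * Z n w ^+ 2).
    by apply: intgD; [exact: intg_cst|exact: intgZ].
  apply: le_trans (Ex_le (intg_norm iZ) ib _) _; last first.
    rewrite ExD ?Ex_cst ?ExZ//; [|exact: intg_cst|exact: intgZ].
    rewrite lerD2l -mulrA ler_wpM2l// mulrC ler_pM2r ?invr_gt0//.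
  move=> w; rewrite normrM.
  apply: (@le_trans _ _ (M * (e + Z n w ^+ 2 / e))); last by rewrite mulrDr lerD2l; lra.
  apply: ler_pM => //; rewrite -(ler_pM2r e0) mulrDl divfK ?gt_eqF//.
  by rewrite -(@real_normK _ (Z n w)) ?num_real//; have := normr_ge0 (Z n w); nra.
pose A := M * (t - s) ^+ 2 / e * 4 / x.
have [n nA] : exists n, A <= N n.
  exists (Num.bound A); apply/ltW; apply: lt_le_trans (archi_boundP _) _.
    apply: divr_ge0; last exact: ltW.
    apply: mulr_ge0 => //; apply: divr_ge0; last exact: ltW.
    by apply: mulr_ge0 => //; exact: sqr_ge0.
  by rewrite ler_nat.
have bn := bound n.
have bE : M * ((t - s) ^+ 2 / N n / e) = A / N n * (x / 4).
  by rewrite /A; field; rewrite !gt_eqF.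
have AN : A / N n * (x / 4) <= x / 4.
  rewrite ler_piMl//; first by apply: divr_ge0 => //; exact: ltW.
  by rewrite ler_pdivrMr// mul1r.
rewrite bE in bn.
have alg (y a b : R) : y <= a + b -> a <= y / 4 -> b <= y / 4 -> 0 < y -> False.
  by move=> ? ? ? ?; lra.
exact: alg bn Me AN xgt0.
Qed.

(** Truncating [xi] at level n preserves its measurability with respect to the past; dominated
    convergence removes the bound. *)
Lemma incr_cross (xi : Omega -> R) : measurable_wrt (F s) xi -> intg P xi ->
  Ex P (fun w => xi w * (D r w * D r' w)) = 0.
Proof.
move=> mxi ixi.
have ii := incr_cross_intg r r' s0 st tT mxi ixi.
pose k n (x : R) := x * \1_([set x | `|x| <= n%:R]) x.
have mk n : measurable_fun setT (k n).
  apply: measurable_funM => //; apply: measurable_indic.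
  have -> : [set x : R | `|x| <= n%:R] = `[- n%:R, n%:R]%classic.
    by apply/seteqP; split => x /=; rewrite in_itv/= ler_norml.
  exact: measurable_itv.
have k0 n : Ex P (fun w => k n (xi w) * (D r w * D r' w)) = 0.
  apply: (@incr_cross_bounded (fun w => k n (xi w)) n%:R).
    exact: (measurable_wrt_comp (mk n) mxi).
  move=> w; rewrite /k indicE; have [/= h|h] := boolP (xi w \in [set x : R | `|x| <= n%:R]).
    by move: h; rewrite inE mulr1.
  by rewrite mulr0 normr0.
have kle n x : `|k n x| <= `|x|.
  by rewrite /k indicE normrM ler_piMr//; case: (_ \in _); rewrite ?normr1 ?normr0.
have mDD : measurable_fun setT (fun w => D r w * D r' w).
  by apply: measurable_funM; [exact: (incr_measurable F_usual (BW r) s0 st tT)|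
    exact: (incr_measurable F_usual (BW r') s0 st tT)].
have mxi' := filt_measurable F_usual sT01 mxi.
pose h n w := k n (xi w) * (D r w * D r' w).
apply: (@Ex_dominated _ _ _ P h _ (fun w => `|xi w * (D r w * D r' w)|) 0) => //.
- by move=> n; apply: measurable_funM => //; exact: (measurableT_comp (mk n) mxi').
- exact: measurable_funM.
- by move=> n w; rewrite /h [leLHS]normrM [leRHS]normrM; apply: ler_wpM2r => //; exact: kle.
- exact: intg_norm.
- move=> w; apply: cvg_near_cst; exists (Num.bound `|xi w|) => // n /= nb.
  rewrite /h /k indicE mem_set ?mulr1//=; apply: le_trans (ltW (archi_boundP _)) _ => //.
  by rewrite ler_nat.
Qed.

End orthogonal.
End CrossTerms.

(** * Moments of sums over a time grid *)

Section PowRIneq.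
Context {R : realType}.
Implicit Types a b c p u x y : R.

(** exp(-x) >= 1 - x gives exp x <= 1/(1 - x), and (1 + x + 2 x^2)(1 - x) = 1 + x^2 (1 - 2x) >=
    1. *)
Lemma expR_le_taylor2 x : `|x| <= 2^-1 -> expR x <= 1 + x + 2 * x ^+ 2.
Proof.
rewrite ler_norml => /andP[x1 x2].
have := expR_ge1Dx (- x); rewrite expRN => h.
have e0 := expR_gt0 x; have : (1 - x) * expR x <= 1 by rewrite -ler_pdivlMr// div1r.
have h2 : 1 <= (1 + x + 2 * x ^+ 2) * (1 - x).
  have -> : (1 + x + 2 * x ^+ 2) * (1 - x) = 1 + x ^+ 2 * (1 - 2 * x) by ring.
  by rewrite lerDl mulr_ge0 ?sqr_ge0//; lra.
move=> h1; have x3 : 0 < 1 - x by lra.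
by rewrite -(ler_pM2r x3) [leLHS]mulrC; exact: le_trans h2.
Qed.

(* 6561 = 9 ^ 4: either |u| <= 1/8 and (1 + u) ^ p <= exp (p u), or |1 + u| <= 9 |u|. *)
Lemma powR_taylor1 u p : 2 < p <= 4 ->
  `|1 + u| `^ p <= 1 + p * u + 6561 * (u ^+ 2 + `|u| `^ p).
Proof.
move=> /andP[p2 p4]; have pu := powR_ge0 `|u| p; have u2 := sqr_ge0 u.
have [u8|u8] := leP `|u| (8^-1).
  have := u8; rewrite ler_norml => /andP[u81 u82].
  have u1 : 0 <= 1 + u by lra.
  have e1 : `|1 + u| `^ p <= expR (u * p).
    rewrite ger0_norm// expRM; apply: powR_le => //; first lra.
    exact: expR_ge1Dx.
  have pu2 : `|u * p| <= 2^-1.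
    have p0 : 0 <= p by lra.
    rewrite normrM (ger0_norm p0).
    have := normr_ge0 u; nra.
  have e2 := expR_le_taylor2 pu2.
  have p16 : p ^+ 2 <= 16 by nra.
  have e3 : (u * p) ^+ 2 <= 16 * u ^+ 2 by rewrite exprMn mulrC ler_wpM2r.
  have e4 : 0 <= u ^+ 2 by [].
  lra.
have e1 : `|1 + u| <= 9 * `|u|.
  by apply: le_trans (ler_normD _ _) _; rewrite normr1; lra.
have e2 : `|1 + u| `^ p <= 6561 * `|u| `^ p.
  apply: (@le_trans _ _ ((9 * `|u|) `^ p)); first by apply: powR_le => //; lra.
  rewrite powRM// ler_wpM2r//; apply: (@le_trans _ _ (9 `^ 4%:R)).
    by apply: ler_powR => //; lra.
  by rewrite powR_mulrn//; lra.
(* For large u the linear term may be negative; since |u| < 8 u^2 and p <= 4 it is compensated by 32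
   u^2. *)
have e3 : 0 <= p * u + 32 * u ^+ 2.
  have : `|u| <= 8 * u ^+ 2.
    by rewrite -(@real_normK _ u) ?num_real//; nra.
  have := ler_norm (- u); rewrite normrN; nra.
lra.
Qed.

(** The scalar case with u = y/x, multiplied by |x|^p. *)
Lemma powR_taylor x y p : 2 < p <= 4 ->
  `|x + y| `^ p <= `|x| `^ p + p * (`|x| `^ (p - 2) * x) * y
    + 6561 * (`|x| `^ (p - 2) * y ^+ 2 + `|y| `^ p).
Proof.
move=> p24; have /andP[p2 p4] := p24.
have [->|x0] := eqVneq x 0.
  rewrite add0r normr0 !powR0 ?gt_eqF//; [|lra|lra].
  by have := powR_ge0 `|y| p; lra.
have xn : 0 < `|x| by rewrite normr_gt0.
have := powR_taylor1 (y / x) p24; move/(ler_wpM2l (powR_ge0 `|x| p)).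
rewrite -powRM ?normr_ge0// -normrM.
have -> : x * (1 + y / x) = x + y by field.
move=> h; apply: le_trans h _.
have pE : `|x| `^ p = `|x| `^ (p - 2) * x ^+ 2.
  rewrite -(@real_normK _ x) ?num_real// -powR_mulrn// -powRD.
    by congr (_ `^ _); ring.
  by apply/implyP => _; rewrite gt_eqF.
rewrite !mulrDr mulr1.
have e1 : `|x| `^ p * (p * (y / x)) = p * (`|x| `^ (p - 2) * x) * y by rewrite pE; field.
have e2 : `|x| `^ p * (6561 * ((y / x) ^+ 2)) = 6561 * (`|x| `^ (p - 2) * y ^+ 2) by rewrite pE; field.
have e3 : `|x| `^ p * (6561 * `|y / x| `^ p) = 6561 * `|y| `^ p.
  rewrite mulrCA -powRM// -normrM; congr (_ * (`|_| `^ _)); by field.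
by rewrite e1 e2 e3 addrA.
Qed.

Lemma powR_taylor_ex p : 2 < p <= 4 -> exists2 c : R, 4 <= c & forall x y : R,
  `|x + y| `^ p <= `|x| `^ p + p * (`|x| `^ (p - 2) * x) * y
    + c * (`|x| `^ (p - 2) * y ^+ 2 + `|y| `^ p).
Proof. by move=> p24; exists 6561 => [|x y]; [lra|exact: powR_taylor]. Qed.

(** Replace the smaller base by the larger one. This weak form of Young's inequality keeps the
    homogeneity, which is all that the moment estimates use. *)
Lemma powR_weighted_le r k a b : 0 <= r -> 0 <= k -> 0 <= a -> 0 <= b ->
  a `^ r * b `^ k <= a `^ (r + k) + b `^ (r + k).
Proof.
move=> r0 k0 a0 b0; have := powR_ge0 a (r + k); have := powR_ge0 b (r + k).
have aux c : 0 <= c -> c `^ r * c `^ k <= c `^ (r + k).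
  rewrite le_eqVlt => /predU1P[<-|c0]; last by rewrite powRD//; apply/implyP => _; rewrite gt_eqF.
  have [->|r1] := eqVneq r 0; first by rewrite add0r powRr0 mul1r.
  by rewrite (powR0 r1) mul0r powR_ge0.
move=> h1 h2; have [ab|/ltW ba] := leP a b.
  apply: le_trans (_ : _ <= b `^ r * b `^ k) _; last by have := aux b b0; lra.
  by apply: ler_wpM2r; [exact: powR_ge0|exact: powR_le].
apply: le_trans (_ : _ <= a `^ r * a `^ k) _; last by have := aux a a0; lra.
by apply: ler_wpM2l; [exact: powR_ge0|exact: powR_le].
Qed.

Lemma powRD2_le a b p : 0 <= p <= 4 -> 0 <= a -> 0 <= b ->
  (a + b) `^ p <= 16 * (a `^ p + b `^ p).
Proof.
move=> /andP[p0 p4] a0 b0; have pa := powR_ge0 a p; have pb := powR_ge0 b p.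
have p16 : 2 `^ p <= 16 :> R.
  apply: (@le_trans _ _ (2 `^ 4%:R)); first by apply: ler_powR => //; lra.
  by rewrite powR_mulrn//; lra.
have aux c : 0 <= c -> (2 * c) `^ p <= 16 * c `^ p.
  by move=> c0; rewrite powRM// ler_wpM2r// powR_ge0.
have [ab|/ltW ba] := leP a b.
  by apply: (@le_trans _ _ ((2 * b) `^ p)); [apply: powR_le; lra|have := aux b b0; lra].
by apply: (@le_trans _ _ ((2 * a) `^ p)); [apply: powR_le; lra|have := aux a a0; lra].
Qed.

Lemma powR_sum_le (n : nat) (x : 'I_n -> R) p : 0 < p ->
  `|\sum_i x i| `^ p <= n%:R `^ p * \sum_i `|x i| `^ p.
Proof.
case: n x => [x p0|n x p0].
  by rewrite !big_ord0 normr0 mulr0 powR0 ?gt_eqF.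
pose M := \big[Num.max/0]_i `|x i|.
have xM i : `|x i| <= M by exact: le_bigmax.
have M0 : 0 <= M by exact: le_trans (xM ord0).
apply: (@le_trans _ _ ((n.+1%:R * M) `^ p)).
  apply: powR_le => //; first exact: ltW.
  apply: le_trans (ler_norm_sum _ _ _) _.
  rewrite -[n.+1 in leRHS]card_ord mulr_natl -sumr_const.
  exact: ler_sum.
rewrite powRM// ler_wpM2l ?powR_ge0//.
have [i ->] : exists i, M = `|x i|.
  have := @bigmax_eq_arg _ R 'I_n.+1 0 ord0 predT (fun i => `|x i|) isT (fun i _ => normr_ge0 _).
  by move=> h; rewrite /M; eexists; exact: h.
by rewrite (bigD1 i)//= lerDl sumr_ge0// => j _; exact: powR_ge0.
Qed.

End PowRIneq.

Section GridSums.
Context {disp : measure_display} {Omega : measurableType disp} {R : realType}.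
Variables (P : probability Omega R) (T : R) (F : R -> set (set Omega)).
Hypothesis F_usual : usual_filtration P T F.
Variables (m : nat) (W : 'I_m -> R -> Omega -> R).
Hypothesis BW : forall r, brownian P T F (W r).

Section step.
Variables s t : R.
Hypotheses (s0 : 0 <= s) (st : s <= t) (tT : t <= T).
Local Notation D r := (fun w => W r t w - W r s w).
Let sT01 : 0 <= s <= T. Proof. by rewrite s0 (le_trans st). Qed.
Let sF := filt_sigma F_usual sT01.

(** One step of the Ito isometry: expanding the square, the linear terms vanish because increments
    are centred given the past, the products of different Brownian motions vanish by [incr_cross],
    and the diagonal carries the variance t - s. *)
Lemma step_sqr (W_indep : independent_processes P T W) (v : Omega -> R) (th : 'I_m -> Omega -> R) :
  measurable_wrt (F s) v -> intg P (fun w => v w ^+ 2) ->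
  (forall r, measurable_wrt (F s) (th r)) -> (forall r, intg P (fun w => th r w ^+ 2)) ->
  intg P (fun w => (v w + \sum_r th r w * D r w) ^+ 2) /\
  Ex P (fun w => (v w + \sum_r th r w * D r w) ^+ 2)
    <= Ex P (fun w => v w ^+ 2) + (t - s) * \sum_r Ex P (fun w => th r w ^+ 2).
Proof.
move=> mv iv mth ith.
have mv' := filt_measurable F_usual sT01 mv.
have mth' r := filt_measurable F_usual sT01 (mth r).
have E : (fun w => (v w + \sum_r th r w * D r w) ^+ 2) =
  fun w => v w ^+ 2 + 2 * (\sum_r (v w * th r w) * D r w)
    + \sum_r \sum_r' (th r w * th r' w) * (D r w * D r' w).
  apply/funext => w; rewrite sqrrD; congr (_ + _ + _).
    by rewrite -mulr_natl; congr (_ * _); rewrite mulr_sumr; apply: eq_bigr => r _; rewrite mulrA.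
  rewrite expr2 mulr_suml; apply: eq_bigr => r _; rewrite mulr_sumr.
  by apply: eq_bigr => r' _; ring.
have mvth r : measurable_wrt (F s) (fun w => v w * th r w) by exact: measurable_wrtM.
have ivth r : intg P (fun w => v w * th r w) by exact: intg_mul.
have mtt r r' : measurable_wrt (F s) (fun w => th r w * th r' w) by exact: measurable_wrtM.
have itt r r' : intg P (fun w => th r w * th r' w) by exact: intg_mul.
have lin r := incr_mul0 F_usual (BW r) s0 st tT (mvth r) (ivth r).
have quad r r' : intg P (fun w => (th r w * th r' w) * (D r w * D r' w)).
  exact: (incr_cross_intg F_usual BW r r' s0 st tT).
rewrite E; split.
  apply: intgD; last by apply: intg_sum => r _; apply: intg_sum => r' _.
  by apply: intgD => //; apply: intgZ; apply: intg_sum => r _; case: (lin r).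
have isum1 : intg P (fun w => \sum_r (v w * th r w) * D r w).
  by apply: intg_sum => r _; case: (lin r).
rewrite ExD; [|by apply: intgD => //; exact: intgZ|by apply: intg_sum => r _; apply: intg_sum => r' _].
rewrite ExD ?ExZ//; last exact: intgZ.
rewrite Ex_sum => [|r _]; last by case: (lin r).
rewrite big1 ?mulr0 ?addr0 => [|r _]; last by case: (lin r).
rewrite lerD2l Ex_sum => [|r _]; last by apply: intg_sum => r' _.
rewrite mulr_sumr; apply: ler_sum => r _.
rewrite Ex_sum// (bigD1 r)//= big1 ?addr0 => [|r' rr'].
  have [_] := incr_mul_sqr F_usual (BW r) s0 st tT (mtt r r) (itt r r) (fun w => sqr_ge0 _).
  apply: le_trans; rewrite le_eqVlt; apply/orP; left; apply/eqP.
  by congr Ex; apply/funext => w; rewrite -expr2.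
by apply: (incr_cross F_usual BW W_indep) => //; rewrite eq_sym.
Qed.

End step.

Section grid.
Variables (K : nat) (tau : nat -> R).
Hypothesis tau0 : 0 <= tau 0%N.
Hypothesis tauT : tau K <= T.
Hypothesis tau_mono : forall j, (j < K)%N -> tau j <= tau j.+1.

Lemma grid_le i j : (i <= j)%N -> (j <= K)%N -> tau i <= tau j.
Proof.
move=> ij; rewrite -(subnKC ij); elim: (j - i)%N => [|n ih] h; first by rewrite addn0.
rewrite addnS in h *; apply: le_trans (tau_mono h); apply: ih; exact: ltnW.
Qed.

Lemma grid_mem j : (j <= K)%N -> 0 <= tau j <= T.
Proof.
move=> jK; rewrite (le_trans tau0 (grid_le (leq0n j) jK)) /=.
exact: le_trans (grid_le jK (leqnn K)) tauT.
Qed.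

Lemma grid_step j : (j < K)%N -> [/\ 0 <= tau j, tau j <= tau j.+1 & tau j.+1 <= T].
Proof.
move=> jK; have /andP[? _] := grid_mem (ltnW jK); have /andP[_ ?] := grid_mem jK.
by split => //; exact: tau_mono.
Qed.

Lemma grid_sum_adapted (v : Omega -> R) (th : nat -> 'I_m -> Omega -> R) k : (k <= K)%N ->
  measurable_wrt (F (tau 0%N)) v ->
  (forall j r, (j < k)%N -> measurable_wrt (F (tau j)) (th j r)) ->
  measurable_wrt (F (tau k)) (fun w => v w + \sum_(j < k) \sum_r th j r w *
    (W r (tau j.+1) w - W r (tau j) w)).
Proof.
move=> kK mv mth; have kT := grid_mem kK.
have up j (Y : Omega -> R) : (j <= k)%N -> measurable_wrt (F (tau j)) Y -> measurable_wrt (F (tau k)) Y.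
  move=> jk; have /andP[? _] := grid_mem (leq_trans jk kK).
  by apply: (filt_le F_usual) => //; [exact: grid_le|case/andP: kT].
have sF := filt_sigma F_usual kT.
apply: measurable_wrtD => //; first exact: up mv.
apply: measurable_wrt_sum => // j _; apply: measurable_wrt_sum => // r _.
apply: measurable_wrtM => //; first exact: up (ltnW (ltn_ord j)) (mth _ _ (ltn_ord j)).
have [? ? ?] := grid_step (leq_trans (ltn_ord j) kK).
by apply: up (ltn_ord j) _; exact: (incr_adapted F_usual (BW r)).
Qed.

Lemma grid_sqr (W_indep : independent_processes P T W) (v : Omega -> R) (th : nat -> 'I_m -> Omega -> R) :
  measurable_wrt (F (tau 0%N)) v -> intg P (fun w => v w ^+ 2) ->
  (forall j r, (j < K)%N -> measurable_wrt (F (tau j)) (th j r)) ->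
  (forall j r, (j < K)%N -> intg P (fun w => th j r w ^+ 2)) ->
  intg P (fun w => (v w + \sum_(j < K) \sum_r th j r w * (W r (tau j.+1) w - W r (tau j) w)) ^+ 2) /\
  Ex P (fun w => (v w + \sum_(j < K) \sum_r th j r w * (W r (tau j.+1) w - W r (tau j) w)) ^+ 2)
    <= Ex P (fun w => v w ^+ 2)
       + \sum_(j < K) (tau j.+1 - tau j) * \sum_r Ex P (fun w => th j r w ^+ 2).
Proof.
move=> mv iv mth ith.
pose V k w := v w + \sum_(j < k) \sum_r th j r w * (W r (tau j.+1) w - W r (tau j) w).
suff H k : (k <= K)%N -> intg P (fun w => V k w ^+ 2) /\ Ex P (fun w => V k w ^+ 2)
    <= Ex P (fun w => v w ^+ 2)
       + \sum_(j < k) (tau j.+1 - tau j) * \sum_r Ex P (fun w => th j r w ^+ 2).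
  exact: H (leqnn K).
elim: k => [_|k ih kK].
  have -> : (fun w => V 0%N w ^+ 2) = fun w => v w ^+ 2.
    by apply/funext => w; rewrite /V big_ord0 addr0.
  by rewrite big_ord0 addr0.
have [ik ek] := ih (ltnW kK).
have mk := grid_sum_adapted (ltnW kK) mv (fun j r jk => mth j r (ltn_trans jk kK)).
have [b1 b2 b3] := grid_step kK.
have [i e] := step_sqr b1 b2 b3 W_indep mk ik (fun r => mth k r kK) (fun r => ith k r kK).
have -> : (fun w => V k.+1 w ^+ 2) = fun w => (V k w + \sum_r th k r w * (W r (tau k.+1) w - W r (tau k) w)) ^+ 2.
  by apply/funext => w; rewrite /V big_ord_recr /= addrA.
split => //; apply: le_trans e _; rewrite big_ord_recr /= addrA lerD2r//.
Qed.

End grid.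
End GridSums.

(** * Moments of order p of sums over a grid *)

Section StepPowR.
Context {disp : measure_display} {Omega : measurableType disp} {R : realType}.
Variables (P : probability Omega R) (T : R) (F : R -> set (set Omega)).
Hypothesis F_usual : usual_filtration P T F.
Variable W : R -> Omega -> R.
Hypothesis BW : brownian P T F W.
Variable p : R.
Hypothesis p24 : 2 < p <= 4.
Variable c : R.
Hypothesis c4 : 4 <= c.
Hypothesis powR_expansion : forall x y : R,
  `|x + y| `^ p <= `|x| `^ p + p * (`|x| `^ (p - 2) * x) * y
    + c * (`|x| `^ (p - 2) * y ^+ 2 + `|y| `^ p).

Let c0 : 0 <= c. Proof. exact: le_trans c4. Qed.

Let p2 : 2 < p. Proof. by case/andP: p24. Qed.
Let p4 : p <= 4. Proof. by case/andP: p24. Qed.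

Let p0 : 0 <= p. Proof. by move: p2; lra. Qed.
Let p1 : 0 <= p - 1. Proof. by move: p2; lra. Qed.
Let pm2 : 0 <= p - 2. Proof. by move: p2; lra. Qed.

Let normp (x : R) := `|x| `^ p.
Let normp_ge0 x : 0 <= normp x. Proof. exact: powR_ge0. Qed.

Let measurable_normp : measurable_fun setT normp.
Proof. exact: (measurableT_comp (measurable_powR p)). Qed.

Section step.
Variables s t H : R.
Hypotheses (s0 : 0 <= s) (st : s <= t) (tT : t <= T) (H_gt0 : 0 < H) (stH : t - s <= H).
Let sT01 : 0 <= s <= T. Proof. by rewrite s0 (le_trans st). Qed.
Let sF := filt_sigma F_usual sT01.
Let D := (fun w => W t w - W s w).
(** [H] is to be the length of the whole grid and [rho] the share of one step in it. These shares
    add up to 1, so growth factors 1 + K rho multiply to at most exp K, however fine the grid. *)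
Let rho := (t - s) / H.
Let rho0 : 0 <= rho. Proof. by rewrite divr_ge0 ?subr_ge0// ltW. Qed.
Let rho1 : rho <= 1. Proof. by rewrite ler_pdivrMr// mul1r. Qed.
Let rhoH : rho * H = t - s. Proof. by rewrite divfK// gt_eqF. Qed.

Let powR_rho a : 1 <= a -> (t - s) `^ a <= rho * H `^ a.
Proof.
move=> a1; rewrite -rhoH powRM// ?(ltW H_gt0)// ler_wpM2r ?powR_ge0//.
move: rho0; rewrite le_eqVlt => /predU1P[<-|r0]; first by rewrite powR0// gt_eqF// (lt_le_trans ltr01).
by apply: ge1r_powR => //; rewrite r0.
Qed.

(** The second order expansion at [v]. The noise term of first order is isolated because its
    expectation vanishes; drift terms receive a factor [rho] from (rho H)^a <= rho H^a for a >=
    1. *)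
Lemma step_powR_pointwise (v b xi dw : R) :
  normp (v + ((t - s) * b + xi * dw)) <=
    normp v + rho * ((4 + c * 2) * normp v + (4 + c * 18) * (H `^ p * normp b))
    + p * (`|v| `^ (p - 2) * v * xi * dw)
    + c * (2 * (`|v| `^ (p - 2) * xi ^+ 2 * dw ^+ 2) + 16 * (normp xi * normp dw)).
Proof.
rewrite /normp; set y := (t - s) * b + xi * dw.
have tay := powR_expansion v y.
have vp := powR_ge0 `|v| (p - 2).
have pE : `|H * b| `^ p = H `^ p * `|b| `^ p.
  by rewrite normrM powRM// gtr0_norm.
have dE : (t - s) * b = rho * (H * b) by rewrite mulrA rhoH.
have y2 : y ^+ 2 <= 2 * (rho * (H * b) ^+ 2) + 2 * (xi ^+ 2 * dw ^+ 2).
  have : y ^+ 2 <= 2 * ((rho * (H * b)) ^+ 2) + 2 * (xi * dw) ^+ 2.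
    rewrite /y dE; move: (rho * (H * b)) (xi * dw) => u1 u2; have := sqr_ge0 (u1 - u2); nra.
  have aux (r z : R) : 0 <= r -> r <= 1 -> (r * z) ^+ 2 <= r * z ^+ 2.
    move=> r0 r1; rewrite exprMn (expr2 r) -(mulrA r) ler_piMl//.
    by apply: mulr_ge0 => //; exact: sqr_ge0.
  have := aux rho (H * b) rho0 rho1.
  have -> : (xi * dw) ^+ 2 = xi ^+ 2 * dw ^+ 2 by rewrite exprMn.
  move: (rho * (H * b) ^+ 2) ((rho * (H * b)) ^+ 2) => u1 u2; lra.
have lin : (`|v| `^ (p - 2) * v) * y <= rho * (`|v| `^ p + H `^ p * `|b| `^ p)
    + `|v| `^ (p - 2) * v * xi * dw.
  rewrite /y mulrDr -(mulrA (_ * v)) lerD2r dE mulrCA ler_wpM2l// -pE.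
  apply: le_trans (ler_norm _) _; rewrite !normrM (ger0_norm vp).
  rewrite -normrM; have pw := @powR_weighted_le R (p - 1) 1 `|v| `|H * b|.
  rewrite subrK (powRr1 (normr_ge0 (H * b))) in pw.
  apply: le_trans (pw p1 ler01 (normr_ge0 _) (normr_ge0 _)).
  apply: ler_wpM2r => //.
  have [->|v0] := eqVneq v 0; first by rewrite normr0 mulr0 powR_ge0.
  have -> : `|v| `^ (p - 1) = `|v| `^ (p - 2) * `|v|.
    rewrite (_ : p - 1 = (p - 2) + 1); last by ring.
    rewrite powRD; last by apply/implyP => _; rewrite normr_eq0.
    by rewrite powRr1.
  by [].
have quad : `|v| `^ (p - 2) * (H * b) ^+ 2 <= `|v| `^ p + H `^ p * `|b| `^ p.
  rewrite -pE -(@real_normK _ (H * b)) ?num_real// -powR_mulrn//.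
  have pw := @powR_weighted_le R (p - 2) 2%:R `|v| `|H * b|.
  by rewrite subrK in pw; exact: pw.
have yp : `|y| `^ p <= 16 * (rho * (H `^ p * `|b| `^ p) + `|xi| `^ p * `|dw| `^ p).
  apply: (@le_trans _ _ ((`|(t - s) * b| + `|xi * dw|) `^ p)).
    by apply: powR_le => //; exact: ler_normD.
  apply: le_trans (powRD2_le _ _ _) _ => //; first by rewrite p0 p4.
  rewrite ler_pM2l// !normrM !powRM// lerD2r mulrA ler_wpM2r ?powR_ge0//.
  by rewrite ger0_norm ?subr_ge0//; apply: powR_rho; rewrite -subr_ge0.
have h1 : p * (`|v| `^ (p - 2) * v) * y <= p * (rho * (`|v| `^ p + H `^ p * `|b| `^ p))
    + p * (`|v| `^ (p - 2) * v * xi * dw).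
  by rewrite -[leRHS]mulrDr -[leLHS]mulrA; apply: ler_wpM2l.
have h2 := ler_wpM2l vp y2.
have h3 := ler_wpM2l rho0 quad.
have h4 : p * (rho * (`|v| `^ p + H `^ p * `|b| `^ p)) <= 4 * (rho * (`|v| `^ p + H `^ p * `|b| `^ p)).
  by apply: ler_wpM2r => //; rewrite mulr_ge0// addr_ge0 ?mulr_ge0 ?powR_ge0.
have e2 : `|v| `^ (p - 2) * (2 * (rho * (H * b) ^+ 2) + 2 * (xi ^+ 2 * dw ^+ 2)) =
    2 * (rho * (`|v| `^ (p - 2) * (H * b) ^+ 2)) + 2 * (`|v| `^ (p - 2) * xi ^+ 2 * dw ^+ 2) by ring.
rewrite e2 in h2.
have alg (S V L U U' Y PR N HB rU X r : R) : S <= V + L + c * (U + Y) ->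
    L <= PR + N -> U <= 2 * rU + 2 * U' -> rU <= r * (V + HB) -> PR <= 4 * (r * (V + HB)) ->
    Y <= 16 * (r * HB + X) ->
    S <= V + r * ((4 + c * 2) * V + (4 + c * 18) * HB) + N + c * (2 * U' + 16 * X).
  move=> h1' h2' h3' h4' h5' h6'.
  have : c * (U + Y) <= c * (2 * (r * (V + HB)) + 2 * U' + 16 * (r * HB + X)).
    by apply: ler_wpM2l => //; lra.
  by move=> h7; lra.
exact: alg tay h1 h2 h3 h4 yp.
Qed.

Let powR_half_sqr (x : R) : (Num.sqrt H * `|x|) `^ p = H `^ (p / 2) * normp x.
Proof.
rewrite powRM ?sqrtr_ge0// -powR12_sqrt ?(ltW H_gt0)// -powRrM.
by congr (H `^ _ * _); field.
Qed.

Let weighted_sqr (v xi : R) : H * (`|v| `^ (p - 2) * xi ^+ 2) <= normp v + H `^ (p / 2) * normp xi.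
Proof.
rewrite -powR_half_sqr mulrCA.
have -> : H * xi ^+ 2 = (Num.sqrt H * `|xi|) `^ 2%:R.
  by rewrite powR_mulrn ?mulr_ge0 ?sqrtr_ge0// exprMn sqr_sqrtr ?(ltW H_gt0)// real_normK ?num_real.
have pw := @powR_weighted_le R (p - 2) 2%:R `|v| (Num.sqrt H * `|xi|).
by rewrite subrK in pw; apply: pw; rewrite ?mulr_ge0 ?sqrtr_ge0.
Qed.

(** The largest coefficient is that of [X], namely (2 + 16 * 130) c = 2082 c; the factor 15 * 140 =
    2100 covers it, and those of [V] and [B] as well since 4 <= c. *)
Let step_arith (r V B X Y2 Y3 d2 d3 : R) : 0 <= r * V -> 0 <= r * B -> 0 <= r * X ->
   d2 <= r * (V + X) -> Y2 <= d2 -> d3 <= r * X -> Y3 <= 130 * d3 ->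
   r * ((4 + c * 2) * V + (4 + c * 18) * B) + c * (2 * Y2 + 16 * Y3)
   <= r * (c * (15 * 140) * (V + B + X)).
Proof.
move=> V0' B0' X0' d2' Y2' d3' Y3'.
have := ler_wpM2r V0' c4; have := ler_wpM2r B0' c4.
have : c * (2 * Y2 + 16 * Y3) <= c * (2 * (r * (V + X)) + 16 * (130 * (r * X))).
  by apply: ler_wpM2l => //; lra.
have := mulr_ge0 c0 V0'; have := mulr_ge0 c0 B0'; have := mulr_ge0 c0 X0'.
by move=> ? ? ? ? ? ?; lra.
Qed.

(** After the first order noise term has dropped out, the remaining noise terms carry (t - s) and (t
    - s)^(p/2); as p > 2, both are at most [rho] times a power of [H]. *)
Lemma step_powR (v b xi : Omega -> R) :
  measurable_wrt (F s) v -> measurable_wrt (F s) b -> measurable_wrt (F s) xi ->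
  intg P (fun w => normp (v w)) -> intg P (fun w => normp (b w)) ->
  intg P (fun w => normp (xi w)) ->
  intg P (fun w => normp (v w + ((t - s) * b w + xi w * D w))) /\
  Ex P (fun w => normp (v w + ((t - s) * b w + xi w * D w))) <=
    Ex P (fun w => normp (v w)) + rho * (c * (15 * 140) * (Ex P (fun w => normp (v w))
      + H `^ p * Ex P (fun w => normp (b w)) + H `^ (p / 2) * Ex P (fun w => normp (xi w)))).
Proof.
move=> mv mb mxi iv ib ixi.
have mv' := filt_measurable F_usual sT01 mv.
have mb' := filt_measurable F_usual sT01 mb.
have mxi' := filt_measurable F_usual sT01 mxi.
have mD : measurable_fun setT D by exact: (incr_measurable F_usual BW).
have mpow r : measurable_fun setT (fun x : R => `|x| `^ r).
  exact: (measurableT_comp (measurable_powR r)).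
have mvp : measurable_wrt (F s) (fun w => `|v w| `^ (p - 2)) by exact: (measurable_wrt_comp (mpow _) mv).
have m1 : measurable_wrt (F s) (fun w => `|v w| `^ (p - 2) * v w * xi w).
  by apply: measurable_wrtM => //; exact: measurable_wrtM.
have m2 : measurable_wrt (F s) (fun w => `|v w| `^ (p - 2) * xi w ^+ 2).
  apply: measurable_wrtM => //.
  exact: (measurable_wrt_comp (@exprn_measurable _ _ 2) mxi).
have i1 : intg P (fun w => `|v w| `^ (p - 2) * v w * xi w).
  apply: (intg_le _ _ (intgD iv ixi)); first exact: (filt_measurable F_usual sT01 m1).
  move=> w; rewrite !normrM (ger0_norm (powR_ge0 _ _)).
  have pw := @powR_weighted_le R (p - 1) 1 `|v w| `|xi w|.
  rewrite subrK (powRr1 (normr_ge0 (xi w))) in pw.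
  apply: le_trans (pw p1 ler01 (normr_ge0 _) (normr_ge0 _)).
  apply: ler_wpM2r => //; have [->|v0] := eqVneq (v w) 0.
    by rewrite normr0 mulr0 powR_ge0.
  have -> : `|v w| `^ (p - 1) = `|v w| `^ (p - 2) * `|v w|.
    rewrite (_ : p - 1 = (p - 2) + 1); last by ring.
    rewrite powRD; last by apply/implyP => _; rewrite normr_eq0.
    by rewrite powRr1.
  by [].
have bnd2 w : `|v w| `^ (p - 2) * xi w ^+ 2 <= H^-1 * (normp (v w) + H `^ (p / 2) * normp (xi w)).
  by rewrite [leRHS]mulrC ler_pdivlMr// mulrC weighted_sqr.
have ibnd2 : intg P (fun w => H^-1 * (normp (v w) + H `^ (p / 2) * normp (xi w))).
  by apply: intgZ; apply: intgD => //; exact: intgZ.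
have i2 : intg P (fun w => `|v w| `^ (p - 2) * xi w ^+ 2).
  apply: (intg_le _ _ ibnd2); first exact: (filt_measurable F_usual sT01 m2).
  by move=> w; rewrite ger0_norm// mulr_ge0 ?powR_ge0 ?sqr_ge0.
have nn2 w : 0 <= `|v w| `^ (p - 2) * xi w ^+ 2 by rewrite mulr_ge0 ?powR_ge0 ?sqr_ge0.
have [j1 e1] := incr_mul0 F_usual BW s0 st tT m1 i1.
have [j2 e2] := incr_mul_sqr F_usual BW s0 st tT m2 i2 nn2.
have p04 : 0 < p <= 4 by rewrite p4 andbT (lt_trans _ p2).
have mnxi : measurable_wrt (F s) (fun w => normp (xi w)) by exact: (measurable_wrt_comp (mpow _) mxi).
have [j3 e3] := incr_mul_powR F_usual BW s0 st tT p04 mnxi ixi (fun w => normp_ge0 _).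
have pw w := step_powR_pointwise (v w) (b w) (xi w) (D w).
set rhs := (fun w => normp (v w) + rho * ((4 + c * 2) * normp (v w) + (4 + c * 18) * (H `^ p * normp (b w)))
    + p * (`|v w| `^ (p - 2) * v w * xi w * D w)
    + c * (2 * (`|v w| `^ (p - 2) * xi w ^+ 2 * D w ^+ 2) + 16 * (normp (xi w) * normp (D w)))).
have k1 : intg P (fun w => (4 + c * 2) * normp (v w) + (4 + c * 18) * (H `^ p * normp (b w))).
  by apply: intgD; apply: intgZ => //; exact: intgZ.
have k2 : intg P (fun w => normp (v w) + rho * ((4 + c * 2) * normp (v w) + (4 + c * 18) * (H `^ p * normp (b w)))).
  by apply: intgD => //; exact: intgZ.
have k3 : intg P (fun w => 2 * (`|v w| `^ (p - 2) * xi w ^+ 2 * D w ^+ 2) + 16 * (normp (xi w) * normp (D w))).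
  by apply: intgD; exact: intgZ.
have k4 : intg P (fun w => normp (v w) + rho * ((4 + c * 2) * normp (v w) + (4 + c * 18) * (H `^ p * normp (b w)))
    + p * (`|v w| `^ (p - 2) * v w * xi w * D w)).
  by apply: intgD => //; exact: intgZ.
have irhs : intg P rhs by apply: intgD => //; exact: intgZ.
have iy : intg P (fun w => normp (v w + ((t - s) * b w + xi w * D w))).
  apply: (intg_le _ _ irhs).
    apply: (measurableT_comp measurable_normp).
    by apply: measurable_funD => //; apply: measurable_funD; apply: measurable_funM.
  by move=> w; rewrite ger0_norm.
split => //; apply: le_trans (Ex_le iy irhs pw) _.
rewrite /rhs ExD//; last exact: intgZ.
rewrite ExD//; last exact: intgZ.
rewrite ExD//; last exact: intgZ.
rewrite (ExZ rho k1) (ExZ p j1) (ExZ c k3) e1 mulr0 addr0.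
rewrite ExD; [|exact: intgZ|by apply: intgZ; exact: intgZ].
rewrite (ExZ _ iv) (ExZ _ (intgZ _ ib)) (ExZ _ ib).
rewrite ExD; [|exact: intgZ|exact: intgZ].
rewrite (ExZ _ j2) (ExZ _ j3) -addrA lerD2l.
have E2 : (t - s) * Ex P (fun w => `|v w| `^ (p - 2) * xi w ^+ 2) <=
    rho * (Ex P (fun w => normp (v w)) + H `^ (p / 2) * Ex P (fun w => normp (xi w))).
  rewrite -rhoH -mulrA ler_wpM2l//.
  rewrite -(ExZ _ ixi) -ExD//; last exact: intgZ.
  rewrite -ExZ//; apply: Ex_le; [exact: intgZ|by apply: intgD => //; exact: intgZ|].
  by move=> w; exact: weighted_sqr.
have hp : (t - s) `^ (p / 2) <= rho * H `^ (p / 2).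
  by apply: powR_rho; rewrite ler_pdivlMr// mul1r ltW.
have E3 := ler_wpM2r (Ex_ge0 P (fun w => normp_ge0 (xi w))) hp.
have V0 : 0 <= rho * Ex P (fun w => normp (v w)) by rewrite mulr_ge0 ?Ex_ge0.
have B0 : 0 <= rho * (H `^ p * Ex P (fun w => normp (b w))).
  apply: (mulr_ge0 rho0); apply: mulr_ge0; first exact: powR_ge0.
  by apply: Ex_ge0 => w; exact: normp_ge0.
have X0 : 0 <= rho * (H `^ (p / 2) * Ex P (fun w => normp (xi w))).
  apply: (mulr_ge0 rho0); apply: mulr_ge0; first exact: powR_ge0.
  by apply: Ex_ge0 => w; exact: normp_ge0.
apply: (step_arith V0 B0 X0 E2 e2 _ _).
  by rewrite mulrA; exact: E3.
by rewrite mulrA; exact: e3.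
Qed.

End step.

Let grid_arith1 (u r Kp q1 q2 Q : R) : r * Kp * (q1 + q2) <= r * Kp * Q ->
  u + r * (Kp * (u + q1 + q2)) <= u * (1 + Kp * r) + Kp * Q * r.
Proof. by move=> ?; lra. Qed.

Let grid_arith2 (A G X a r : R) : A <= G * (X * a) -> X * r <= G * (X * r) ->
  A + X * r <= G * (X * (a + r)).
Proof. by move=> ? ?; lra. Qed.

Section grid.
Variables (K : nat) (tau : nat -> R).
Hypothesis tau0 : 0 <= tau 0%N.
Hypothesis tauT : tau K <= T.
Hypothesis tau_mono : forall j, (j < K)%N -> tau j <= tau j.+1.
Hypothesis tau0K : tau 0%N < tau K.

(** A Gronwall induction with the elapsed share [sg k] of the interval as clock. The bound does not
    involve the number of grid points, so it survives refinement of the grid. *)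
Lemma grid_powR (b xi : nat -> Omega -> R) (M : R) :
  (forall j, (j < K)%N -> measurable_wrt (F (tau j)) (b j)) ->
  (forall j, (j < K)%N -> measurable_wrt (F (tau j)) (xi j)) ->
  (forall j, (j < K)%N -> intg P (fun w => normp (b j w)) /\ Ex P (fun w => normp (b j w)) <= M) ->
  (forall j, (j < K)%N -> intg P (fun w => normp (xi j w)) /\ Ex P (fun w => normp (xi j w)) <= M) ->
  let S w := \sum_(j < K) ((tau j.+1 - tau j) * b j w + xi j w * (W (tau j.+1) w - W (tau j) w)) in
  let H := tau K - tau 0%N in
  intg P (fun w => normp (S w)) /\
  Ex P (fun w => normp (S w)) <=
    expR (c * (15 * 140)) * (c * (15 * 140)) * ((H `^ p + H `^ (p / 2)) * M).
Proof.
move=> mb mxi ib ixi S H.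
have H0 : 0 < H by rewrite subr_gt0.
pose Sk k w := \sum_(j < k) ((tau j.+1 - tau j) * b j w + xi j w * (W (tau j.+1) w - W (tau j) w)).
have [Kp KpE] : exists Kp : R, Kp = c * (15 * 140) by exists (c * (15 * 140)).
have Kp0 : 0 <= Kp by move: c0 => ?; rewrite KpE; lra.
rewrite -KpE.
pose Q := (H `^ p + H `^ (p / 2)) * M.
pose sg k := (tau k - tau 0%N) / H.
have HpE := powR_ge0 H p; have Hp2 := powR_ge0 H (p / 2).
have gmem := grid_mem tau0 tauT tau_mono.
have gle := grid_le tau_mono.
have gstep := grid_step tau0 tauT tau_mono.
suff key k : (k <= K)%N -> [/\ measurable_wrt (F (tau k)) (Sk k), intg P (fun w => normp (Sk k w))
    & Ex P (fun w => normp (Sk k w)) <= expR (Kp * sg k) * (Kp * Q * sg k)].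
  have [_ i e] := key K (leqnn K); split => //; apply: le_trans e _.
  by rewrite /sg divff ?gt_eqF// !mulr1 mulrA.
elim: k => [_|k ih kK].
  have S0 : Sk 0%N = fun=> 0 by apply/funext => w; rewrite /Sk big_ord0.
  rewrite S0 /sg subrr mul0r !mulr0; split.
  - exact: (measurable_wrt_cst (filt_sigma F_usual (gmem 0%N (leq0n K))) 0).
  - exact: intg_cst.
  - by rewrite Ex_cst /normp normr0 powR0// gt_eqF// (lt_trans _ p2).
have [mk ik ek] := ih (ltnW kK).
have [b1 b2 b3] := gstep k kK.
have dH : tau k.+1 - tau k <= H.
  by apply: lerB; [exact: gle|exact: gle (leq0n k) (ltnW kK)].
have [ibk ebk] := ib k kK; have [ixk exk] := ixi k kK.
have [i e] := step_powR b1 b2 b3 H0 dH mk (mb k kK) (mxi k kK) ik ibk ixk.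
rewrite -KpE in e.
have E : Sk k.+1 = fun w => Sk k w + ((tau k.+1 - tau k) * b k w + xi k w * (W (tau k.+1) w - W (tau k) w)).
  by apply/funext => w; rewrite /Sk big_ord_recr.
have sgT := filt_sigma F_usual (gmem _ kK).
have up (Y : Omega -> R) : measurable_wrt (F (tau k)) Y -> measurable_wrt (F (tau k.+1)) Y.
  exact: (filt_le F_usual b1 b2 b3).
rewrite E; split => //.
  apply: measurable_wrtD => //; first exact: up.
  apply: measurable_wrtD => //; apply: measurable_wrtM => //.
  - exact: measurable_wrt_cst.
  - exact: up (mb k kK).
  - exact: up (mxi k kK).
  - exact: (incr_adapted F_usual BW).
apply: le_trans e _.
set r := (tau k.+1 - tau k) / H.
have r0 : 0 <= r by rewrite divr_ge0 ?subr_ge0// ltW.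
have sgE : sg k.+1 = sg k + r by rewrite /sg /r -mulrDl; congr (_ / _); ring.
have sg0 : 0 <= sg k by rewrite divr_ge0 ?subr_ge0 ?(ltW H0)// gle// ltnW.
set u := Ex P (fun w => normp (Sk k w)) in ek *.
have Q0 : 0 <= Q.
  by apply: mulr_ge0; [exact: addr_ge0|apply: le_trans exk; exact: Ex_ge0].
have hQ : H `^ p * Ex P (fun w => normp (b k w)) + H `^ (p / 2) * Ex P (fun w => normp (xi k w)) <= Q.
  by rewrite /Q mulrDl; apply: lerD; [exact: (ler_wpM2l HpE ebk)|exact: (ler_wpM2l Hp2 exk)].
rewrite sgE (_ : Kp * (sg k + r) = Kp * sg k + Kp * r) ?expRD; last by ring.
apply: (@le_trans _ _ (u * (1 + Kp * r) + Kp * Q * r)).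
  exact: (grid_arith1 _ (ler_wpM2l (mulr_ge0 r0 Kp0) hQ)).
have er : 1 + Kp * r <= expR (Kp * r) by exact: expR_ge1Dx.
have e1 : 1 <= expR (Kp * sg k) * expR (Kp * r).
  by rewrite -expRD -[leLHS]expR0 ler_expR addr_ge0// mulr_ge0.
have u1 : u * (1 + Kp * r) <= expR (Kp * sg k) * expR (Kp * r) * (Kp * Q * sg k).
  rewrite [leRHS](_ : _ = (expR (Kp * sg k) * (Kp * Q * sg k)) * expR (Kp * r)); last by ring.
  apply: ler_pM => //; first exact: Ex_ge0.
  by rewrite addr_ge0// mulr_ge0.
have KQr : 0 <= Kp * Q * r by apply: (mulr_ge0 _ r0); exact: (mulr_ge0 Kp0 Q0).
by have := ler_wpM2r KQr e1; rewrite mul1r; exact: grid_arith2 u1.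
Qed.

End grid.
End StepPowR.

(** * Convergence in probability *)

Section ConvergenceInProbability.
Context {disp : measure_display} {Omega : measurableType disp} {R : realType}.
Variable P : probability Omega R.
Implicit Types (Y : nat -> Omega -> R) (Z : Omega -> R).

(* Convergence in probability, phrased so that it makes sense without measurability. *)
Definition cvg_prob Y Z : Prop := forall e dl : R, 0 < e -> 0 < dl ->
  exists N, forall n, (N <= n)%N ->
  exists B, [/\ measurable B, (P B <= dl%:E)%E & forall w, ~ B w -> `|Y n w - Z w| < e].

Lemma cvg_probD Y Y' Z Z' : cvg_prob Y Z -> cvg_prob Y' Z' ->
  cvg_prob (fun n w => Y n w + Y' n w) (fun w => Z w + Z' w).
Proof.
move=> c1 c2 e dl e0 d0.
have e2 : 0 < e / 2 by rewrite divr_gt0.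
have d2 : 0 < dl / 2 by rewrite divr_gt0.
have [N1 h1] := c1 _ _ e2 d2; have [N2 h2] := c2 _ _ e2 d2.
exists (maxn N1 N2) => n; rewrite geq_max => /andP[n1 n2].
have [B1 [mB1 P1 b1]] := h1 n n1; have [B2 [mB2 P2 b2]] := h2 n n2.
exists (B1 `|` B2); split; first exact: measurableU.
  apply: le_trans (measureU2 _ _ _) _ => //.
  by rewrite [dl]splitr EFinD; apply: leeD.
move=> w /not_orP[w1 w2]; rewrite [e]splitr.
have -> : Y n w + Y' n w - (Z w + Z' w) = (Y n w - Z w) + (Y' n w - Z' w) by ring.
by apply: le_lt_trans (ler_normD _ _) _; apply: ltrD; [exact: b1|exact: b2].
Qed.

Lemma cvg_prob_sum m (Y : 'I_m -> nat -> Omega -> R) (Z : 'I_m -> Omega -> R) :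
  (forall r, cvg_prob (Y r) (Z r)) ->
  cvg_prob (fun n w => \sum_r Y r n w) (fun w => \sum_r Z r w).
Proof.
elim: m Y Z => [|m ih] Y Z c.
  move=> e dl e0 d0; exists 0%N => n _; exists set0; split => //; first by rewrite measure0 lee_fin ltW.
  by move=> w _; rewrite !big_ord0 subrr normr0.
have c1 := cvg_probD (ih _ _ (fun r => c (widen_ord (leqnSn m) r))) (c ord_max).
move=> e dl e0 d0; have [N h] := c1 e dl e0 d0; exists N => n nN.
have [B [mB PB b]] := h n nN; exists B; split => // w Bw.
by rewrite !big_ord_recr /=; exact: b.
Qed.

(** The tail unions of the E n decrease to their upper limit, which is negligible; by continuity
    from above their probabilities tend to 0, and they dominate P (E n). *)
Lemma ae_eventually_measure (E : nat -> set Omega) : (forall n, measurable (E n)) ->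
  {ae P, forall w, exists N, forall n, (N <= n)%N -> ~ E n w} ->
  forall dl : R, 0 < dl -> exists N, forall n, (N <= n)%N -> (P (E n) <= dl%:E)%E.
Proof.
move=> mE aeE dl d0.
have c := lim_sup_set_cvg P E mE.
have fin : (P (\bigcup_(k >= 0) E k) < +oo)%E.
  apply: le_lt_trans (probability_le1 _ _) (ltry _).
  by apply: bigcup_measurable => k _; exact: mE.
have mL : measurable (lim_sup_set E).
  by apply: bigcapT_measurable => k; apply: bigcup_measurable => j _; exact: mE.
have L0 : P (lim_sup_set E) = 0%E.
  apply: measure_negligible => //; apply: negligibleS aeE => w Lw [N h].
  by have [j /= Nj Ej] := Lw N I; exact: h Ej.
have c0 : P (\bigcup_(k in [set k | (n <= k)%N]) E k) @[n --> \oo] --> 0%E.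
  by rewrite -L0; exact: c fin.
have /fine_cvgP[_ f0] := c0.
have [N _ hN] := cvgr_lt _ f0 _ d0.
exists N => n Nn; have mU : measurable (\bigcup_(k in [set k | (n <= k)%N]) E k).
  by apply: bigcup_measurable => k _; exact: mE.
apply: (@le_trans _ _ (P (\bigcup_(k in [set k | (n <= k)%N]) E k))).
  by apply: le_measure; rewrite ?inE// => w Ew; exists n => /=.
by rewrite -[leLHS]fineK ?fin_num_measure// lee_fin ltW//; exact: hN.
Qed.

(** For a positive limit this is the continuity of exp and ln; a zero limit is separate, and is
    trivial because the sequence stays below its limit. *)
Let continuous_powR (p a : R) : 0 < p -> 0 <= a -> forall x_ : nat -> R,
  (forall n, 0 <= x_ n <= a) -> x_ n @[n --> \oo] --> a -> x_ n `^ p @[n --> \oo] --> a `^ p.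
Proof.
move=> p0; rewrite le_eqVlt => /predU1P[<-|a0] x_ x01 xa.
  apply: cvg_near_cst; apply: nearW => n.
  by congr (_ `^ p); apply/eqP; rewrite eq_le andbC.
have pE x : 0 < x -> x `^ p = expR (p * ln x) by move=> x0; rewrite /powR gt_eqF.
rewrite (pE a a0); apply: (cvg_trans (G := (expR (p * ln (x_ n))) @[n --> \oo])).
  apply: near_eq_cvg; have [N _ hN] := cvgr_gt _ xa _ a0.
  by exists N => // n Nn; rewrite -pE//; exact: hN.
apply: (cvg_comp (fun n => p * ln (x_ n)) expR); last exact: continuous_expR.
apply: cvgMr; apply: (cvg_comp x_ (@ln R) xa); exact: continuous_ln.
Qed.

(** No almost sure subsequence is extracted. [V k] lowers |Z| by 1/(k + 1) and caps the power at k: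
    where Y n is within 1/(k + 1) of Z it is below |Y n|^p, and elsewhere it is at most k. Fatou's
    lemma is then applied in k. *)
Lemma fatou_prob (p c : R) Y Z : 0 < p ->
  (forall n, measurable_fun setT (Y n)) -> measurable_fun setT Z -> cvg_prob Y Z ->
  (forall n, intg P (fun w => `|Y n w| `^ p) /\ Ex P (fun w => `|Y n w| `^ p) <= c) ->
  intg P (fun w => `|Z w| `^ p) /\ Ex P (fun w => `|Z w| `^ p) <= c.
Proof.
move=> p0 mY mZ cYZ hY.
have mnorm r : measurable_fun setT (fun x : R => `|x| `^ r).
  exact: (measurableT_comp (measurable_powR r)).
pose tr (k : nat) (x : R) := Num.max (`|x| - k.+1%:R^-1) 0.
pose V k w := Num.min (tr k (Z w) `^ p) k%:R.
have tr0 k x : 0 <= tr k x by rewrite le_max lexx orbT.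
have trle k x : tr k x <= `|x|.
  by rewrite ge_max normr_ge0 andbT lerBlDr lerDl.
have V0 k w : 0 <= V k w by rewrite le_min powR_ge0 ler0n.
have mV k : measurable_fun setT (V k).
  apply: measurable_minr => //; apply: (measurableT_comp (measurable_powR p)).
  by apply: measurable_maxr => //; apply: measurable_funB => //; exact: measurableT_comp.
have EV k : (\int[P]_w (V k w)%:E <= c%:E)%E.
  have iV : intg P (V k).
    apply: (intg_le (mV k) _ (intg_cst P k%:R)) => w.
    by rewrite ger0_norm// ge_min lexx orbT.
  rewrite -Ex_EFin// lee_fin; apply/ler_addgt0Pr => e e0.
  have k0 : 0 < k.+1%:R^-1 :> R by rewrite invr_gt0.
  (* The exceptional set contributes at most k e/(k + 1) <= e. *)
  have d0 : 0 < e / k.+1%:R by rewrite divr_gt0.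
  have [N h] := cYZ _ _ k0 d0; have [B [mB PB b]] := h N (leqnn N).
  have [iY eY] := hY N.
  have i2 : intg P (fun w => `|Y N w| `^ p + k%:R * \1_B w).
    by apply: intgD => //; apply: intgZ; exact: intg_indic.
  apply: le_trans (Ex_le iV i2 _) _ => [w|]; last first.
    rewrite ExD//; last by apply: intgZ; exact: intg_indic.
    rewrite ExZ; last exact: intg_indic.
    apply: lerD => //; apply: (@le_trans _ _ (k%:R * (e / k.+1%:R))).
      by rewrite ler_wpM2l// -lee_fin Ex_indic.
    by rewrite mulrCA ler_piMr ?(ltW e0)// ler_pdivrMr// mul1r ler_nat.
  rewrite indicE; have [wB|wB] := boolP (w \in B).
    by rewrite mulr1 (le_trans (_ : _ <= k%:R))// ?ge_min ?lexx ?orbT// lerDr powR_ge0.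
  rewrite mulr0 addr0 (le_trans (_ : _ <= tr k (Z w) `^ p))// ?ge_min ?lexx//.
  apply: powR_le => //; first exact: ltW.
  rewrite ge_max normr_ge0 andbT.
  have := b w; rewrite -notin_setE => /(_ wB) bw.
  have dZ := ler_normD (Y N w) (Z w - Y N w); rewrite subrKC distrC in dZ.
  by rewrite lerBlDr; apply: le_trans dZ _; rewrite lerD2l ltW.
have lim w : (V k w)%:E @[k --> \oo] --> (`|Z w| `^ p)%:E.
  apply: cvg_EFin; first exact: nearW.
  apply: (cvg_trans (G := tr k (Z w) `^ p @[k --> \oo])).
    apply: near_eq_cvg; exists (Num.bound (`|Z w| `^ p)) => // k /= hk.
    rewrite /V min_l//; apply: (@le_trans _ _ (`|Z w| `^ p)).
      by apply: powR_le => //; exact: ltW.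
    apply: le_trans (ltW (archi_boundP _)) _; first exact: powR_ge0.
    by rewrite ler_nat.
  apply: continuous_powR => //; first by move=> n; rewrite tr0 trle.
  apply/cvgrPdist_lt => e e0; have [N _ hN] := near_infty_natSinv_lt (PosNum e0).
  exists N => // k Nk; apply: le_lt_trans (hN k Nk).
  rewrite ger0_norm ?subr_ge0// lerBlDr addrC -lerBlDr.
  by rewrite /tr le_max lexx.
have mlim : measurable_fun setT (fun w => `|Z w| `^ p) by exact: (measurableT_comp (mnorm p)).
apply: intg_ge0_le => //.
apply: le_trans (_ : _ <= limn_einf (fun k => \int[P]_w (V k w)%:E))%E _.
  rewrite (_ : (\int[P]_w (`|Z w| `^ p)%:E)%E = (\int[P]_w (limn_einf (fun k => (V k w)%:E)))%E).
    apply: fatou => //; first by move=> n; exact/measurable_EFinP.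
    by move=> n w _; rewrite lee_fin.
  by apply: eq_integral => w _; rewrite (cvg_limn_einf_sup (lim w)).1.
rewrite limn_einf_lim; apply: lime_le; first exact: is_cvg_einfs.
apply: nearW => n; apply: le_trans (EV n); apply: ereal_inf_lbound.
by exists n => /=.
Qed.

End ConvergenceInProbability.

(** * Time grids, simple processes and Riemann sums of the Ito integral *)

Section Grids.
Context {R : realType}.

Definition is_grid (s t : R) (K : nat) (tau : nat -> R) : Prop :=
  [/\ tau 0%N = s, tau K = t & forall j, (j < K)%N -> tau j <= tau j.+1].

Lemma is_grid_le s t K tau i j : is_grid s t K tau -> (i <= j)%N -> (j <= K)%N -> tau i <= tau j.
Proof. by case=> _ _ mono; exact: grid_le mono _ _. Qed.

(** Sort the prescribed points together with equidistant ones of spacing at most h. Repetitions are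
    kept, so cells may have length zero. *)
Lemma grid_exists (s t h : R) (pts : seq R) : s <= t -> 0 < h ->
  (forall x, x \in pts -> s <= x <= t) ->
  exists K tau, [/\ is_grid s t K tau,
    (forall x, x \in pts -> exists2 k, (k <= K)%N & tau k = x)
    & forall j, (j < K)%N -> tau j.+1 - tau j <= h].
Proof.
move=> st h0 ptsT.
pose N := Num.bound ((t - s) / h).
have N0 : 0 < N.+1%:R :> R by rewrite ltr0n.
have hN : (t - s) / N.+1%:R <= h.
  rewrite ler_pdivrMr// mulrC -ler_pdivrMr//; apply: ltW.
  apply: lt_le_trans (archi_boundP _) _; first by rewrite divr_ge0 ?subr_ge0// ltW.
  by rewrite ler_nat.
pose u (k : nat) := s + k%:R * ((t - s) / N.+1%:R).
have u0 : u 0%N = s by rewrite /u mul0r addr0.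
have uN : u N.+1 = t by rewrite /u mulrCA divff ?gt_eqF// mulr1 subrKC.
have uS k : u k.+1 <= u k + h by rewrite /u mulrSr mulrDl mul1r addrA lerD2l.
have uT k : (k <= N.+1)%N -> s <= u k <= t.
  have q0 : 0 <= (t - s) / N.+1%:R by rewrite divr_ge0 ?subr_ge0// ltW.
  move=> kN; rewrite lerDl mulr_ge0//= -[leRHS]uN lerD2l ler_wpM2r// ler_nat//.
pose S := sort <=%R ([seq u k | k <- iota 0 N.+2] ++ pts).
have memS x : (x \in S) = (x \in [seq u k | k <- iota 0 N.+2] ++ pts) by rewrite mem_sort.
have uS' k : (k <= N.+1)%N -> u k \in S.
  by move=> kN; rewrite memS mem_cat; apply/orP; left; apply: map_f; rewrite mem_iota.
have sizeS : (0 < size S)%N by case: (S) (uS' 0%N isT).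
have sortS : sorted <=%R S by exact: sort_le_sorted.
have ST x : x \in S -> s <= x <= t.
  rewrite memS mem_cat => /orP[/mapP[k]|/ptsT//].
  by rewrite mem_iota => kN ->; exact: uT.
pose tau k := nth t S k.
have mono i j : (i <= j)%N -> (j < size S)%N -> tau i <= tau j.
  move=> ij js; have := @sorted_leq_nth _ _ le_trans lexx t S sortS i j.
  by rewrite !inE; apply => //; exact: leq_ltn_trans js.
have idx x : x \in S -> exists2 k, (k < size S)%N & tau k = x.
  by move=> xS; exists (index x S); rewrite ?index_mem// /tau nth_index.
have tauT k : (k < size S)%N -> s <= tau k <= t by move=> ks; apply: ST; exact: mem_nth.
have SE : size S = (size S).-1.+1 by rewrite prednK.
have sK k : (k < size S)%N -> (k <= (size S).-1)%N by move=> ks; rewrite -ltnS -SE.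
have Ks k : (k <= (size S).-1)%N -> (k < size S)%N by move=> ks; rewrite SE ltnS.
exists (size S).-1, tau; split; first split.
- have [k ks ks'] : exists2 k, (k < size S)%N & tau k = s by apply: idx; rewrite -u0; exact: uS'.
  by apply/eqP; rewrite eq_le; case/andP: (tauT 0%N sizeS) => -> _; rewrite andbT -ks' mono.
- have [k ks ks'] : exists2 k, (k < size S)%N & tau k = t by apply: idx; rewrite -uN; exact: uS'.
  by apply/eqP; rewrite eq_le; case/andP: (tauT _ (Ks _ (leqnn _))) => _ -> /=; rewrite -{1}ks' mono ?sK// Ks.
- by move=> j jK; apply: mono => //; exact: Ks.
- move=> x xp; have [k ks <-] : exists2 k, (k < size S)%N & tau k = x.
    by apply: idx; rewrite memS mem_cat xp orbT.
  by exists k => //; exact: sK.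
move=> j jK; have /andP[js jt] := tauT j (Ks _ (ltnW jK)).
have /andP[_ jt1] := tauT j.+1 (Ks _ jK).
have [tj|jt'] := leP t (tau j); first lra.
(* The first equidistant point beyond tau j is itself a grid point, hence at least tau j.+1, while
   its predecessor is at most tau j. *)
have ex : exists k, tau j < u k by exists N.+1; rewrite uN.
have := ex_minnP ex; case: ex_minnP => k ku kmin _.
case: k ku kmin => [|k] ku kmin; first by move: ku; rewrite u0; lra.
have kN : (k.+1 <= N.+1)%N by apply: kmin; rewrite uN.
have uk : u k <= tau j by rewrite leNgt; apply/negP => /kmin; rewrite ltnn.
have [i iS iE] := idx _ (uS' _ kN).
have ij : (j < i)%N.
  by rewrite ltnNge; apply/negP => ij; move: ku; rewrite -iE ltNge mono// Ks// ltnW.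
have := mono _ _ ij iS; rewrite iE; have := uS k; lra.
Qed.

(** Telescoping after clamping the grid to [a, b]: as a and b are grid points, no cell straddles
    them, and cells outside [a, b] collapse. *)
Lemma grid_telescope (G : R -> R) s t K tau a b : is_grid s t K tau -> a <= b ->
  (exists2 k, (k <= K)%N & tau k = a) -> (exists2 k, (k <= K)%N & tau k = b) ->
  G b - G a = \sum_(j < K) ([&& tau j < tau j.+1, a <= tau j & tau j.+1 <= b])%:R
                * (G (tau j.+1) - G (tau j)).
Proof.
move=> gr ab [ka kaK ea] [kb kbK eb].
have le := is_grid_le gr.
pose c x := Num.max a (Num.min x b).
have c0 : c (tau 0%N) = a.
  by rewrite /c max_l// ge_min -ea le.
have cK : c (tau K) = b.
  by rewrite /c min_r ?max_r// -eb le.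
rewrite -{1}cK -{1}c0.
have -> : G (c (tau K)) - G (c (tau 0%N)) = \sum_(j < K) (G (c (tau j.+1)) - G (c (tau j))).
  by elim: (K) => [|k ih]; rewrite ?big_ord0 ?subrr// big_ord_recr /= -ih addrC subrKA.
apply: eq_bigr => j _; have jK := ltn_ord j.
have l1 : tau j <= tau j.+1 by exact: le.
have [e|lt1] : tau j = tau j.+1 \/ tau j < tau j.+1 by move: l1; rewrite le_eqVlt => /predU1P[]; [left|right].
  by rewrite -e !subrr mulr0.
rewrite lt1 /=.
have ha : a <= tau j \/ tau j.+1 <= a.
  by rewrite -ea; case: (leqP ka j) => h; [left; exact: le (ltnW jK)|right; exact: le].
have hb : b <= tau j \/ tau j.+1 <= b.
  by rewrite -eb; case: (leqP kb j) => h; [left; exact: le (ltnW jK)|right; exact: le].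
case: ha => ha; last first.
  rewrite (_ : (a <= tau j) = false) ?mul0r; last by apply/negbTE; rewrite -ltNge; lra.
  by rewrite /c !max_l ?subrr// ge_min; apply/orP; left; lra.
rewrite ha /=; case: hb => hb.
  rewrite (_ : (tau j.+1 <= b) = false) ?mul0r; last by apply/negbTE; rewrite -ltNge; lra.
  by rewrite /c !min_r ?subrr//; lra.
by rewrite hb mul1r /c !min_l ?max_r//; lra.
Qed.

(** Heine-Cantor: the local moduli 1/(n + 1) become uniform by compactness, in the form of a
    property that holds near every point and for all large n. *)
Lemma uniform_continuity_segment (T : R) (c : R -> R) : {within `[0, T], continuous c} ->
  forall e, 0 < e -> exists2 h, 0 < h & forall x y, 0 <= x <= T -> 0 <= y <= T ->
    `|x - y| <= h -> `|c x - c y| < e.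
Proof.
move=> /subspace_continuousP cc e e0.
have e2 : 0 < e / 2 by rewrite divr_gt0.
have cov := (compact_near_coveringP _).1 (@segment_compact R 0 T).
have [|N _ hN] := cov nat \oo (fun n x => 0 <= x <= T -> forall y, 0 <= y <= T ->
    `|x - y| <= n.+1%:R^-1 -> `|c x - c y| < e) _.
  move=> x; rewrite /= in_itv /= => xT.
  have [r /= r0 rU] : exists2 r : R, 0 < r & forall y, 0 <= y <= T -> `|x - y| < r -> `|c x - c y| < e / 2.
    have xS : [set` `[0, T]] x by rewrite /= in_itv.
    have /cvgrPdist_lt cx := cc x xS; have := cx _ e2.
    rewrite /prop_near1 /= withinE => -[U nU UE].
    move: nU => /nbhs_ballP[r /= r0 rU].
    exists r => // y yT xyr; have : (U `&` [set` `[0, T]]) y by split; [exact: rU|rewrite /= in_itv].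
    by rewrite -UE => -[].
  have r2 : 0 < r / 2 by rewrite divr_gt0.
  have [N _ hN] := near_infty_natSinv_lt (PosNum r2).
  exists (ball x (r / 2), [set n | (N <= n)%N]); first split.
  - exact: nbhsx_ballx.
  - by exists N.
  move=> [x' n] [/= xx' Nn] x'T y yT x'y.
  have x'y' := le_lt_trans x'y (hN n Nn).
  have a1 : `|c x - c x'| < e / 2.
    by apply: rU => //; apply: lt_trans xx' _; rewrite ltr_pdivrMr// ltr_pMr// ltr1n.
  have a2 : `|c x - c y| < e / 2.
    apply: rU => //; rewrite [r]splitr; have -> : x - y = (x - x') + (x' - y) by ring.
    by apply: le_lt_trans (ler_normD _ _) _; exact: ltrD.
  rewrite [e]splitr; have -> : c x' - c y = (c x - c y) - (c x - c x') by ring.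
  by apply: le_lt_trans (ler_normB _ _) _; exact: ltrD.
exists N.+1%:R^-1 => // x y xT yT xy.
by apply: (hN N (leqnn N) x) => //; rewrite /= in_itv.
Qed.
End Grids.

(** * Lenglart's inequality for sums over a grid *)

Section Lenglart.
Context {disp : measure_display} {Omega : measurableType disp} {R : realType}.
Variables (P : probability Omega R) (T : R) (F : R -> set (set Omega)).
Hypothesis F_usual : usual_filtration P T F.
Variable W : R -> Omega -> R.
Hypothesis BW : brownian P T F W.

Lemma independent_processes_singleton : independent_processes P T (fun _ : 'I_1 => W).
Proof.
move=> A _; rewrite big_ord1; congr (P _); apply/seteqP; split=> w /=; first exact.
by move=> Aw r _; rewrite (ord1 r).
Qed.

Section grid.
Variables (K : nat) (tau : nat -> R).
Hypothesis tau0 : 0 <= tau 0%N.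
Hypothesis tauT : tau K <= T.
Hypothesis tau_mono : forall j, (j < K)%N -> tau j <= tau j.+1.
Variable psi : nat -> Omega -> R.
Hypothesis psi_adapted : forall j, (j < K)%N -> measurable_wrt (F (tau j)) (psi j).

Let Q k w := \sum_(i < k) psi i w ^+ 2 * (tau i.+1 - tau i).

(* Lenglart's inequality: truncating the integrand at the last time its bracket is at most dl
   makes the bracket bounded by dl. *)
Lemma lenglart (dl e : R) : 0 < dl -> 0 < e -> exists B, [/\ measurable B,
  (P B <= P [set w | (dl < Q K w)%R] + (dl / e ^+ 2)%:E)%E &
  forall w, ~ B w -> `|\sum_(j < K) psi j w * (W (tau j.+1) w - W (tau j) w)| < e].
Proof.
move=> dl0 e0.
have dtau j : (j < K)%N -> 0 <= tau j.+1 - tau j by move=> /tau_mono ?; lra.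
(* Cells of length zero are discarded as well: only on the others does a bracket below [dl] bound
   [psi j], which makes the truncated integrand square integrable. The bracket up to j.+1 is already
   known at time tau j. *)
pose ind j w : R := (if (tau j < tau j.+1) && (Q j.+1 w <= dl) then 1 else 0).
pose psi' j w := psi j w * ind j w.
have step := grid_step tau0 tauT tau_mono.
have mem j (jK : (j < K)%N) : 0 <= tau j <= T by exact: (grid_mem tau0 tauT tau_mono (ltnW jK)).
have mQ j : (j < K)%N -> measurable_wrt (F (tau j)) (Q j.+1).
  move=> jK; have sF := filt_sigma F_usual (mem _ jK).
  apply: measurable_wrt_sum => // i _.
  apply: measurable_wrtM => //; last exact: measurable_wrt_cst.
  have iK : (i < K)%N by apply: leq_trans (ltn_ord i) jK.
  have [t0 _ _] := step _ iK.
  apply: (measurable_wrt_comp (@exprn_measurable _ _ 2)).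
  apply: (filt_le F_usual t0 _ _ (psi_adapted iK)); last by case/andP: (mem _ jK).
  by apply: (grid_le tau_mono); [rewrite -ltnS|exact: ltnW].
have mind j : (j < K)%N -> measurable_wrt (F (tau j)) (ind j).
  move=> jK; have sF := filt_sigma F_usual (mem _ jK).
  rewrite /ind; case: (tau j < tau j.+1) => /=; last exact: measurable_wrt_cst.
  apply: (@measurable_wrt_comp _ _ _ _ (fun x : R => if x <= dl then 1 else 0)) (mQ _ jK).
  apply: measurable_fun_ifT => //; exact: measurable_fun_ler.
have mpsi' j : (j < K)%N -> measurable_wrt (F (tau j)) (psi' j).
  move=> jK; apply: measurable_wrtM; [exact: (filt_sigma F_usual (mem _ jK))|exact: psi_adapted|exact: mind].
have Qmono w i j : (i <= j)%N -> (j <= K)%N -> Q i w <= Q j w.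
  move=> ij; elim: j ij => [|j ih]; first by rewrite leqn0 => /eqP ->.
  rewrite leq_eqVlt => /predU1P[-> //|ij] jK; apply: le_trans (ih ij (ltnW jK)) _.
  by rewrite /Q [leRHS]big_ord_recr/= lerDl mulr_ge0 ?sqr_ge0 ?dtau.
have psi'Q j w : (j < K)%N -> psi' j w ^+ 2 * (tau j.+1 - tau j) <= dl.
  move=> jK; rewrite /psi' /ind; case: ifP => [/andP[_ h]|_]; last by rewrite mulr0 expr0n mul0r ltW.
  rewrite mulr1; apply: le_trans h; rewrite /Q big_ord_recr/= lerDr.
  by apply: sumr_ge0 => i _; rewrite mulr_ge0 ?sqr_ge0 ?dtau// (ltn_trans (ltn_ord i)).
have ipsi' j : (j < K)%N -> intg P (fun w => psi' j w ^+ 2).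
  move=> jK; have [tj|tj] := ltP (tau j) (tau j.+1).
    have tj' : 0 < tau j.+1 - tau j by rewrite subr_gt0.
    apply: (intg_le _ _ (intg_cst P (dl / (tau j.+1 - tau j)))) => [|w].
      exact: (measurableT_comp (@exprn_measurable _ _ 2) (filt_measurable F_usual (mem _ jK) (mpsi' _ jK))).
    by rewrite ger0_norm ?sqr_ge0// ler_pdivlMr// psi'Q.
  have -> : (fun w => psi' j w ^+ 2) = fun=> 0; last exact: intg_cst.
  by apply/funext => w; rewrite /psi' /ind ltNge tj /= mulr0 expr0n.
pose S w := \sum_(j < K) psi' j w * (W (tau j.+1) w - W (tau j) w).
have [iS eS] : intg P (fun w => S w ^+ 2) /\ Ex P (fun w => S w ^+ 2) <= dl.
  have mem0 : 0 <= tau 0%N <= T by exact: (grid_mem tau0 tauT tau_mono (leq0n K)).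
  have mz : measurable_wrt (F (tau 0%N)) (fun=> 0 : R).
    by have sF := filt_sigma F_usual mem0; exact: measurable_wrt_cst.
  have iz : intg P (fun=> (0 : R) ^+ 2) by exact: intg_cst.
  have [i e'] := grid_sqr F_usual (fun _ : 'I_1 => BW) tau0 tauT tau_mono
    independent_processes_singleton mz iz
    (fun j (_ : 'I_1) jK => mpsi' j jK) (fun j (_ : 'I_1) jK => ipsi' j jK).
  have SE : (fun w => S w ^+ 2) = fun w => (0 + \sum_(j < K) \sum_(r < 1) psi' j w *
      (W (tau j.+1) w - W (tau j) w)) ^+ 2.
    by apply/funext => w; rewrite add0r; congr (_ ^+ 2); apply: eq_bigr => j _; rewrite big_ord1.
  rewrite SE; split => //; apply: le_trans e' _.
  rewrite Ex_cst expr0n add0r.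
  rewrite (eq_bigr (fun j : 'I_K => Ex P (fun w => (tau j.+1 - tau j) * psi' j w ^+ 2))); last first.
    by move=> j _; rewrite big_ord1 ExZ//; exact: ipsi'.
  have ij (j : 'I_K) : intg P (fun w => (tau j.+1 - tau j) * psi' j w ^+ 2).
    by apply: intgZ; exact: ipsi'.
  rewrite -Ex_sum// -[leRHS](Ex_cst P); apply: Ex_le; [exact: intg_sum|exact: intg_cst|] => w.
  (* The truncated bracket stops growing once the true bracket exceeds [dl], so it stays below
     both. *)
  have : forall k, (k <= K)%N -> \sum_(i < k) (tau i.+1 - tau i) * psi' i w ^+ 2 <= Num.min dl (Q k w).
    elim=> [_|k ih kK]; first by rewrite /Q !big_ord0 le_min lexx ltW.
    rewrite big_ord_recr /=; have := ih (ltnW kK); rewrite !le_min => /andP[i1 i2].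
    have QS : Q k.+1 w = Q k w + psi k w ^+ 2 * (tau k.+1 - tau k) by rewrite /Q big_ord_recr.
    have := mulr_ge0 (sqr_ge0 (psi k w)) (dtau _ kK).
    rewrite {2 4}/psi' /ind; case: ifP => [/andP[_ h]|_]; last first.
      by rewrite mulr0 expr0n mulr0 addr0 i1 QS /= => ?; lra.
    by rewrite mulr1 [(tau k.+1 - tau k) * _]mulrC; move: h; rewrite QS => ? ?; apply/andP; split; lra.
  by move=> /(_ K (leqnn K)); rewrite le_min => /andP[].
have mS : measurable_fun setT S.
  apply: measurable_sum => j; apply: measurable_funM.
    exact: (filt_measurable F_usual (mem _ (ltn_ord j)) (mpsi' _ (ltn_ord j))).
  have [t0 tt tT'] := step _ (ltn_ord j); exact: (incr_measurable F_usual BW t0 tt tT').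
have mQK : measurable_fun setT (Q K).
  apply: measurable_sum => j; apply: measurable_funM; last exact: measurable_cst.
  apply: (measurableT_comp (@exprn_measurable _ _ 2)).
  exact: (filt_measurable F_usual (mem _ (ltn_ord j)) (psi_adapted (ltn_ord j))).
pose B1 := [set w | dl < Q K w]; pose B2 := [set w | e ^+ 2 <= S w ^+ 2].
have mB1 : measurable B1.
  by rewrite -[B1]setTI; exact: (measurable_fun_ltr (measurable_cst dl) mQK).
have mB2 : measurable B2.
  have mS2 : measurable_fun setT (fun w => S w ^+ 2) by exact: (measurableT_comp (@exprn_measurable _ _ 2)).
  by rewrite -[B2]setTI; exact: (measurable_fun_ler (measurable_cst _) mS2).
exists (B1 `|` B2); split; first exact: measurableU.
  apply: le_trans (measureU2 _ mB1 mB2) _; apply: leeD2l.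
  apply: (@le_trans _ _ (Ex P \1_B2)%:E); first by rewrite Ex_indic.
  rewrite lee_fin ler_pdivlMr ?exprn_gt0// mulrC.
  apply: le_trans eS; rewrite -ExZ; last exact: intg_indic.
  apply: Ex_le => //; first by apply: intgZ; exact: intg_indic.
  move=> w; rewrite indicE; case: (boolP (w \in B2)) => h; rewrite ?mulr1 ?mulr0 ?sqr_ge0//.
  by move: h; rewrite inE.
move=> w /not_orP[w1 w2].
have Qd : Q K w <= dl by rewrite leNgt; apply/negP.
(* Since the bracket is nondecreasing and ends below [dl], nothing is cut except cells of length
   zero, whose increments vanish. *)
have -> : \sum_(j < K) psi j w * (W (tau j.+1) w - W (tau j) w) = S w.
  apply: eq_bigr => j _; rewrite /psi' /ind.
  rewrite (le_trans (Qmono w j.+1 K _ _) Qd)// andbT.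
  case: ltP => h; rewrite ?mulr1//.
  have -> : tau j.+1 = tau j by apply/eqP; rewrite eq_le h tau_mono.
  by rewrite subrr !mulr0.
rewrite ltNge; apply/negP => h; apply: w2; rewrite /B2 /=.
by rewrite -[S w ^+ 2]real_normK ?num_real// lerXn2r ?nnegrE ?normr_ge0// ltW.
Qed.

End grid.
End Lenglart.

(** * Simple processes on a grid that contains their jump times *)

Section SimpleOnGrid.
Context {disp : measure_display} {Omega : measurableType disp} {R : realType}.
Variables (T : R) (F : R -> set (set Omega)) (W : R -> Omega -> R).
Variable phi : simple_process T F.
Variables (s t : R) (K : nat) (tau : nat -> R).
Hypotheses (st : s <= t) (tau_grid : is_grid s t K tau).

Definition clamp (x : R) := Num.max s (Num.min x t).

Lemma clamp_mem x : s <= clamp x <= t.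
Proof. by rewrite /clamp le_max lexx /= ge_max st ge_min lexx orbT. Qed.

Lemma clamp_le x y : x <= y -> clamp x <= clamp y.
Proof.
move=> xy; rewrite /clamp ge_max le_max lexx /= le_max; apply/orP; right.
by rewrite le_min !ge_min xy lexx orbT.
Qed.

Hypothesis times_in_grid : forall l, (l <= sp_size phi)%N ->
  exists2 k, (k <= K)%N & tau k = clamp (sp_time phi l).

(** The strict inequality tau j < tau j.+1 matters for adaptedness: it gives tau j < t, so a clamped
    jump time below tau j can only come from a jump time that is itself at most tau j. *)
Let inc l j := [&& tau j < tau j.+1, clamp (sp_time phi l) <= tau j &
  tau j.+1 <= clamp (sp_time phi l.+1)].

(** The constant value of the process on the cell from tau j to tau j.+1, which meets at most one
    interval of constancy since all clamped jump times are grid points. *)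
Definition sp_grid_val j w : R :=
  \sum_(l < sp_size phi) sp_coef phi l w * (inc l j)%:R.

Lemma sp_integral_grid w : sp_integral W phi t w - sp_integral W phi s w =
  \sum_(j < K) sp_grid_val j w * (W (tau j.+1) w - W (tau j) w).
Proof.
have cl x : W (Num.min x t) w - W (Num.min x s) w = W (clamp x) w - W s w.
  rewrite /clamp; have [h|h] := leP x s.
    by rewrite min_l ?(le_trans h)// max_l// !subrr.
  by rewrite max_r// le_min (ltW h) st.
rewrite /sp_integral -sumrB.
under [RHS]eq_bigr do rewrite /sp_grid_val mulr_suml.
rewrite exchange_big /=; apply: eq_bigr => l _.
under [RHS]eq_bigr do rewrite -mulrA.
rewrite -mulr_sumr -mulrBr; congr (_ * _).
rewrite /inc -(grid_telescope (fun x => W x w) tau_grid).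
- by have := cl (sp_time phi l); have := cl (sp_time phi l.+1); lra.
- by apply: clamp_le; apply: sp_time_mono; exact: ltn_ord.
- exact: times_in_grid (ltnW (ltn_ord l)).
- exact: times_in_grid (ltn_ord l).
Qed.

Lemma sp_val_grid j u w : (j < K)%N -> tau j < u <= tau j.+1 ->
  sp_val phi u w = sp_grid_val j w.
Proof.
move=> jK /andP[ju uj]; apply: eq_bigr => l _; congr (_ * _).
have le := is_grid_le tau_grid; have [ts tt _] := tau_grid.
have su : s < u by apply: le_lt_trans ju; rewrite -ts le// ltnW.
have ut : u <= t by apply: le_trans uj _; rewrite -tt le.
rewrite indicE /inc (lt_le_trans ju uj) /=; congr (_%:R); congr nat_of_bool.
apply/idP/idP; rewrite inE /= in_itv /= => /andP[h1 h2].
- apply/andP; split.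
    have [k kK kE] := times_in_grid (ltnW (ltn_ord l)).
    rewrite -kE; have [h|h] := leqP k j; first by apply: le => //; exact: ltnW.
    have : u <= clamp (sp_time phi l) by rewrite -kE; apply: le_trans uj _; exact: le.
    rewrite /clamp le_max !le_min => /orP[h3|/andP[h3 _]]; lra.
  have [k kK kE] := times_in_grid (ltn_ord l).
  rewrite -kE; have [h|h] := leqP k j; last exact: le.
  have : clamp (sp_time phi l.+1) < u by rewrite -kE; apply: le_lt_trans _ ju; apply: le => //; exact: ltnW.
  by rewrite /clamp gt_max gt_min => /andP[_ /orP[]]; lra.
- apply/andP; split.
    by have := le_lt_trans h1 ju; rewrite /clamp gt_max gt_min => /andP[_ /orP[]]; lra.
  have := le_trans uj h2; rewrite /clamp le_max le_min => /orP[|/andP[]]; lra.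
Qed.

Lemma sp_grid_val_adapted j : (forall u, 0 <= u <= T -> sigma_algebra setT (F u)) ->
  (forall u v, 0 <= u -> u <= v -> v <= T -> F u `<=` F v) ->
  0 <= s -> t <= T -> (j < K)%N -> measurable_wrt (F (tau j)) (sp_grid_val j).
Proof.
move=> sF mF s0 tT jK.
have le := is_grid_le tau_grid; have [ts tt _] := tau_grid.
have sj : s <= tau j by rewrite -ts le// ltnW.
have jt : tau j <= t by rewrite -tt le// ltnW.
have sFj := sF (tau j) _.
have {}sFj : sigma_algebra setT (F (tau j)) by apply: sFj; lra.
rewrite /sp_grid_val; apply: measurable_wrt_sum => // l _.
rewrite /inc; case: and3P => [[h1 h2 h3]|_] /=; last first.
  under eq_fun do rewrite mulr0; exact: measurable_wrt_cst.
under eq_fun do rewrite mulr1.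
have /andP[a0 aT] := @sp_time_range _ _ _ _ phi l (ltnW (ltn_ord l)).
have jt' : tau j < t by apply: lt_le_trans h1 _; rewrite -tt le.
apply: measurable_wrt_sub (sp_coef_adapted (ltn_ord l)).
apply: mF => //; last lra.
by move: h2; rewrite /clamp ge_max ge_min => /andP[_ /orP[]] //; lra.
Qed.

End SimpleOnGrid.

(** * Riemann sums along a single path *)

Section RiemannSums.
Context {R : realType}.
Local Notation mu := (@lebesgue_measure R).

Lemma itv_ccP (a b u : R) : `[a, b]%classic u <-> a <= u <= b.
Proof. by rewrite /= in_itv. Qed.

Lemma itv_ocP (a b u : R) : `]a, b]%classic u <-> a < u <= b.
Proof. by rewrite /= in_itv. Qed.

Lemma lebesgue_measure_oc (a b : R) : a <= b -> mu `]a, b]%classic = (b - a)%:E.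
Proof.
move=> ab; rewrite lebesgue_measure_itv /= lte_fin -EFinB; case: ltP => // ba.
have -> : b = a by lra.
by rewrite subrr.
Qed.

Let sub_ocP (a b c' T' : R) : 0 <= a -> b <= c' -> c' <= T' -> `]a, b]%classic `<=` `[0, T']%classic.
Proof. by move=> ? ? ? u /itv_ocP ?; apply/itv_ccP; lra. Qed.

Let sub_ccP (a b : R) : a <= b -> `[0, a]%classic `<=` `[0, b]%classic.
Proof. by move=> ? u /itv_ccP ?; apply/itv_ccP; lra. Qed.

Variables (T s t : R) (K : nat) (tau : nat -> R).
Hypotheses (s0 : 0 <= s) (tT : t <= T) (tau_grid : is_grid s t K tau).

Let gmem j : (j <= K)%N -> s <= tau j <= t.
Proof.
have le := is_grid_le tau_grid; have [ts tt _] := tau_grid.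
by move=> jK; rewrite -ts -tt !le.
Qed.

Lemma lower_sum_le_integral (G : R -> R) (b : nat -> R) :
  measurable_fun `[0, T] G -> (forall u, 0 <= G u) -> (forall j, 0 <= b j) ->
  (forall j u, (j < K)%N -> tau j < u <= tau j.+1 -> b j <= G u) ->
  ((\sum_(j < K) b j * (tau j.+1 - tau j))%:E <= \int[mu]_(u in `[0%R, T]) (G u)%:E)%E.
Proof.
move=> mG G0 b0 bG.
have [ts tt mono] := tau_grid; have le := is_grid_le tau_grid.
have mGs (A : set R) : measurable A -> A `<=` `[0, T] -> measurable_fun A (fun u => (G u)%:E).
  by move=> mA AT; apply/measurable_EFinP; exact: (measurable_funS _ AT mG).
have sub j : (j <= K)%N -> `]s, tau j]%classic `<=` `[0, T].
  move=> jK; have /andP[_ jt] := gmem jK; exact: (sub_ocP s0 jt tT).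
suff H k : (k <= K)%N ->
    ((\sum_(j < k) b j * (tau j.+1 - tau j))%:E <= \int[mu]_(u in `]s, tau k]) (G u)%:E)%E.
  apply: le_trans (H K (leqnn K)) _; apply: ge0_subset_integral => //; last exact: sub.
  - exact: mGs.
  - by move=> u _; rewrite lee_fin.
elim: k => [_|k ih kK].
  by rewrite big_ord0; apply: integral_ge0 => u _; rewrite lee_fin.
have tk := mono _ kK; have /andP[sk _] := gmem (ltnW kK).
rewrite big_ord_recr /= (@itv_bndbnd_setU _ _ (BRight s) (BRight (tau k)))// ?bnd_simp//.
rewrite ge0_integral_setU//=; first last.
- rewrite disj_set2E; apply/eqP/seteqP; split=> // u [/itv_ocP ? /itv_ocP ?] /=; lra.
- by move=> u _; rewrite lee_fin.
- by rewrite -itv_bndbnd_setU ?bnd_simp//; apply: mGs => //; exact: sub.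
rewrite EFinD; apply: leeD; first exact: ih (ltnW kK).
rewrite EFinM -(lebesgue_measure_oc tk) -integral_cst//.
apply: ge0_le_integral => //.
- by move=> u _; rewrite lee_fin.
- by apply: mGs => //; have /andP[_ kt] := gmem kK; exact: (sub_ocP (le_trans s0 sk) kt tT).
- by move=> u /itv_ocP ?; rewrite lee_fin; exact: bG.
Qed.

Variable c : R -> R.
Hypothesis c_cont : {within `[0, T], continuous c}.
Variable e : R.
Hypothesis c_osc : forall j u, (j < K)%N -> tau j < u <= tau j.+1 -> `|c u - c (tau j)| <= e.

(** By (x - y)^2 >= x^2/2 - y^2, the distance to the path bounds the distance to its values at left
    endpoints, up to the oscillation [e]. This turns mean square approximation in continuous time
    into smallness of a discrete bracket. *)
Lemma riemann_sum_sqr_le (v : R -> R) (a : nat -> R) : measurable_fun setT v ->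
  (forall j u, (j < K)%N -> tau j < u <= tau j.+1 -> v u = a j) ->
  ((\sum_(j < K) (a j - c (tau j)) ^+ 2 * (tau j.+1 - tau j) / 2 - e ^+ 2 * (t - s))%:E
     <= \int[mu]_(u in `[0%R, T]) ((v u - c u) ^+ 2)%:E)%E.
Proof.
move=> mv va; have [ts tt mono] := tau_grid.
have mc : measurable_fun `[0, T] c by exact: subspace_continuous_measurable_fun.
(* The positive part, as a step function below the integrand must be nonnegative for the lower sum
   estimate. *)
pose b j := Num.max 0 ((a j - c (tau j)) ^+ 2 / 2 - e ^+ 2).
apply: (@le_trans _ _ (\sum_(j < K) b j * (tau j.+1 - tau j))%:E); last first.
  apply: lower_sum_le_integral.
  - apply: (@measurableT_comp _ _ _ _ _ _ (fun x : R => x ^+ 2)) => //.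
    by apply: measurable_funB => //; exact: measurable_funTS.
  - by move=> u; exact: sqr_ge0.
  - by move=> j; rewrite le_max lexx.
  move=> j u jK uj; rewrite ge_max sqr_ge0 /= (va j u jK uj).
  have : (c u - c (tau j)) ^+ 2 <= e ^+ 2.
    rewrite -[leLHS]real_normK ?num_real// lerXn2r ?nnegrE//; last exact: c_osc.
    exact: le_trans (normr_ge0 _) (c_osc jK uj).
  have : 0 <= ((a j - c (tau j)) - 2 * (c u - c (tau j))) ^+ 2 by exact: sqr_ge0.
  have alg (x y z : R) : 0 <= (x - 2 * y) ^+ 2 -> y ^+ 2 <= z -> x ^+ 2 / 2 - z <= (x - y) ^+ 2.
    by rewrite !sqrrB; move=> ? ?; nra.
  have -> : a j - c u = (a j - c (tau j)) - (c u - c (tau j)) by ring.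
  exact: alg.
have -> : t - s = \sum_(j < K) (tau j.+1 - tau j).
  rewrite -tt -ts; elim: (K) => [|k ih]; first by rewrite big_ord0 subrr.
  by rewrite big_ord_recr /= -ih; ring.
rewrite lee_fin mulr_sumr -sumrB; apply: ler_sum => j _.
rewrite mulrAC -mulrBl ler_wpM2r ?subr_ge0 ?mono//.
by rewrite le_max lexx orbT.
Qed.

Lemma riemann_sum_integral :
  `|\sum_(j < K) c (tau j) * (tau j.+1 - tau j)
    - ((\int[mu]_(u in `[0, t]) c u) - \int[mu]_(u in `[0, s]) c u)| <= e * (t - s).
Proof.
have [ts tt mono] := tau_grid.
have ic x : 0 <= x <= T -> mu.-integrable `[0, x] (EFin \o c).
  move=> xT; apply: continuous_compact_integrable; first exact: segment_compact.
  by apply: continuous_subspaceW c_cont; apply: sub_ccP; case/andP: xT.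
suff H k : (k <= K)%N -> `|\sum_(j < k) c (tau j) * (tau j.+1 - tau j)
    - ((\int[mu]_(u in `[0, tau k]) c u) - \int[mu]_(u in `[0, s]) c u)| <= e * (tau k - s).
  by have := H K (leqnn K); rewrite tt.
elim: k => [_|k ih kK]; first by rewrite big_ord0 ts !subrr normr0 mulr0.
have tk := mono _ kK; have /andP[sk _] := gmem (ltnW kK); have /andP[_ kt] := gmem kK.
have tT0 : 0 <= tau k.+1 <= T by have := s0; have := tT => ? ?; lra.
have ick : mu.-integrable `]tau k, tau k.+1] (EFin \o c).
  apply: integrableS (ic (tau k.+1) tT0) => //.
  exact: (sub_ocP (le_trans s0 sk) (lexx _) (lexx _)).
have E : \int[mu]_(u in `[0, tau k.+1]) c u - \int[mu]_(u in `[0, tau k]) c u =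
    \int[mu]_(u in `]tau k, tau k.+1]) c u.
  apply: Rintegral_itvB; first exact: ic.
  - by rewrite bnd_simp; move: s0 => ?; lra.
  - by rewrite bnd_simp.
have mk := lebesgue_measure_oc tk.
have icst (x : R) : mu.-integrable `]tau k, tau k.+1] (EFin \o (fun=> x)).
  have i0 : mu.-integrable `[0, tau k.+1] (EFin \o (fun=> x)).
    apply: continuous_compact_integrable; first exact: segment_compact.
    by apply: continuous_subspaceT => z; exact: cst_continuous.
  by apply: integrableS i0 => //; exact: (sub_ocP (le_trans s0 sk) (lexx _) (lexx _)).
have cst x : \int[mu]_(u in `]tau k, tau k.+1]) x = x * (tau k.+1 - tau k).
  by rewrite Rintegral_cst//; congr (_ * _); exact: (congr1 fine mk).
have iB : mu.-integrable `]tau k, tau k.+1] (EFin \o (fun u => c u - c (tau k))).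
  by have := integrableB _ ick (icst (c (tau k))); apply => //.
have D : `|\int[mu]_(u in `]tau k, tau k.+1]) c u - c (tau k) * (tau k.+1 - tau k)| <= e * (tau k.+1 - tau k).
  rewrite -!cst -RintegralB//.
  apply: le_trans (le_normr_Rintegral _ iB) _ => //.
  apply: le_Rintegral => //.
  - by have := integrable_abse iB; apply: eq_integrable.
  - by move=> u /itv_ocP uk; exact: c_osc.
rewrite big_ord_recr /=; move: (ih (ltnW kK)) D E.
set A := \sum_(_ < k) _; set I0 := \int[mu]_(u in `[0, s]) _.
set I1 := \int[mu]_(u in `[0, tau k]) _; set I2 := \int[mu]_(u in `[0, tau k.+1]) _.
set I3 := \int[mu]_(u in `]tau k, _]) _.
rewrite !ler_norml => /andP[? ?] /andP[? ?] ?; lra.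
Qed.
End RiemannSums.

(** * Riemann sums converge to the Ito integral *)

Section ItoRiemann.
Context {disp : measure_display} {Omega : measurableType disp} {R : realType}.
Variable P : probability Omega R.

Lemma cvg0_small (Y : nat -> Omega -> \bar R) : cvg0_in_probability P Y ->
  forall e dl : R, 0 < e -> 0 < dl -> exists N, forall n, (N <= n)%N ->
    (P [set w | (e%:E <= `|Y n w|)%E] <= dl%:E)%E.
Proof.
move=> [mY cY] e dl e0 d0; have /fine_cvgP[_ f0] := cY e e0.
have [N _ hN] := cvgr_lt _ f0 _ d0; exists N => n Nn.
have m1 : measurable [set w | (e%:E <= `|Y n w|)%E].
  rewrite -[X in measurable X]setTI; apply: emeasurable_fun_c_infty => //.
  exact: measurableT_comp.
by rewrite -[leLHS]fineK ?fin_num_measure// lee_fin ltW//; exact: hN.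
Qed.

Lemma cvg0_cvg_prob (Y : nat -> Omega -> R) (Z : Omega -> R) :
  cvg0_in_probability P (fun n w => (Y n w - Z w)%:E) -> cvg_prob P Y Z.
Proof.
move=> c e dl e0 d0; have [N hN] := cvg0_small c e0 d0; exists N => n Nn.
exists [set w | (e%:E <= `|(Y n w - Z w)%:E|)%E]; split; last first.
- by move=> w /=; rewrite lee_fin => /negP; rewrite -ltNge.
- exact: hN.
rewrite -[X in measurable X]setTI; apply: emeasurable_fun_c_infty => //.
by apply: measurableT_comp => //; case: c.
Qed.

Lemma cvg_probB (Y Y' : nat -> Omega -> R) (Z Z' : Omega -> R) :
  cvg_prob P Y Z -> cvg_prob P Y' Z' ->
  cvg_prob P (fun n w => Y n w - Y' n w) (fun w => Z w - Z' w).
Proof.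
move=> c c'; apply: cvg_probD => // e dl e0 d0; have [N h] := c' e dl e0 d0.
exists N => n Nn; have [B [mB PB b]] := h n Nn; exists B; split => // w Bw.
by rewrite -opprD normrN; exact: b.
Qed.

Variables (T : R) (F : R -> set (set Omega)).
Hypothesis F_usual : usual_filtration P T F.
Variable W : R -> Omega -> R.
Hypothesis BW : brownian P T F W.
Variables (phi I : R -> Omega -> R) (phi_ : nat -> simple_process T F).
Hypothesis phi_adapted : forall u, 0 <= u <= T -> measurable_wrt (F u) (phi u).
Hypothesis phi_cont : {ae P, forall w, {within `[0, T], continuous (fun u => phi u w)}}.
Hypothesis phi_cvg : cvg0_in_probability P (fun n w =>
      \int[lebesgue_measure]_(s in `[0%R, T])
        ((sp_val (phi_ n) s w - phi s w) ^+ 2)%:E)%E.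
Hypothesis I_cvg : forall t : R, 0 <= t <= T ->
      cvg0_in_probability P (fun n w => (sp_integral W (phi_ n) t w - I t w)%:E).
Variables (s t : R) (K : nat -> nat) (tau : nat -> nat -> R).
Hypotheses (s0 : 0 <= s) (st : s <= t) (tT : t <= T).
Hypothesis tau_grid : forall n, is_grid s t (K n) (tau n).
Hypothesis tau_times : forall n l, (l <= sp_size (phi_ n))%N ->
  exists2 k, (k <= K n)%N & tau n k = clamp s t (sp_time (phi_ n) l).
Hypothesis tau_mesh : forall h, 0 < h -> exists N, forall n, (N <= n)%N ->
  forall j, (j < K n)%N -> tau n j.+1 - tau n j <= h.

Let val n j w := sp_grid_val (phi_ n) s t (tau n) j w.
Let Q n w := \sum_(j < K n) (val n j w - phi (tau n j) w) ^+ 2 * (tau n j.+1 - tau n j).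

Let gmem n j : (j <= K n)%N -> 0 <= tau n j <= T.
Proof.
have le := is_grid_le (tau_grid n); have [ts tt _] := tau_grid n.
move=> jK; apply/andP; split; first by apply: le_trans s0 _; rewrite -ts le.
by apply: le_trans tT; rewrite -tt le.
Qed.

Let psi_adapted n j : (j < K n)%N ->
  measurable_wrt (F (tau n j)) (fun w => val n j w - phi (tau n j) w).
Proof.
move=> jK; have jT := gmem (ltnW jK); apply: measurable_wrtB.
- exact: (filt_sigma F_usual).
- apply: sp_grid_val_adapted => //; first exact: (filt_sigma F_usual).
  exact: (filt_mono F_usual).
- exact: phi_adapted.
Qed.

Let mQ n : measurable_fun setT (Q n).
Proof.
apply: measurable_sum => j; apply: measurable_funM; last exact: measurable_cst.
apply: (measurableT_comp (@exprn_measurable _ _ 2)).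
exact: (filt_measurable F_usual (gmem (ltnW (ltn_ord j))) (psi_adapted (ltn_ord j))).
Qed.

(** How fine the grid must be depends on the modulus of continuity of the path, which is random. The
    comparison with the time integral thus holds almost surely from some index on, and
    [ae_eventually_measure] makes this uniform in probability. *)
Let Q_small (delta dl : R) : 0 < delta -> 0 < dl ->
  exists N, forall n, (N <= n)%N -> (P [set w | (delta < Q n w)%R] <= dl%:E)%E.
Proof.
move=> d0 dl0.
pose J n w := (\int[lebesgue_measure]_(s in `[0%R, T]) ((sp_val (phi_ n) s w - phi s w) ^+ 2)%:E)%E.
have d4 : 0 < delta / 4 by rewrite divr_gt0.
have dl2 : 0 < dl / 2 by rewrite divr_gt0.
pose A n := [set w | delta < Q n w]; pose B n := [set w | ((delta / 4)%:E <= `|J n w|)%E].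
have mA n : measurable (A n).
  by rewrite -[A n]setTI; exact: (measurable_fun_ltr (measurable_cst delta) (mQ n)).
have mB n : measurable (B n).
  rewrite -[B n]setTI; apply: emeasurable_fun_c_infty => //.
  by apply: measurableT_comp => //; exact: (phi_cvg.1 n).
have mE n : measurable (A n `\` B n) by exact: measurableD.
have aE : {ae P, forall w, exists N, forall n, (N <= n)%N -> ~ (A n `\` B n) w}.
  apply: filterS phi_cont => w cw.
  (* Makes the oscillation term at most delta/4; where the integral is below delta/4 as well, Q/2 <
     delta/2. *)
  pose e := Num.sqrt (delta / 4 / (t - s + 1)).
  have ts1 : 0 < t - s + 1 by have := st => ?; lra.
  have e0 : 0 < e by rewrite sqrtr_gt0 divr_gt0.
  have [h h0 osc] := uniform_continuity_segment cw e0.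
  have [N hN] := tau_mesh h0; exists N => n Nn [Aw Bw].
  have mono := (tau_grid n); case: mono => ts tt mono.
  have mv : measurable_fun setT (fun u => sp_val (phi_ n) u w).
    by apply: measurable_sum => l; apply: measurable_funM => //.
  have va j u : (j < K n)%N -> tau n j < u <= tau n j.+1 -> sp_val (phi_ n) u w = val n j w.
    by move=> jK uj; exact: (sp_val_grid (tau_grid n) (@tau_times n) w jK uj).
  have oscj j u : (j < K n)%N -> tau n j < u <= tau n j.+1 ->
      `|phi u w - phi (tau n j) w| <= e.
    move=> jK /andP[u1 u2]; have /andP[? ?] := gmem (ltnW jK); have /andP[? ?] := gmem jK.
    apply/ltW/osc; [lra|lra|].
    by have h3 := hN n Nn j jK; rewrite ger0_norm; lra.
  have := riemann_sum_sqr_le s0 tT (tau_grid n) cw oscj mv va.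
  rewrite -/(J n w) leNgt => /negP; apply.
  have Jlt : (J n w < (delta / 4)%:E)%E.
    by rewrite ltNge; apply/negP => h4; apply: Bw; apply: le_trans h4 _; exact: lee_abs.
  apply: lt_le_trans Jlt _; rewrite lee_fin.
  have e2 : e ^+ 2 * (t - s) <= delta / 4.
    rewrite sqr_sqrtr; last by rewrite divr_ge0 ?ltW.
    by rewrite mulrAC ler_pdivrMr// ler_wpM2l ?ltW//; lra.
  have -> : \sum_(j < K n) (val n j w - phi (tau n j) w) ^+ 2 * (tau n j.+1 - tau n j) / 2 = Q n w / 2.
    by rewrite /Q mulr_suml.
  move: Aw; rewrite /A /= => Aw; move: (Q n w) Aw e2 => q; lra.
have [N1 h1] := ae_eventually_measure mE aE dl2.
have [N2 h2] := cvg0_small phi_cvg d4 dl2.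
exists (maxn N1 N2) => n; rewrite geq_max => /andP[n1 n2].
apply: (@le_trans _ _ (P ((A n `\` B n) `|` B n))).
  apply: le_measure; rewrite ?inE; [exact: mA|exact: (measurableU _ _ (mE n) (mB n))|].
  by move=> w Aw; have [Bw|Bw] := pselect (B n w); [right|left].
apply: le_trans (measureU2 _ _ _) _ => //.
by rewrite [dl]splitr EFinD; apply: leeD; [exact: h1|exact: h2].
Qed.

Lemma ito_riemann : cvg_prob P
  (fun n w => \sum_(j < K n) phi (tau n j) w * (W (tau n j.+1) w - W (tau n j) w))
  (fun w => I t w - I s w).
Proof.
have sT : 0 <= s <= T by have := s0; have := st; have := tT => ? ? ?; lra.
have tT' : 0 <= t <= T by have := s0; have := st; have := tT => ? ? ?; lra.
have c1 := cvg_probB (cvg0_cvg_prob (I_cvg tT')) (cvg0_cvg_prob (I_cvg sT)).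
have c2 : cvg_prob P (fun n w => \sum_(j < K n) (val n j w - phi (tau n j) w) *
    (W (tau n j.+1) w - W (tau n j) w)) (fun=> 0).
  move=> e dl e0 dl0.
  have dl2 : 0 < dl / 2 by rewrite divr_gt0.
  (* Bracket level for which the quotient by e^2 in Lenglart's inequality is exactly dl/2. *)
  have d0 : 0 < dl / 2 * e ^+ 2 by rewrite mulr_gt0// exprn_gt0.
  have [N hN] := Q_small d0 dl2; exists N => n Nn.
  have [ts tt mono] := tau_grid n.
  have t0 : 0 <= tau n 0%N by rewrite ts.
  have tKT : tau n (K n) <= T by rewrite tt.
  have [B [mB PB b]] := lenglart F_usual BW t0 tKT mono (@psi_adapted n) d0 e0.
  exists B; split => //; last by move=> w Bw; rewrite subr0; exact: b.
  apply: le_trans PB _; rewrite [dl in leRHS]splitr EFinD; apply: leeD; first exact: hN.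
  by rewrite lee_fin mulfK// gt_eqF// exprn_gt0.
have := cvg_probB c1 c2.
have -> : (fun w => I t w - I s w - 0) = fun w => I t w - I s w.
  by apply/funext => w; rewrite subr0.
congr (cvg_prob P _ _); apply/funext => n; apply/funext => w.
rewrite (sp_integral_grid W st (tau_grid n) (@tau_times n)) -sumrB; apply: eq_bigr => j _.
by rewrite -mulrBl opprB addrC subrK.
Qed.

End ItoRiemann.

(** * Increments and moments of the solution *)

Section SodeIncrements.
Context {disp : measure_display} {Omega : measurableType disp} {R : realType}.
Variable P : probability Omega R.

Lemma within_path_continuous d (T : R) (c : R * 'rV[R]_d -> 'rV[R]_d) (x : R -> 'rV[R]_d) i :
  {within [set z : R * 'rV[R]_d | 0 <= z.1 <= T], continuous c} ->
  {within `[0, T], continuous x} ->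
  {within `[0, T], continuous (fun u => c (u, x u) 0 i)}.
Proof.
move=> /subspace_continuousP cc /subspace_continuousP cx; apply/subspace_continuousP => u uT.
have uT' : 0 <= u <= T by move: uT => /itv_ccP.
have cu : c (v, x v) @[v --> within `[0, T] (nbhs u)] --> c (u, x u).
  apply: (@cvg_comp _ _ _ (fun v => (v, x v)) c _ _ _ _ (cc (u, x u) uT')).
  move=> U; rewrite withinE => -[V [[A B] /= [nA nB] AB] UV].
  have nx := cx u uT B nB.
  have nA' : within `[0, T] (nbhs u) A.
    by rewrite /within /=; apply: filterS nA => v Av _.
  change (within `[0, T] (nbhs u) [set v | U (v, x v)]).
  have : within `[0, T] (nbhs u) (A `&` [set v | B (x v)]) by apply: filterI.
  rewrite /within /=; apply: filterS => v h vT; have [Av Bv] := h vT.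
  have vT' : 0 <= v <= T by move: vT => /itv_ccP.
  have : (U `&` [set z : R * 'rV[R]_d | 0 <= z.1 <= T]) (v, x v).
    by rewrite UV; split => //; exact: AB.
  by case.
apply: (@cvg_comp _ _ _ (fun v => c (v, x v)) (fun y : 'rV[R]_d => y 0 i) _ _ _ cu).
exact: coord_continuous.
Qed.

Lemma ae_cvg_prob (Y : nat -> Omega -> R) (Z : Omega -> R) :
  (forall n, measurable_fun setT (Y n)) -> measurable_fun setT Z ->
  {ae P, forall w, Y n w @[n --> \oo] --> Z w} -> cvg_prob P Y Z.
Proof.
move=> mY mZ c e dl e0 dl0.
have mE n : measurable [set w | e <= `|Y n w - Z w|].
  have mYZ : measurable_fun setT (fun w => `|Y n w - Z w|).
    by apply: measurableT_comp => //; exact: measurable_funB.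
  by rewrite -[X in measurable X]setTI; exact: (measurable_fun_ler (measurable_cst _) mYZ).
have aE : {ae P, forall w, exists N, forall n, (N <= n)%N -> ~ [set w | e <= `|Y n w - Z w|] w}.
  apply: filterS c => w /cvgrPdist_lt/(_ e e0)[N _ hN]; exists N => k Nk /=.
  by rewrite distrC; apply/negP; rewrite -ltNge; exact: hN.
have [N hN] := ae_eventually_measure mE aE dl0; exists N => n Nn.
exists [set w | e <= `|Y n w - Z w|]; split => //; first exact: hN.
by move=> w /= /negP; rewrite -ltNge.
Qed.

Lemma cvg_prob_ae (Y : nat -> Omega -> R) (Z Z' : Omega -> R) :
  {ae P, forall w, Z w = Z' w} -> cvg_prob P Y Z -> cvg_prob P Y Z'.
Proof.
move=> [A [mA PA AZ]] c e dl e0 dl0; have [N hN] := c e dl e0 dl0; exists N => n Nn.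
have [B [mB PB b]] := hN n Nn; exists (B `|` A); split; first exact: measurableU.
  apply: le_trans (measureU2 _ mB mA) _; rewrite -[X in (_ <= X)%E]adde0; apply: leeD => //.
  by move: PA => /= ->.
move=> w /not_orP[Bw Aw]; have -> : Z' w = Z w; last exact: b.
by apply: contrapT => ZZ; apply: Aw; apply: AZ => /esym.
Qed.

Variables (T : R) (F : R -> set (set Omega)).
Hypothesis F_usual : usual_filtration P T F.
Variables (d m : nat) (W : 'I_m -> R -> Omega -> R).
Hypothesis BW : forall r, brownian P T F (W r).
Variables (f : R -> 'rV[R]_d -> 'rV[R]_d) (g : 'I_m -> R -> 'rV[R]_d -> 'rV[R]_d) (L eta q : R).
Hypothesis adm : admissible T f g L eta q.
Variables (X0 : Omega -> 'rV[R]_d) (X : R -> Omega -> 'rV[R]_d).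
Hypothesis X_sol : sode_solution P T F W f g X0 X.

Lemma sp_integral_measurable (W1 : R -> Omega -> R) (phi : simple_process T F) t :
  brownian P T F W1 -> 0 <= t <= T -> measurable_fun setT (sp_integral W1 phi t).
Proof.
move=> B1 tT; apply: measurable_sum => l.
have lT := sp_time_range (ltnW (ltn_ord l)); have lT1 := sp_time_range (ltn_ord l).
apply: measurable_funM; first exact: (filt_measurable F_usual lT (sp_coef_adapted (ltn_ord l))).
have mW u : 0 <= u <= T -> measurable_fun setT (W1 u).
  by move=> uT; exact: (filt_measurable F_usual uT (bm_adapted B1 uT)).
have mn u : 0 <= u <= T -> 0 <= Num.min u t <= T.
  by move: tT => /andP[? ?] /andP[? ?]; rewrite le_min ge_min; apply/andP; split; [apply/andP|apply/orP; left].
by apply: measurable_funB; apply: mW; exact: mn.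
Qed.

(** One sequence of grids must serve all Brownian motions and all coordinates at once, so the jump
    times of every approximating simple process are put into it. Afterwards the Ito integral no
    longer appears. *)
Lemma sode_increment (s t : R) : 0 <= s -> s <= t -> t <= T ->
  exists (K : nat -> nat) (tau : nat -> nat -> R),
  [/\ forall n, is_grid s t (K n) (tau n),
    forall h, 0 < h -> exists N, forall n, (N <= n)%N ->
      forall j, (j < K n)%N -> tau n j.+1 - tau n j <= h &
    forall i, cvg_prob P (fun n w => \sum_(j < K n)
        (f (tau n j) (X (tau n j) w) 0 i * (tau n j.+1 - tau n j) +
         \sum_r g r (tau n j) (X (tau n j) w) 0 i * (W r (tau n j.+1) w - W r (tau n j) w)))
      (fun w => X t w 0 i - X s w 0 i)].
Proof.
move=> s0 st tT.
have sT : 0 <= s <= T by rewrite s0 (le_trans st).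
have tT' : 0 <= t <= T by rewrite tT (le_trans s0).
have [I [II XE]] := sol_eq X_sol.
have [phi_ phiP] := choice (fun ri : 'I_m * 'I_d => (II ri.1 ri.2).2).
pose pts n := flatten [seq [seq clamp s t (sp_time (phi_ ri n) l) | l <- iota 0 (sp_size (phi_ ri n)).+1]
  | ri <- enum {: 'I_m * 'I_d}].
have ptsT n x : x \in pts n -> s <= x <= t.
  by move=> /flatten_mapP[ri _ /mapP[l _ ->]]; exact: clamp_mem.
have /choice[Kt KtP] : forall n, exists Kt : nat * (nat -> R), [/\ is_grid s t Kt.1 Kt.2,
    (forall x, x \in pts n -> exists2 k, (k <= Kt.1)%N & Kt.2 k = x)
    & forall j, (j < Kt.1)%N -> Kt.2 j.+1 - Kt.2 j <= n.+1%:R^-1].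
  move=> n; have n0 : 0 < n.+1%:R^-1 :> R by rewrite invr_gt0.
  by have [K [tau [? ? ?]]] := grid_exists st n0 (@ptsT n); exists (K, tau).
pose K n := (Kt n).1; pose tau n := (Kt n).2.
have tau_grid n : is_grid s t (K n) (tau n) by case: (KtP n).
have tau_mesh h : 0 < h -> exists N, forall n, (N <= n)%N ->
      forall j, (j < K n)%N -> tau n j.+1 - tau n j <= h.
  move=> h0; have [N _ hN] := near_infty_natSinv_lt (PosNum h0); exists N => n Nn j jK.
  by case: (KtP n) => _ _ /(_ j jK) hj; apply: le_trans hj (ltW (hN n Nn)).
have tau_times ri n l : (l <= sp_size (phi_ ri n))%N ->
    exists2 k, (k <= K n)%N & tau n k = clamp s t (sp_time (phi_ ri n) l).
  move=> lS; case: (KtP n) => _ + _; apply; apply/flatten_mapP; exists ri; first by rewrite mem_enum.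
  by apply/mapP; exists l; rewrite // mem_iota.
exists K, tau; split => // i.
have gmem n j : (j <= K n)%N -> 0 <= tau n j <= T.
  have le := is_grid_le (tau_grid n); have [ts tt _] := tau_grid n.
  move=> jK; apply/andP; split; first by apply: le_trans s0 _; rewrite -ts le.
  by apply: le_trans tT; rewrite -tt le.
have sF u (uT : 0 <= u <= T) := filt_sigma F_usual uT.
have adaptX (c : R -> 'rV[R]_d -> 'rV[R]_d) u : 0 <= u <= T -> continuous (c u) ->
    measurable_wrt (F u) (fun w => c u (X u w) 0 i).
  by move=> uT cc; exact: (measurable_wrt_coord i (sF u uT) cc (sol_adapted X_sol uT)).
have ito r := ito_riemann F_usual (BW r)
  (phi := fun u w => g r u (X u w) 0 i) (I := fun u w => I r u w 0 i)
  (fun u uT => adaptX (g r) u uT (adm_continuous_g adm uT)) _ (phiP (r, i)).1 (phiP (r, i)).2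
  s0 st tT tau_grid (tau_times (r, i)) tau_mesh.
have gc r : {ae P, forall w, {within `[0, T], continuous (fun u => g r u (X u w) 0 i)}}.
  apply: filterS (sol_cont X_sol) => w cw.
  exact: (@within_path_continuous d T (fun z => g r z.1 z.2) (fun u => X u w) i (adm_cont_g adm (r := r)) cw).
have fc : {ae P, forall w, {within `[0, T], continuous (fun u => f u (X u w) 0 i)}}.
  apply: filterS (sol_cont X_sol) => w cw.
  exact: (@within_path_continuous d T (fun z => f z.1 z.2) (fun u => X u w) i (adm_cont_f adm) cw).
have sto := cvg_prob_sum (ito gc).
(* The notion of convergence in probability includes measurability of the differences; adding back a
   simple integral yields that of the limit. *)
have mI r u : 0 <= u <= T -> measurable_fun setT (fun w => I r u w 0 i).
  move=> uT; have [mD _] := (phiP (r, i)).2 u uT.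
  have mS := sp_integral_measurable (phi_ (r, i) 0%N) (BW r) uT.
  have -> : (fun w => I r u w 0 i) = fun w => sp_integral (W r) (phi_ (r, i) 0%N) u w -
      (sp_integral (W r) (phi_ (r, i) 0%N) u w - I r u w 0 i).
    by apply/funext => w; rewrite opprB addrC subrK.
  by apply: measurable_funB => //; apply/measurable_EFinP; exact: mD.
have mX u : 0 <= u <= T -> measurable_fun setT (fun w => X u w 0 i).
  by move=> uT; exact: (filt_measurable F_usual uT (sol_adapted X_sol uT i)).
(* By the equation this is almost surely the drift integral over [s, t]; written through X and I,
   its measurability in w is immediate. *)
pose Z w := X t w 0 i - X s w 0 i - \sum_r (I r t w 0 i - I r s w 0 i).
have mZ : measurable_fun setT Z.
  apply: measurable_funB; first by apply: measurable_funB; exact: mX.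
  by apply: measurable_sum => r; apply: measurable_funB; exact: mI.
have drift : cvg_prob P (fun n w => \sum_(j < K n)
    f (tau n j) (X (tau n j) w) 0 i * (tau n j.+1 - tau n j)) Z.
  apply: ae_cvg_prob => //.
    move=> n; apply: measurable_sum => j; apply: measurable_funM; last exact: measurable_cst.
    have jT := gmem n j (ltnW (ltn_ord j)).
    exact: (filt_measurable F_usual jT (adaptX f _ jT (adm_continuous_f adm jT))).
  apply: filterS2 fc XE => w cw Xw; apply/cvgrPdist_lt => e e0.
  have ts0 : 0 < t - s + 1 by lra.
  have e1 : 0 < e / (t - s + 1) by rewrite divr_gt0.
  have [h h0 osc] := uniform_continuity_segment cw e1.
  have [N hN] := tau_mesh h h0; exists N => // n /= Nn.
  have oscj j u : (j < K n)%N -> tau n j < u <= tau n j.+1 ->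
      `|f u (X u w) 0 i - f (tau n j) (X (tau n j) w) 0 i| <= e / (t - s + 1).
    move=> jK /andP[u1 u2]; have /andP[? ?] := gmem n _ (ltnW jK); have /andP[? ?] := gmem n _ jK.
    apply/ltW/osc; [lra|lra|].
    by have h3 := hN n Nn j jK; rewrite ger0_norm; lra.
  have := riemann_sum_integral s0 tT (tau_grid n) cw oscj.
  have -> : \int[lebesgue_measure]_(u in `[0, t]) f u (X u w) 0 i -
      \int[lebesgue_measure]_(u in `[0, s]) f u (X u w) 0 i = Z w.
    rewrite /Z [in RHS](Xw t tT') [in X in _ = _ - X - _](Xw s sT) !mxE !summxE sumrB; ring.
  rewrite distrC => h1; apply: le_lt_trans h1 _.
  by rewrite mulrAC ltr_pdivrMr// ltr_pM2l//; lra.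
have := cvg_probD drift sto.
have -> : (fun w => Z w + \sum_(r < m) (I r t w 0 i - I r s w 0 i)) = fun w => X t w 0 i - X s w 0 i.
  by apply/funext => w; rewrite /Z subrK.
congr (cvg_prob P _ _); apply/funext => n; apply/funext => w.
rewrite big_split /=; congr (_ + _); rewrite exchange_big /=; apply: eq_bigr => j _.
by [].
Qed.

End SodeIncrements.

Section Moments.
Context {disp : measure_display} {Omega : measurableType disp} {R : realType}.
Variable P : probability Omega R.

Lemma Lp_norm_moment d (Y : Omega -> 'rV[R]_d) (r S : R) : 0 < r ->
  measurable_fun setT (fun w => enorm (Y w)) -> (Lp_norm P r Y <= S%:E)%E ->
  intg P (fun w => enorm (Y w) `^ r) /\ Ex P (fun w => enorm (Y w) `^ r) <= S `^ r.
Proof.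
move=> r0 mY YS; apply: intg_ge0_le.
- exact: (measurableT_comp (measurable_powR r)).
- by move=> w; exact: powR_ge0.
have := poweR_Lnorm P (fun w => (enorm (Y w))%:E) (lt0r_neq0 r0).
have -> : (\int[P]_x `|(enorm (Y x))%:E| `^ r = \int[P]_w (enorm (Y w) `^ r)%:E)%E.
  by apply: eq_integral => w _ /=; rewrite ger0_norm ?enorm_ge0.
move=> <-; rewrite -poweR_EFin; apply: gt0_ler_poweR => //.
- exact: ltW.
- by rewrite in_itv /= Lnorm_ge0 leey.
- by rewrite in_itv /= leey andbT; apply: le_trans YS; exact: Lnorm_ge0.
Qed.

Lemma moment_Lp_norm d (Y : Omega -> 'rV[R]_d) (c : R) : 0 <= c ->
  intg P (fun w => enorm (Y w) ^+ 2) -> Ex P (fun w => enorm (Y w) ^+ 2) <= c ^+ 2 ->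
  (Lp_norm P 2 Y <= c%:E)%E.
Proof.
move=> c0 iY EY; rewrite /Lp_norm unlock.
have -> : (\int[P]_x `|(enorm (Y x))%:E| `^ 2 = (Ex P (fun w => (enorm (Y w)) ^+ 2))%:E)%E.
  rewrite Ex_EFin//; apply: eq_integral => w _ /=.
  by rewrite ger0_norm ?enorm_ge0// powR_mulrn ?enorm_ge0.
rewrite poweR_EFin lee_fin powR12_sqrt; last by apply: Ex_ge0 => w; exact: sqr_ge0.
by rewrite -[c]ger0_norm// -sqrtr_sqr ler_wsqrtr.
Qed.
End Moments.

Section SodeMoments.
Context {disp : measure_display} {Omega : measurableType disp} {R : realType}.
Variable P : probability Omega R.

Lemma enorm_powR_le d (x : 'rV[R]_d) p : 0 < p ->
  enorm x `^ p <= d%:R `^ (p / 2) * \sum_i `|x 0 i| `^ p.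
Proof.
move=> p0.
have sq (a : R) : 0 <= a -> a `^ p = (a ^+ 2) `^ (p / 2).
  by move=> a0; rewrite -powR_mulrn// -powRrM; congr (_ `^ _); field.
rewrite (sq _ (enorm_ge0 x)) enorm_sqr_sum.
have s0 : 0 <= \sum_(i < d) x 0 i ^+ 2 by apply: sumr_ge0 => i _; exact: sqr_ge0.
rewrite -{1}(ger0_norm s0); apply: le_trans (powR_sum_le _ _) _; first by rewrite divr_gt0.
rewrite ler_wpM2l ?powR_ge0//; apply: ler_sum => i _.
by rewrite (sq _ (normr_ge0 _)) real_normK ?num_real// ger0_norm ?sqr_ge0.
Qed.

Variables (T : R) (F : R -> set (set Omega)).
Hypothesis F_usual : usual_filtration P T F.
Variables (d m : nat) (W : 'I_m -> R -> Omega -> R).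
Hypothesis m_gt0 : (0 < m)%N.
Hypothesis BW : forall r, brownian P T F (W r).
Variables (f : R -> 'rV[R]_d -> 'rV[R]_d) (g : 'I_m -> R -> 'rV[R]_d -> 'rV[R]_d) (L eta q : R).
Hypothesis adm : admissible T f g L eta q.
Variables (X0 : Omega -> 'rV[R]_d) (X : R -> Omega -> 'rV[R]_d).
Hypothesis X_sol : sode_solution P T F W f g X0 X.
Hypothesis X_moment : (ereal_sup
   [set Lp_norm P (4 * q - 2) (X tau) | tau in `[0%R, T]] < +oo)%E.

Let q1 : 1 < q. Proof. exact: adm_q adm. Qed.
Let L0 : 0 < L. Proof. exact: adm_L adm. Qed.
(** Chosen so that p q = 4q - 2: coefficients of growth order q then have p-th moments. Since p = 4
    - 2/q and q > 1, it exceeds 2, as the expansion of |x|^p requires, and stays below 4. *)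
Let p := (4 * q - 2) / q.
Let p24 : 2 < p <= 4.
Proof.
have q0 : 0 < q by have := q1 => ?; lra.
by rewrite /p ltr_pdivlMr// ler_pdivrMr//; have := q1 => ?; apply/andP; split; lra.
Qed.
Let p0 : 0 < p. Proof. by have := p24 => ?; lra. Qed.

Lemma sode_moment : exists2 M : R, 0 <= M & forall u, 0 <= u <= T ->
  intg P (fun w => enorm (X u w) `^ (4 * q - 2)) /\
  Ex P (fun w => enorm (X u w) `^ (4 * q - 2)) <= M.
Proof.
move: X_moment; set S := ereal_sup _ => S_fin.
have r0 : 0 < 4 * q - 2 by have := q1 => ?; lra.
exists (fine S `^ (4 * q - 2)); first exact: powR_ge0.
move=> u uT.
have uS : (Lp_norm P (4 * q - 2) (X u) <= S)%E.
  by apply: ereal_sup_ubound; exists u => //; exact/itv_ccP.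
have Sfin : S \is a fin_num.
  rewrite ge0_fin_numE//; apply: le_trans uS; exact: Lnorm_ge0.
apply: Lp_norm_moment => //; last by rewrite fineK.
apply: (filt_measurable F_usual uT).
apply: measurable_wrt_continuous; [exact: (filt_sigma F_usual uT)|exact: enorm_continuous|].
exact: (sol_adapted X_sol).
Qed.

Lemma coef_moment (M u : R) (phi : 'rV[R]_d -> 'rV[R]_d) i : 0 <= u <= T -> continuous phi ->
  (forall x, enorm (phi x) <= L * (1 + enorm x `^ q)) ->
  intg P (fun w => enorm (X u w) `^ (4 * q - 2)) ->
  Ex P (fun w => enorm (X u w) `^ (4 * q - 2)) <= M ->
  intg P (fun w => `|phi (X u w) 0 i| `^ p) /\
  Ex P (fun w => `|phi (X u w) 0 i| `^ p) <= L `^ p * (16 * (1 + M)).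
Proof.
move=> uT cphi gphi iX eX; have sF := filt_sigma F_usual uT.
have mphi := measurable_wrt_coord i sF cphi (sol_adapted X_sol uT).
have bnd w : `|phi (X u w) 0 i| `^ p <= L `^ p * (16 * (1 + enorm (X u w) `^ (4 * q - 2))).
  have x0 := enorm_ge0 (X u w).
  apply: (@le_trans _ _ ((L * (1 + enorm (X u w) `^ q)) `^ p)).
    apply: powR_le; [exact: ltW|exact: normr_ge0|].
    by apply: le_trans (gphi _); exact: ler_coord_enorm.
  rewrite powRM ?(ltW L0)// ?addr_ge0 ?powR_ge0// ler_wpM2l ?powR_ge0//.
  have p04 : 0 <= p <= 4 by have := p24 => ?; lra.
  have := powRD2_le p04 ler01 (powR_ge0 (enorm (X u w)) q).
  rewrite powR1 -powRrM; congr (_ <= 16 * (1 + _ `^ _)).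
  by rewrite /p mulrC divfK// gt_eqF// (lt_trans ltr01).
have ib : intg P (fun w => L `^ p * (16 * (1 + enorm (X u w) `^ (4 * q - 2)))).
  by apply: intgZ; apply: intgZ; apply: intgD => //; exact: intg_cst.
have iphi : intg P (fun w => `|phi (X u w) 0 i| `^ p).
  apply: (intg_le _ _ ib) => [|w]; last by rewrite ger0_norm ?powR_ge0.
  apply: (measurableT_comp (measurable_powR p)).
  exact: (measurableT_comp (@normr_measurable R _) (filt_measurable F_usual uT mphi)).
split => //; apply: le_trans (Ex_le iphi ib bnd) _.
have i1 : intg P (fun w => 1 + enorm (X u w) `^ (4 * q - 2)) by apply: intgD => //; exact: intg_cst.
rewrite ExZ; last exact: intgZ.
rewrite (ExZ _ i1) ExD//; last exact: intg_cst.
by rewrite Ex_cst ler_wpM2l ?powR_ge0// ler_pM2l// lerD2l.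
Qed.

(** The bound holds for the approximating sums uniformly in the grid and passes to their limit in
    probability by Fatou. The moment estimate treats one Brownian motion at a time, so the sum is
    divided over [r] and over coordinates at the price of powers of m and d. *)
Lemma sode_increment_moment : exists2 C : R, 0 <= C & forall s t, 0 <= s -> s <= t -> t <= T ->
  intg P (fun w => enorm (X t w - X s w) `^ p) /\
  Ex P (fun w => enorm (X t w - X s w) `^ p) <= C * (t - s) `^ (p / 2).
Proof.
have [M M0 XM] := sode_moment.
have [c c4 expansion] := powR_taylor_ex p24.
have [C1 C1E] : exists C1, C1 = expR (c * (15 * 140)) * (c * (15 * 140)) by eexists.
have c0 : 0 <= C1.
  by rewrite C1E mulr_ge0 ?expR_ge0// mulr_ge0 ?(le_trans _ c4)// mulr_ge0.
pose M1 := L `^ p * (16 * (1 + M)).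
have M10 : 0 <= M1 by rewrite /M1 mulr_ge0 ?powR_ge0// mulr_ge0// addr_ge0.
have T12 : 0 <= T `^ (p / 2) by exact: powR_ge0.
pose C2 := m%:R `^ p * (m%:R * (C1 * ((T `^ (p / 2) + 1) * M1))).
have C20 : 0 <= C2.
  rewrite /C2; apply: mulr_ge0; first exact: powR_ge0.
  by apply: mulr_ge0 => //; apply: mulr_ge0 => //; apply: mulr_ge0 => //; apply: addr_ge0.
exists (d%:R `^ (p / 2) * (d%:R * C2)).
  by apply: mulr_ge0; [exact: powR_ge0|exact: mulr_ge0].
move=> s t s0 st tT.
have sT : 0 <= s <= T by lra.
have tT' : 0 <= t <= T by lra.
have sFt := filt_sigma F_usual tT'.
have vD : vmeasurable_wrt (F t) (fun w => X t w - X s w).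
  move=> i; have -> : (fun w => (X t w - X s w) 0 i) = fun w => X t w 0 i - X s w 0 i.
    by apply/funext => w; rewrite !mxE.
  apply: measurable_wrtB => //; first exact: (sol_adapted X_sol tT' i).
  exact: (filt_le F_usual s0 st tT (sol_adapted X_sol sT i)).
have mD i := filt_measurable F_usual tT' (vD i).
suff coord i : intg P (fun w => `|(X t w - X s w) 0 i| `^ p) /\
    Ex P (fun w => `|(X t w - X s w) 0 i| `^ p) <= C2 * (t - s) `^ (p / 2).
  have is_ : intg P (fun w => \sum_i `|(X t w - X s w) 0 i| `^ p).
    by apply: intg_sum => i _; case: (coord i).
  have ib : intg P (fun w => d%:R `^ (p / 2) * \sum_i `|(X t w - X s w) 0 i| `^ p) by exact: intgZ.
  have iD : intg P (fun w => enorm (X t w - X s w) `^ p).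
    apply: (intg_le _ _ ib) => [|w]; last by rewrite ger0_norm ?powR_ge0//; exact: enorm_powR_le.
    apply: (measurableT_comp (measurable_powR p)).
    exact: (filt_measurable F_usual tT' (measurable_wrt_continuous sFt (@enorm_continuous _ _) vD)).
  split => //; apply: le_trans (Ex_le iD ib (fun w => enorm_powR_le _ p0)) _.
  rewrite ExZ// -mulrA ler_wpM2l ?powR_ge0// Ex_sum; last by move=> i _; case: (coord i).
  apply: (@le_trans _ _ (\sum_(i < d) C2 * (t - s) `^ (p / 2))).
    by apply: ler_sum => i _; case: (coord i).
  by rewrite sumr_const card_ord mulr_natl mulrnAl.
have [->|ts] : s = t \/ s < t by move: st; rewrite le_eqVlt => /predU1P[|]; [left|right].
  have -> : (fun w => `|(X t w - X t w) 0 i| `^ p) = fun=> 0.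
    by apply/funext => w; rewrite subrr mxE normr0 powR0 ?gt_eqF.
  by split; [exact: intg_cst|rewrite Ex_cst mulr_ge0 ?powR_ge0].
have [K [tau [tau_grid tau_mesh tau_cvg]]] := sode_increment F_usual BW adm X_sol s0 st tT.
have gmem n j : (j <= K n)%N -> 0 <= tau n j <= T.
  have le := is_grid_le (tau_grid n); have [ts' tt _] := tau_grid n.
  move=> jK; apply/andP; split; first by apply: le_trans s0 _; rewrite -ts' le.
  by apply: le_trans tT; rewrite -tt le.
pose r0 := Ordinal m_gt0.
(* The whole drift is attached to the single index [r0], so that summation over [r] counts it
   once. *)
pose b n (r : 'I_m) j w := if r == r0 then f (tau n j) (X (tau n j) w) 0 i else 0.
pose xi n (r : 'I_m) j w := g r (tau n j) (X (tau n j) w) 0 i.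
pose S n r w := \sum_(j < K n) ((tau n j.+1 - tau n j) * b n r j w +
  xi n r j w * (W r (tau n j.+1) w - W r (tau n j) w)).
have mb n r j : (j < K n)%N -> measurable_wrt (F (tau n j)) (b n r j).
  move=> jK; have jT := gmem n j (ltnW jK); have sF := filt_sigma F_usual jT.
  rewrite /b; case: eqP => _; last exact: measurable_wrt_cst.
  exact: (measurable_wrt_coord i sF (adm_continuous_f adm jT) (sol_adapted X_sol jT)).
have mxi n r j : (j < K n)%N -> measurable_wrt (F (tau n j)) (xi n r j).
  move=> jK; have jT := gmem n j (ltnW jK); have sF := filt_sigma F_usual jT.
  exact: (measurable_wrt_coord i sF (adm_continuous_g adm jT) (sol_adapted X_sol jT)).
have mS n r : measurable_fun setT (S n r).
  apply: measurable_sum => j; have jK := ltn_ord j; have jT := gmem n j (ltnW jK).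
  have [_ _ mono] := tau_grid n.
  have /andP[j0 _] := jT; have /andP[_ jT1] := gmem n j.+1 jK.
  apply: measurable_funD; apply: measurable_funM => //.
  - exact: (filt_measurable F_usual jT (mb n r j jK)).
  - exact: (filt_measurable F_usual jT (mxi n r j jK)).
  - exact: (incr_measurable F_usual (BW r) j0 (mono j jK) jT1).
have M1b : 0 <= (t - s) `^ (p / 2) by exact: powR_ge0.
have bound n r : intg P (fun w => `|S n r w| `^ p) /\
    Ex P (fun w => `|S n r w| `^ p) <= C1 * ((T `^ (p / 2) + 1) * M1) * (t - s) `^ (p / 2).
  have [ts' tt mono] := tau_grid n.
  have cm (phi : R -> 'rV[R]_d -> 'rV[R]_d) j : (j < K n)%N ->
      (forall u, 0 <= u <= T -> continuous (phi u)) ->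
      (forall u x, 0 <= u <= T -> enorm (phi u x) <= L * (1 + enorm x `^ q)) ->
      intg P (fun w => `|phi (tau n j) (X (tau n j) w) 0 i| `^ p) /\
      Ex P (fun w => `|phi (tau n j) (X (tau n j) w) 0 i| `^ p) <= M1.
    move=> jK cphi gphi; have jT := gmem n j (ltnW jK).
    have [iX eX] := XM _ jT.
    exact: (coef_moment i jT (cphi _ jT) (fun x => gphi _ x jT) iX eX).
  have ib j : (j < K n)%N -> intg P (fun w => `|b n r j w| `^ p) /\ Ex P (fun w => `|b n r j w| `^ p) <= M1.
    move=> jK; rewrite /b; case: eqP => _.
      by apply: cm => // u; [move=> uT; exact: (adm_continuous_f adm uT)|move=> x uT; exact: (adm_growth_f m_gt0 adm x uT)].
    by rewrite normr0 powR0 ?gt_eqF//; split; [exact: intg_cst|rewrite Ex_cst].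
  have ixi j : (j < K n)%N -> intg P (fun w => `|xi n r j w| `^ p) /\ Ex P (fun w => `|xi n r j w| `^ p) <= M1.
    by move=> jK; apply: cm => // u; [move=> uT; exact: (adm_continuous_g adm uT)|move=> x uT; exact: (adm_growth_g adm r x uT)].
  have t0 : 0 <= tau n 0%N by rewrite ts'.
  have tK : tau n (K n) <= T by rewrite tt.
  have t0K : tau n 0%N < tau n (K n) by rewrite ts' tt.
  have [iS eS] := grid_powR F_usual (BW r) p24 c4 expansion t0 tK mono t0K
    (mb n r) (mxi n r) ib ixi.
  split => //; apply: le_trans eS _; rewrite -C1E tt ts'.
  (* The drift is of order (t - s)^p; half of that power is spent on T^(p/2) to match the noise. *)
  have Hb : (t - s) `^ p + (t - s) `^ (p / 2) <= (T `^ (p / 2) + 1) * (t - s) `^ (p / 2).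
    have h2 : (t - s) `^ p = (t - s) `^ (p / 2) * (t - s) `^ (p / 2).
      rewrite -powRD; last by apply/implyP => _; rewrite gt_eqF// subr_gt0.
      by congr (_ `^ _); field.
    rewrite h2 [leRHS]mulrDl mul1r lerD2r ler_wpM2r//.
    by apply: powR_le; [have := p0 => ?; lra|lra|lra].
  have alg (A B h C M' : R) : 0 <= C -> 0 <= M' -> A <= B * h -> C * (A * M') <= C * (B * M') * h.
    by move=> C' M'' AB; rewrite -mulrA ler_wpM2l// mulrAC ler_wpM2r.
  exact: alg.
pose Y n w := \sum_r S n r w.
have YE n w : Y n w = \sum_(j < K n) (f (tau n j) (X (tau n j) w) 0 i * (tau n j.+1 - tau n j) +
    \sum_r g r (tau n j) (X (tau n j) w) 0 i * (W r (tau n j.+1) w - W r (tau n j) w)).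
  rewrite /Y /S exchange_big /=; apply: eq_bigr => j _; rewrite big_split /=; congr (_ + _).
  rewrite -mulr_sumr mulrC; congr (_ * _); rewrite /b (bigD1 r0) //=.
  by rewrite [X in _ + X]big1 ?addr0 ?eqxx // => r /negbTE ->.
apply: (@fatou_prob _ _ _ P p _ Y) => //.
- by move=> n; exact: measurable_sum.
- have -> : (fun w => (X t w - X s w) 0 i) = fun w => X t w 0 i - X s w 0 i.
    by apply/funext => w; rewrite !mxE.
  have := tau_cvg i; congr (cvg_prob P _ _); apply/funext => n; apply/funext => w.
  by rewrite YE.
move=> n.
have iS : intg P (fun w => \sum_r `|S n r w| `^ p) by apply: intg_sum => r _; case: (bound n r).
have ib : intg P (fun w => m%:R `^ p * \sum_r `|S n r w| `^ p) by exact: intgZ.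
have iY : intg P (fun w => `|Y n w| `^ p).
  apply: (intg_le _ _ ib) => [|w]; last by rewrite ger0_norm ?powR_ge0//; exact: powR_sum_le.
  apply: (measurableT_comp (measurable_powR p)); apply: measurableT_comp => //.
  exact: measurable_sum.
split => //; apply: le_trans (Ex_le iY ib (fun w => powR_sum_le _ p0)) _.
rewrite ExZ// /C2 -mulrA ler_wpM2l ?powR_ge0// Ex_sum; last by move=> r _; case: (bound n r).
apply: (@le_trans _ _ (\sum_(r < m) C1 * ((T `^ (p / 2) + 1) * M1) * (t - s) `^ (p / 2))).
  by apply: ler_sum => r _; case: (bound n r).
by rewrite sumr_const card_ord mulr_natl mulrnAl.
Qed.
End SodeMoments.

(** * Consistency and error recursion *)

Section Consistency.
Context {disp : measure_display} {Omega : measurableType disp} {R : realType}.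
Variable P : probability Omega R.
Variables (T : R) (F : R -> set (set Omega)).
Hypothesis F_usual : usual_filtration P T F.
Variables (d m : nat) (W : 'I_m -> R -> Omega -> R).
Hypothesis m_gt0 : (0 < m)%N.
Hypothesis BW : forall r, brownian P T F (W r).
Variables (f : R -> 'rV[R]_d -> 'rV[R]_d) (g : 'I_m -> R -> 'rV[R]_d -> 'rV[R]_d) (L eta q : R).
Hypothesis adm : admissible T f g L eta q.
Variables (X0 : Omega -> 'rV[R]_d) (X : R -> Omega -> 'rV[R]_d).
Hypothesis X_sol : sode_solution P T F W f g X0 X.
Hypothesis X_moment : (ereal_sup
   [set Lp_norm P (4 * q - 2) (X tau) | tau in `[0%R, T]] < +oo)%E.
Variable hbar : R.
Hypothesis hbarL : hbar * L < 1.

Let q1 : 1 < q. Proof. exact: adm_q adm. Qed.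
Let L0 : 0 < L. Proof. exact: adm_L adm. Qed.
Let p := (4 * q - 2) / q.
Let p0 : 0 < p. Proof. by have := q1 => ?; apply: divr_gt0; lra. Qed.

Lemma stepL h : h <= hbar -> h * L < 1.
Proof. by move=> hh; apply: le_lt_trans hbarL; rewrite ler_pM2r. Qed.

(** The properties that [f] and every [g r] share, so that consistency is proved once for both. *)
Definition regular_coef (phi : R -> 'rV[R]_d -> 'rV[R]_d) : Prop :=
  [/\ forall t, 0 <= t <= T -> continuous (phi t),
    forall t x1 x2, 0 <= t <= T -> enorm (phi t x1 - phi t x2) <=
      L * (1 + enorm x1 `^ (q - 1) + enorm x2 `^ (q - 1)) * enorm (x1 - x2) &
    forall t1 t2 x, 0 <= t1 <= T -> 0 <= t2 <= T -> enorm (phi t1 x - phi t2 x) <=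
      L * (1 + enorm x `^ q) * `|t1 - t2| `^ 2^-1].

Lemma regular_coef_f : regular_coef f.
Proof.
split=> [t tT|t x1 x2 tT|t1 t2 x t1T t2T].
- exact: (adm_continuous_f adm tT).
- exact: (adm_space_f m_gt0 adm x1 x2 tT).
- exact: (adm_time_f m_gt0 adm x t1T t2T).
Qed.

Lemma regular_coef_g r : regular_coef (g r).
Proof.
split=> [t tT|t x1 x2 tT|t1 t2 x t1T t2T].
- exact: (adm_continuous_g adm tT).
- exact: (adm_space_g adm r x1 x2 tT).
- exact: (adm_time_g adm r x t1T t2T).
Qed.

Lemma vmeasurable_wrt_Finv (G : set (set Omega)) (phi : R -> 'rV[R]_d -> 'rV[R]_d) (x : Omega -> 'rV[R]_d) h t i :
  sigma_algebra setT G -> 0 < h <= hbar -> 0 <= t <= T -> continuous (phi t) -> vmeasurable_wrt G x ->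
  measurable_wrt G (fun w => phi t (ssbe_Finv f h t (x w)) 0 i).
Proof.
move=> sG /andP[h0 hh] tT cphi mx.
apply: (@measurable_wrt_coord _ _ _ _ _ (fun y => phi t (ssbe_Finv f h t y))) => // y.
have cF := @ssbe_Finv_continuous _ _ _ _ _ _ _ _ _ m_gt0 adm h t h0 (stepL hh) tT y.
exact: (@cvg_comp _ _ _ (ssbe_Finv f h t) (phi t) _ _ _ cF (cphi _)).
Qed.

(** Expectation of [ssbe_consistency] at x0 = X s and x = X tau. As 0 <= tau - s <= h, the increment
    divided by sqrt h has a p-th moment bounded independently of h. *)
Lemma sode_consistency : exists2 C : R, 0 <= C & forall phi s h tau, regular_coef phi ->
  0 <= s -> 0 < h <= hbar -> s + h <= T -> s <= tau <= s + h ->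
  intg P (fun w => enorm (phi (s + h) (ssbe_Finv f h (s + h) (X s w)) - phi tau (X tau w)) ^+ 2) /\
  Ex P (fun w => enorm (phi (s + h) (ssbe_Finv f h (s + h) (X s w)) - phi tau (X tau w)) ^+ 2) <= C * h.
Proof.
have [M M0 XM] := sode_moment F_usual adm X_sol X_moment.
have [C1 C10 XC] := sode_increment_moment F_usual m_gt0 BW adm X_sol X_moment.
have iL0 : 0 < 1 - hbar * L by rewrite subr_gt0.
(* A common bound for (1 - h L)^-1 and sqrt h over all h <= hbar, making the final constant
   independent of the step. *)
pose K := (1 - hbar * L)^-1 + Num.sqrt hbar.
pose C0 := (2 * (L * (2 + K `^ (q - 1)) * (L * (1 + K `^ q)) * K + 2 * L) ^+ 2 +
  2 * (L * (2 + K `^ (q - 1))) ^+ 2).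
have C00 : 0 <= C0 by rewrite /C0 addr_ge0// mulr_ge0// sqr_ge0.
pose r := 4 * q - 2.
have r0 : 0 <= r by have := q1 => ?; rewrite /r; lra.
pose C2 := 3 `^ r * (1 + M + M) + C1.
have C20 : 0 <= C2 by rewrite /C2 addr_ge0// mulr_ge0 ?powR_ge0// !addr_ge0.
exists (C0 * C2); first exact: mulr_ge0.
move=> phi s h tau [cphi sphi tphi] s0 hh' hT /andP[st th].
have /andP[h0 hh] := hh'.
have tT : 0 <= s + h <= T by lra.
have tauT : 0 <= tau <= T by lra.
have sT : 0 <= s <= T by lra.
have tsh : tau - s <= h by lra.
have ts0 : 0 <= tau - s by lra.
have p20 : 0 <= p / 2 by apply: divr_ge0 => //; exact: ltW.
have ssh : s <= s + h by lra.
have hs0 : 0 < Num.sqrt h by rewrite sqrtr_gt0.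
have K1 : (1 - h * L)^-1 <= K.
  apply: (@le_trans _ _ (1 - hbar * L)^-1); last by rewrite lerDl sqrtr_ge0.
  by rewrite lef_pV2 ?posrE ?subr_gt0 ?stepL// lerB// ler_pM2r.
have K2 : Num.sqrt h <= K.
  apply: (@le_trans _ _ (Num.sqrt hbar)); first exact: ler_wsqrtr.
  by rewrite lerDr invr_ge0 ltW.
have pw w : enorm (phi (s + h) (ssbe_Finv f h (s + h) (X s w)) - phi tau (X tau w)) ^+ 2 <=
    C0 * h * ((1 + enorm (X s w) + enorm (X tau w)) `^ r +
      (enorm (X tau w - X s w) / Num.sqrt h) `^ p).
  apply: (ssbe_consistency m_gt0 adm h0 (stepL hh) tT (X s w) _ _ K1 K2).
    by move=> x1 x2; exact: sphi.
  apply: le_trans (tphi _ _ _ tT tauT) _; rewrite ler_wpM2l//.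
    by rewrite mulr_ge0 ?(ltW L0)// addr_ge0 ?powR_ge0.
  rewrite powR12_sqrt// ler_wsqrtr// ger0_norm; lra.
have [is_ es] := XM s sT; have [it et] := XM tau tauT.
have tauT' : tau <= T by case/andP: tauT.
have [iD eD] := XC s tau s0 st tauT'.
pose Z w := 3 `^ r * (1 + enorm (X s w) `^ r + enorm (X tau w) `^ r) +
  (Num.sqrt h `^ p)^-1 * enorm (X tau w - X s w) `^ p.
have i1 : intg P (fun w => 1 + enorm (X s w) `^ r) by apply: intgD => //; exact: intg_cst.
have i2 : intg P (fun w => 1 + enorm (X s w) `^ r + enorm (X tau w) `^ r) by exact: (intgD i1 it).
have iZ : intg P Z by apply: intgD; exact: intgZ.
have pwZ w : enorm (phi (s + h) (ssbe_Finv f h (s + h) (X s w)) - phi tau (X tau w)) ^+ 2 <= C0 * h * Z w.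
  apply: le_trans (pw w) _; rewrite ler_wpM2l ?mulr_ge0 ?(ltW h0)//.
  apply: lerD.
    by have := powR_sum3_le r0 ler01 (enorm_ge0 (X s w)) (enorm_ge0 (X tau w)); rewrite powR1.
  rewrite powRM ?enorm_ge0 ?invr_ge0 ?(ltW hs0)// mulrC.
  by rewrite -[in leRHS]powRN -powR_inv1 ?(ltW hs0)// -powRrM mulN1r.
have EZ : Ex P Z <= C2.
  have E2 : Ex P (fun w => 1 + enorm (X s w) `^ r + enorm (X tau w) `^ r) =
      1 + Ex P (fun w => enorm (X s w) `^ r) + Ex P (fun w => enorm (X tau w) `^ r).
    by rewrite (ExD i1 it) (ExD (intg_cst P 1) is_) Ex_cst.
  rewrite /Z (ExD (intgZ _ i2) (intgZ _ iD)) (ExZ _ i2) (ExZ _ iD) E2; apply: lerD.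
    exact: (ler_wpM2l (powR_ge0 3 r) (lerD (lerD (lexx 1) es) et)).
  have hp : Num.sqrt h `^ p = h `^ (p / 2).
    by rewrite -powR12_sqrt ?(ltW h0)// -powRrM; congr (_ `^ _); field.
  have hp0 : 0 < h `^ (p / 2) by exact: powR_gt0.
  rewrite hp mulrC (ler_pdivrMr _ _ hp0); apply: le_trans eD _; apply: (ler_wpM2l C10).
  exact: powR_le p20 ts0 tsh.
have iB : intg P (fun w => C0 * h * Z w) by exact: intgZ.
have mY : measurable_fun setT
    (fun w => enorm (phi (s + h) (ssbe_Finv f h (s + h) (X s w)) - phi tau (X tau w))).
  have sF := filt_sigma F_usual tT.
  apply: (filt_measurable F_usual tT).
  apply: measurable_wrt_continuous => //; first exact: enorm_continuous.
  move=> i; have -> : (fun w => (phi (s + h) (ssbe_Finv f h (s + h) (X s w)) - phi tau (X tau w)) 0 i) =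
      fun w => phi (s + h) (ssbe_Finv f h (s + h) (X s w)) 0 i - phi tau (X tau w) 0 i.
    by apply/funext => w; rewrite !mxE.
  have up u v (Y : Omega -> R) : 0 <= u -> u <= v -> v <= T -> measurable_wrt (F u) Y -> measurable_wrt (F v) Y.
    by move=> u0 uv vT; exact: (filt_le F_usual u0 uv vT).
  apply: measurable_wrtB => //.
    apply: (vmeasurable_wrt_Finv _ sF hh' tT (cphi _ tT)) => j.
    by apply: (up s) => //; exact: (sol_adapted X_sol sT).
  apply: (up tau) => //; first by case/andP: tauT.
  exact: (measurable_wrt_coord i (filt_sigma F_usual tauT) (cphi _ tauT) (sol_adapted X_sol tauT)).
have iY : intg P (fun w => enorm (phi (s + h) (ssbe_Finv f h (s + h) (X s w)) - phi tau (X tau w)) ^+ 2).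
  apply: (intg_le _ _ iB) => [|w]; last by rewrite ger0_norm ?sqr_ge0.
  exact: (measurableT_comp (@exprn_measurable _ _ 2) mY).
split => //; apply: le_trans (Ex_le iY iB pwZ) _.
rewrite (ExZ _ iZ).
have alg (A B E D : R) : 0 <= A * B -> E <= D -> A * B * E <= A * D * B.
  by move=> AB ED; rewrite [leRHS]mulrAC ler_wpM2l.
exact: alg (mulr_ge0 C00 (ltW h0)) EZ.
Qed.
End Consistency.

Section GridError.
Context {disp : measure_display} {Omega : measurableType disp} {R : realType}.
Variables (P : probability Omega R) (T : R) (F : R -> set (set Omega)).
Hypothesis F_usual : usual_filtration P T F.
Variables (m : nat) (W : 'I_m -> R -> Omega -> R).
Hypothesis BW : forall r, brownian P T F (W r).
Hypothesis W_indep : independent_processes P T W.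

(** The difference of the two sides is a weighted variance, up to a positive factor. *)
Lemma weighted_sum_sqr_le K (w b : 'I_K -> R) : 0 < \sum_j w j -> (forall j, 0 <= w j) ->
  (\sum_j w j * b j) ^+ 2 <= (\sum_j w j) * \sum_j w j * b j ^+ 2.
Proof.
move=> H0 w0; set H := \sum_j w j; set S := \sum_j w j * b j.
have : 0 <= \sum_j w j * (b j * H - S) ^+ 2.
  by apply: sumr_ge0 => j _; rewrite mulr_ge0 ?sqr_ge0.
have -> : \sum_j w j * (b j * H - S) ^+ 2 = H * (H * (\sum_j w j * b j ^+ 2) - S ^+ 2).
  rewrite (eq_bigr (fun j => H ^+ 2 * (w j * b j ^+ 2) - 2 * H * S * (w j * b j) + S ^+ 2 * w j)).
    rewrite big_split sumrB /= -!mulr_sumr -/S -/H; ring.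
  by move=> j _; ring.
by rewrite pmulr_rge0// subr_ge0.
Qed.

(** The isometry gives the martingale part [V] with constant one. The drift part [D] has second
    moment at most h^2 B and is separated by (V + D)^2 <= (1 + h) V^2 + (1 + 1/h) D^2, where (1 +
    1/h) h^2 = (1 + h) h. *)
Lemma grid_sum_error (s h : R) (K : nat) (tau : nat -> R) (v : Omega -> R)
    (th : nat -> 'I_m -> Omega -> R) (be : nat -> Omega -> R) (A : 'I_m -> R) (B : R) :
  0 <= s -> 0 < h -> s + h <= T -> is_grid s (s + h) K tau ->
  measurable_wrt (F s) v -> intg P (fun w => v w ^+ 2) ->
  (forall j r, (j < K)%N -> measurable_wrt (F (tau j)) (th j r)) ->
  (forall j r, (j < K)%N -> intg P (fun w => th j r w ^+ 2) /\ Ex P (fun w => th j r w ^+ 2) <= A r) ->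
  (forall j, (j < K)%N -> measurable_wrt (F (tau j)) (be j)) ->
  (forall j, (j < K)%N -> intg P (fun w => be j w ^+ 2) /\ Ex P (fun w => be j w ^+ 2) <= B) ->
  let Y w := v w + \sum_(j < K) \sum_r th j r w * (W r (tau j.+1) w - W r (tau j) w)
    + \sum_(j < K) (tau j.+1 - tau j) * be j w in
  intg P (fun w => Y w ^+ 2) /\
  Ex P (fun w => Y w ^+ 2) <= (1 + h) * (Ex P (fun w => v w ^+ 2) + h * (\sum_r A r + B)).
Proof.
move=> s0 h0 hT gr mv iv mth ith mbe ibe Y.
have [ts tt mono] := gr.
have t0 : 0 <= tau 0%N by rewrite ts.
have tK : tau K <= T by rewrite tt.
have dt (j : 'I_K) : 0 <= tau j.+1 - tau j by rewrite subr_ge0 mono.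
have sumd : \sum_(j < K) (tau j.+1 - tau j) = h.
  have -> : h = tau K - tau 0%N by rewrite ts tt; ring.
  elim: (K) => [|k ih]; first by rewrite big_ord0 subrr.
  by rewrite big_ord_recr /= ih; ring.
pose V w := v w + \sum_(j < K) \sum_r th j r w * (W r (tau j.+1) w - W r (tau j) w).
pose D w := \sum_(j < K) (tau j.+1 - tau j) * be j w.
have mv' : measurable_wrt (F (tau 0%N)) v by rewrite ts.
have [iV eV] := grid_sqr F_usual BW t0 tK mono W_indep mv' iv mth (fun j r jK => (ith j r jK).1).
rewrite -/(V) in iV eV.
have eV' : Ex P (fun w => V w ^+ 2) <= Ex P (fun w => v w ^+ 2) + h * \sum_r A r.
  apply: le_trans eV _; rewrite lerD2l -sumd mulr_suml; apply: ler_sum => j _.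
  by apply: ler_wpM2l => //; apply: ler_sum => r _; case: (ith j r (ltn_ord j)).
have jT (j : 'I_K) : 0 <= tau j <= T by exact: (grid_mem t0 tK mono (ltnW (ltn_ord j))).
have mV : measurable_fun setT V.
  have KT := grid_mem t0 tK mono (leqnn K).
  exact: (filt_measurable F_usual KT (grid_sum_adapted F_usual BW t0 tK mono (leqnn K) mv' mth)).
have mD : measurable_fun setT D.
  apply: measurable_sum => j; apply: measurable_funM; first exact: measurable_cst.
  exact: (filt_measurable F_usual (jT j) (mbe j (ltn_ord j))).
have ij (j : 'I_K) : intg P (fun w => (tau j.+1 - tau j) * be j w ^+ 2).
  by apply: intgZ; case: (ibe j (ltn_ord j)).
have iQ : intg P (fun w => h * \sum_(j < K) (tau j.+1 - tau j) * be j w ^+ 2).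
  by apply: intgZ; exact: intg_sum.
have DQ w : D w ^+ 2 <= h * \sum_(j < K) (tau j.+1 - tau j) * be j w ^+ 2.
  by rewrite -sumd; apply: weighted_sum_sqr_le => //; rewrite sumd.
have iD : intg P (fun w => D w ^+ 2).
  apply: (intg_le _ _ iQ) => [|w]; last by rewrite ger0_norm ?sqr_ge0.
  exact: (measurableT_comp (@exprn_measurable _ _ 2) mD).
have eD : Ex P (fun w => D w ^+ 2) <= h * (h * B).
  apply: le_trans (Ex_le iD iQ DQ) _.
  rewrite ExZ; last exact: intg_sum.
  rewrite (ler_pM2l h0) Ex_sum// -sumd mulr_suml; apply: ler_sum => j _.
  have [i e] := ibe j (ltn_ord j).
  by rewrite (ExZ _ i); exact: (ler_wpM2l (dt j) e).
have YE w : Y w = V w + D w by [].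
have iY : intg P (fun w => Y w ^+ 2) by exact: intg_sqrD.
split => //.
have iR : intg P (fun w => (1 + h) * V w ^+ 2 + (1 + h^-1) * D w ^+ 2).
  by apply: intgD; exact: intgZ.
have YR w : Y w ^+ 2 <= (1 + h) * V w ^+ 2 + (1 + h^-1) * D w ^+ 2.
  rewrite YE -subr_ge0.
  have -> : (1 + h) * V w ^+ 2 + (1 + h^-1) * D w ^+ 2 - (V w + D w) ^+ 2 =
      h * (V w - h^-1 * D w) ^+ 2 by field; rewrite gt_eqF.
  by apply: mulr_ge0; [exact: ltW|exact: sqr_ge0].
apply: le_trans (Ex_le iY iR YR) _.
rewrite (ExD (intgZ _ iV) (intgZ _ iD)) (ExZ _ iV) (ExZ _ iD).
have h1 : 0 <= 1 + h by rewrite addr_ge0// ltW.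
have h2 : 0 <= 1 + h^-1 by rewrite addr_ge0// invr_ge0 ltW.
have := ler_wpM2l h1 eV'; have := ler_wpM2l h2 eD.
have -> : (1 + h^-1) * (h * (h * B)) = (1 + h) * (h * B) by field; rewrite gt_eqF.
move: (Ex P _) (Ex P _) (Ex P _) (\sum_r A r) => a b c e; lra.
Qed.
End GridError.

(** * Propagation of the mean square error over one step *)

Section OneStep.
Context {disp : measure_display} {Omega : measurableType disp} {R : realType}.
Variable P : probability Omega R.
Variables (T : R) (F : R -> set (set Omega)).
Hypothesis F_usual : usual_filtration P T F.
Variables (d m : nat) (W : 'I_m -> R -> Omega -> R).
Hypothesis m_gt0 : (0 < m)%N.
Hypothesis BW : forall r, brownian P T F (W r).
Hypothesis W_indep : independent_processes P T W.
Variables (f : R -> 'rV[R]_d -> 'rV[R]_d) (g : 'I_m -> R -> 'rV[R]_d -> 'rV[R]_d) (L eta q : R).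
Hypothesis adm : admissible T f g L eta q.
Hypothesis eta1 : 1 < eta.
Variables (X0 : Omega -> 'rV[R]_d) (X : R -> Omega -> 'rV[R]_d).
Hypothesis X_sol : sode_solution P T F W f g X0 X.
Hypothesis X_moment : (ereal_sup
   [set Lp_norm P (4 * q - 2) (X tau) | tau in `[0%R, T]] < +oo)%E.
Variable hbar : R.
Hypotheses (hbar_gt0 : 0 < hbar) (hbarL : hbar * L < 1).

Let L0 : 0 < L. Proof. exact: adm_L adm. Qed.

Lemma coord_sqr_le (x : 'rV[R]_d) i : x 0 i ^+ 2 <= enorm x ^+ 2.
Proof.
rewrite -(@real_normK _ (x 0 i)) ?num_real// lerXn2r ?nnegrE ?normr_ge0 ?enorm_ge0//.
exact: ler_coord_enorm.
Qed.

Lemma cvg_prob_cstB (a : Omega -> R) Y Z : cvg_prob P Y Z ->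
  cvg_prob P (fun n w => a w - Y n w) (fun w => a w - Z w).
Proof.
apply: cvg_probB => e dl e0 dl0; exists 0%N => n _; exists set0; split => //.
  by rewrite measure0 lee_fin ltW.
by move=> w _; rewrite subrr normr0.
Qed.

Section step.
Variables (C1 s h : R) (x : Omega -> 'rV[R]_d).
Hypothesis C10 : 0 <= C1.
Hypothesis consistency : forall phi s h tau, regular_coef T L q phi ->
  0 <= s -> 0 < h <= hbar -> s + h <= T -> s <= tau <= s + h ->
  intg P (fun w => enorm (phi (s + h) (ssbe_Finv f h (s + h) (X s w)) - phi tau (X tau w)) ^+ 2) /\
  Ex P (fun w => enorm (phi (s + h) (ssbe_Finv f h (s + h) (X s w)) - phi tau (X tau w)) ^+ 2) <= C1 * h.
Hypotheses (s0 : 0 <= s) (hh' : 0 < h <= hbar) (hT : s + h <= T).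
Hypothesis mx : vmeasurable_wrt (F s) x.
Hypothesis ix : intg P (fun w => enorm (x w - X s w) ^+ 2).

Let h0 : 0 < h. Proof. by case/andP: hh'. Qed.
Let hL : h * L < 1. Proof. by apply: (stepL adm hbarL); case/andP: hh'. Qed.
Let sT : 0 <= s <= T. Proof. by have := s0; have := h0; have := hT => ? ? ?; lra. Qed.
Let tT : 0 <= s + h <= T. Proof. by have := s0; have := h0; have := hT => ? ? ?; lra. Qed.
Let sF := filt_sigma F_usual sT.
Let tF := filt_sigma F_usual tT.
Let t := s + h.
Let y w := ssbe_Finv f h t (x w).
Let z w := ssbe_Finv f h t (X s w).
Let e w := x w - X s w.
Let kap := 1 + 2 * h * L / (1 - h * L) ^+ 2.
Let Dg r w := g r t (y w) - g r t (z w).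
Let x' := fun w => ssbe f g W (x w) s h w.

Let stable w : enorm (y w - z w) ^+ 2 + 2 * h * eta * (\sum_r enorm (Dg r w) ^+ 2) <= kap * enorm (e w) ^+ 2.
Proof. exact: (ssbe_Finv_stable m_gt0 adm h0 hL tT (x w) (X s w)). Qed.

Let mcoef (phi : R -> 'rV[R]_d -> 'rV[R]_d) (v : Omega -> 'rV[R]_d) i : continuous (phi t) ->
  vmeasurable_wrt (F s) v -> measurable_wrt (F s) (fun w => phi t (ssbe_Finv f h t (v w)) 0 i).
Proof. by move=> cphi mv; exact: (vmeasurable_wrt_Finv m_gt0 adm hbarL i sF hh' tT cphi mv). Qed.

Let mX : vmeasurable_wrt (F s) (X s). Proof. exact: (sol_adapted X_sol sT). Qed.

Let my i : measurable_wrt (F s) (fun w => y w 0 i).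
Proof. by apply: (mcoef (phi := fun _ x => x)) => // a; exact: cvg_id. Qed.
Let mz i : measurable_wrt (F s) (fun w => z w 0 i).
Proof. by apply: (mcoef (phi := fun _ x => x)) => // a; exact: cvg_id. Qed.
Let mgy r i : measurable_wrt (F s) (fun w => g r t (y w) 0 i).
Proof. exact: (mcoef i (adm_continuous_g adm tT) mx). Qed.
Let mgz r i : measurable_wrt (F s) (fun w => g r t (z w) 0 i).
Proof. exact: (mcoef i (adm_continuous_g adm tT) mX). Qed.
Let mfz i : measurable_wrt (F s) (fun w => f t (z w) 0 i).
Proof. exact: (mcoef i (adm_continuous_f adm tT) mX). Qed.

Let up u (Y : Omega -> R) : s <= u -> u <= T -> measurable_wrt (F s) Y -> measurable_wrt (F u) Y.
Proof. exact: (filt_le F_usual s0). Qed.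

Lemma ssbe_step_measurable : vmeasurable_wrt (F t) x'.
Proof.
have st : s <= t by rewrite lerDl ltW ?h0.
move=> i; have -> : (fun w => x' w 0 i) = fun w => y w 0 i +
    \sum_r (W r t w - W r s w) * g r t (y w) 0 i.
  by apply/funext => w; rewrite /x' /ssbe mxE summxE; congr (_ + _); apply: eq_bigr => r _; rewrite mxE.
apply: (measurable_wrtD tF); first exact: (up st hT (my i)).
apply: (measurable_wrt_sum tF) => r _; apply: (measurable_wrtM tF).
  exact: (incr_adapted F_usual (BW r) s0 st hT).
exact: (up st hT (mgy r i)).
Qed.

Let ik : intg P (fun w => kap * enorm (e w) ^+ 2). Proof. exact: intgZ. Qed.

Let sum_Dg_ge0 w : 0 <= 2 * h * eta * (\sum_r enorm (Dg r w) ^+ 2).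
Proof.
apply: mulr_ge0; last by apply: sumr_ge0 => r _; exact: sqr_ge0.
by apply: mulr_ge0; [apply: mulr_ge0 => //; exact: ltW|apply: ltW; exact: lt_trans eta1].
Qed.

Let iv i : intg P (fun w => (y w 0 i - z w 0 i) ^+ 2).
Proof.
apply: (intg_le _ _ ik) => [|w].
  apply: (measurableT_comp (@exprn_measurable _ _ 2)).
  exact: (filt_measurable F_usual sT (measurable_wrtB sF (my i) (mz i))).
rewrite ger0_norm ?sqr_ge0//; apply: le_trans (stable w).
apply: (@le_trans _ _ (enorm (y w - z w) ^+ 2)); last by rewrite lerDl.
by have := coord_sqr_le (y w - z w) i; rewrite !mxE.
Qed.

Let iDg r i : intg P (fun w => (g r t (y w) 0 i - g r t (z w) 0 i) ^+ 2).
Proof.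
have c0 : 0 < 2 * h * eta.
  by apply: mulr_gt0; [apply: mulr_gt0 => //|exact: lt_trans eta1].
have ik' : intg P (fun w => (2 * h * eta)^-1 * (kap * enorm (e w) ^+ 2)) by exact: intgZ.
apply: (intg_le _ _ ik') => [|w].
  apply: (measurableT_comp (@exprn_measurable _ _ 2)).
  exact: (filt_measurable F_usual sT (measurable_wrtB sF (mgy r i) (mgz r i))).
rewrite ger0_norm ?sqr_ge0// mulrC ler_pdivlMr// mulrC; apply: le_trans (stable w).
apply: (@le_trans _ _ (2 * h * eta * (\sum_r enorm (Dg r w) ^+ 2))); last by rewrite lerDr sqr_ge0.
apply: ler_wpM2l; first exact: ltW.
rewrite (bigD1 r)//=; apply: (@le_trans _ _ (enorm (Dg r w) ^+ 2)).
  by have := coord_sqr_le (Dg r w) i; rewrite !mxE.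
by rewrite lerDl; apply: sumr_ge0 => r' _; exact: sqr_ge0.
Qed.

Let EDg r i := Ex P (fun w => (g r t (y w) 0 i - g r t (z w) 0 i) ^+ 2).

(** The new error is the limit in probability of [Y n]: the increment of X over the step is replaced
    by its grid sums, while the scheme's noise and the term h f(t, z) are spread over the same
    cells. The bound for [Y n] is independent of n and passes to the limit. *)
Lemma ssbe_step_coord i : intg P (fun w => (x' w - X t w) 0 i ^+ 2) /\
  Ex P (fun w => (x' w - X t w) 0 i ^+ 2) <= (1 + h) * (Ex P (fun w => (y w 0 i - z w 0 i) ^+ 2)
    + h * (\sum_r (2 * EDg r i + 2 * (C1 * h)) + C1 * h)).
Proof.
have st : s <= t by rewrite lerDl ltW ?h0.
have [K [tau [tau_grid tau_mesh tau_cvg]]] := sode_increment F_usual BW adm X_sol s0 st hT.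
have gmem n j : (j <= K n)%N -> s <= tau n j <= t.
  have le := is_grid_le (tau_grid n); have [ts' tt _] := tau_grid n.
  by move=> jK; apply/andP; split; [rewrite -ts' le|rewrite -tt le].
pose th n j r w := g r t (y w) 0 i - g r (tau n j) (X (tau n j) w) 0 i.
pose be n j w := f t (z w) 0 i - f (tau n j) (X (tau n j) w) 0 i.
pose Y n w := (y w 0 i - z w 0 i) + \sum_(j < K n) \sum_r th n j r w * (W r (tau n j.+1) w - W r (tau n j) w)
    + \sum_(j < K n) (tau n j.+1 - tau n j) * be n j w.
have jT n j : (j < K n)%N -> 0 <= tau n j <= T.
  by move=> jK; have := gmem n j (ltnW jK); have := hT; have := s0; rewrite -/t => ? ? ?; lra.
have mXc (phi : R -> 'rV[R]_d -> 'rV[R]_d) u : 0 <= u <= T -> continuous (phi u) ->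
    measurable_wrt (F u) (fun w => phi u (X u w) 0 i).
  by move=> uT cphi; exact: (measurable_wrt_coord i (filt_sigma F_usual uT) cphi (sol_adapted X_sol uT)).
have cons phi n j : regular_coef T L q phi -> (j < K n)%N ->
    intg P (fun w => (phi t (z w) 0 i - phi (tau n j) (X (tau n j) w) 0 i) ^+ 2) /\
    Ex P (fun w => (phi t (z w) 0 i - phi (tau n j) (X (tau n j) w) 0 i) ^+ 2) <= C1 * h.
  move=> rphi jK; have [ic ec] := consistency rphi s0 hh' hT (gmem n j (ltnW jK)).
  have [cphi _ _] := rphi; have uT := jT n j jK.
  have le w : (phi t (z w) 0 i - phi (tau n j) (X (tau n j) w) 0 i) ^+ 2 <=
      enorm (phi t (z w) - phi (tau n j) (X (tau n j) w)) ^+ 2.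
    by have := coord_sqr_le (phi t (z w) - phi (tau n j) (X (tau n j) w)) i; rewrite !mxE.
  have ii : intg P (fun w => (phi t (z w) 0 i - phi (tau n j) (X (tau n j) w) 0 i) ^+ 2).
    apply: (intg_le _ _ ic) => [|w]; last by rewrite ger0_norm ?sqr_ge0.
    apply: (measurableT_comp (@exprn_measurable _ _ 2)); apply: measurable_funB.
      exact: (filt_measurable F_usual sT (mcoef i (cphi _ tT) mX)).
    exact: (filt_measurable F_usual uT (mXc phi _ uT (cphi _ uT))).
  by split => //; exact: le_trans (Ex_le ii ic le) ec.
have mv : measurable_wrt (F s) (fun w => y w 0 i - z w 0 i) by exact: measurable_wrtB.
have up' n j (Z : Omega -> R) : (j < K n)%N -> measurable_wrt (F s) Z -> measurable_wrt (F (tau n j)) Z.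
  by move=> jK; apply: up; [case/andP: (gmem n j (ltnW jK))|case/andP: (jT n j jK)].
have mth n j r : (j < K n)%N -> measurable_wrt (F (tau n j)) (th n j r).
  move=> jK; have uT := jT n j jK; apply: (measurable_wrtB (filt_sigma F_usual uT)).
    exact: (up' _ _ _ jK (mgy r i)).
  exact: (mXc _ _ uT (adm_continuous_g adm uT)).
have mbe n j : (j < K n)%N -> measurable_wrt (F (tau n j)) (be n j).
  move=> jK; have uT := jT n j jK; apply: (measurable_wrtB (filt_sigma F_usual uT)).
    exact: (up' _ _ _ jK (mfz i)).
  exact: (mXc _ _ uT (adm_continuous_f adm uT)).
have ith n j r : (j < K n)%N -> intg P (fun w => th n j r w ^+ 2) /\
    Ex P (fun w => th n j r w ^+ 2) <= 2 * EDg r i + 2 * (C1 * h).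
  move=> jK; have [ic ec] := cons _ n j (regular_coef_g adm r) jK; have uT := jT n j jK.
  have ib : intg P (fun w => 2 * (g r t (y w) 0 i - g r t (z w) 0 i) ^+ 2 +
      2 * (g r t (z w) 0 i - g r (tau n j) (X (tau n j) w) 0 i) ^+ 2).
    by apply: intgD; exact: intgZ.
  have le w : th n j r w ^+ 2 <= 2 * (g r t (y w) 0 i - g r t (z w) 0 i) ^+ 2 +
      2 * (g r t (z w) 0 i - g r (tau n j) (X (tau n j) w) 0 i) ^+ 2.
    have alg (a b c : R) : (a - c) ^+ 2 <= 2 * (a - b) ^+ 2 + 2 * (b - c) ^+ 2.
      by have := sqr_ge0 (a - 2 * b + c); rewrite !expr2 => ?; lra.
    exact: alg.
  have ii : intg P (fun w => th n j r w ^+ 2).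
    apply: (intg_le _ _ ib) => [|w]; last by rewrite ger0_norm ?sqr_ge0.
    exact: (measurableT_comp (@exprn_measurable _ _ 2) (filt_measurable F_usual uT (mth n j r jK))).
  split => //; apply: le_trans (Ex_le ii ib le) _.
  rewrite (ExD (intgZ _ (iDg r i)) (intgZ _ ic)) (ExZ _ (iDg r i)) (ExZ _ ic) -/(EDg r i).
  by rewrite lerD2l ler_pM2l.
have bound n := grid_sum_error F_usual BW W_indep s0 h0 hT (tau_grid n) mv (iv i)
  (mth n) (ith n) (mbe n) (fun j jK => cons _ n j (regular_coef_f m_gt0 adm) jK).
have sqE (a : R) : `|a| `^ 2 = a ^+ 2 by rewrite powR_mulrn// real_normK ?num_real.
have sqF (Z : Omega -> R) : (fun w => Z w ^+ 2) = fun w => `|Z w| `^ 2.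
  by apply/funext => w; rewrite sqE.
have mY n : measurable_fun setT (Y n).
  apply: measurable_funD.
    have [ts' tt mono] := tau_grid n.
    have t0 : 0 <= tau n 0%N by rewrite ts' s0.
    have tK : tau n (K n) <= T by rewrite tt hT.
    have KT := grid_mem t0 tK mono (leqnn _).
    have mv' : measurable_wrt (F (tau n 0%N)) (fun w => y w 0 i - z w 0 i) by rewrite ts'.
    exact: (filt_measurable F_usual KT (grid_sum_adapted F_usual BW t0 tK mono (leqnn _) mv' (mth n))).
  apply: measurable_sum => j; apply: measurable_funM; first exact: measurable_cst.
  exact: (filt_measurable F_usual (jT n j (ltn_ord j)) (mbe n j (ltn_ord j))).
have mx' := ssbe_step_measurable.
have mE : measurable_fun setT (fun w => (x' w - X t w) 0 i).
  have -> : (fun w => (x' w - X t w) 0 i) = fun w => x' w 0 i - X t w 0 i.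
    by apply/funext => w; rewrite !mxE.
  apply: measurable_funB; first exact: (filt_measurable F_usual tT (mx' i)).
  exact: (filt_measurable F_usual tT (sol_adapted X_sol tT i)).
rewrite sqF; apply: (@fatou_prob _ _ _ P 2 _ Y) => //; last first.
  by move=> n; rewrite -sqF; exact: bound.
have := cvg_prob_cstB (fun w => x' w 0 i - X s w 0 i) (tau_cvg i).
have -> : (fun w => x' w 0 i - X s w 0 i - (X t w 0 i - X s w 0 i)) = fun w => (x' w - X t w) 0 i.
  by apply/funext => w; rewrite !mxE; ring.
congr (cvg_prob P _ _); apply/funext => n; apply/funext => w.
have [ts' tt mono] := tau_grid n.
have tele (G : R -> R) : \sum_(j < K n) (G (tau n j.+1) - G (tau n j)) = G t - G s.
  rewrite -tt -ts'; elim: (K n) => [|k ih]; first by rewrite big_ord0 subrr.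
  by rewrite big_ord_recr /= ih; ring.
have xE : x' w 0 i = y w 0 i + \sum_r g r t (y w) 0 i * (W r t w - W r s w).
  rewrite /x' /ssbe mxE summxE; congr (_ + _); apply: eq_bigr => r _.
  by rewrite mxE mulrC.
(* The implicit equation at X s; it supplies the drift h f(t, z) against which the drift of the
   solution is compared. *)
have zE : z w 0 i = X s w 0 i + h * f t (z w) 0 i.
  by rewrite {1}/z (ssbe_Finv_eq m_gt0 adm h0 hL tT) -/(z w) !mxE.
have thE : \sum_(j < K n) \sum_r th n j r w * (W r (tau n j.+1) w - W r (tau n j) w) =
    \sum_r g r t (y w) 0 i * (W r t w - W r s w) -
    \sum_(j < K n) \sum_r g r (tau n j) (X (tau n j) w) 0 i * (W r (tau n j.+1) w - W r (tau n j) w).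
  have -> : \sum_r g r t (y w) 0 i * (W r t w - W r s w) =
      \sum_(j < K n) \sum_r g r t (y w) 0 i * (W r (tau n j.+1) w - W r (tau n j) w).
    rewrite exchange_big /=; apply: eq_bigr => r _.
    by rewrite -mulr_sumr (tele (fun u => W r u w)).
  rewrite -sumrB; apply: eq_bigr => j _; rewrite -sumrB; apply: eq_bigr => r _.
  by rewrite /th mulrBl.
have beE : \sum_(j < K n) (tau n j.+1 - tau n j) * be n j w = h * f t (z w) 0 i -
    \sum_(j < K n) f (tau n j) (X (tau n j) w) 0 i * (tau n j.+1 - tau n j).
  have -> : h * f t (z w) 0 i = \sum_(j < K n) (tau n j.+1 - tau n j) * f t (z w) 0 i.
    rewrite -mulr_suml; have := tele id; rewrite /= => ->; congr (_ * _); rewrite /t; ring.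
  by rewrite -sumrB; apply: eq_bigr => j _; rewrite /be; ring.
by rewrite /Y thE beE xE big_split /= zE; ring.
Qed.

(** Summed over coordinates, |y - z|^2 and the diffusion differences with weight 2h are exactly what
    the stability estimate controls; what remains is the consistency error, of order h^2. *)
Lemma ssbe_step_sqr : intg P (fun w => enorm (x' w - X t w) ^+ 2) /\
  Ex P (fun w => enorm (x' w - X t w) ^+ 2) <=
    (1 + h) * (kap * Ex P (fun w => enorm (e w) ^+ 2) + d%:R * (h * ((2 * m%:R + 1) * (C1 * h)))).
Proof.
have coord := ssbe_step_coord.
have -> : (fun w => enorm (x' w - X t w) ^+ 2) = fun w => \sum_i (x' w - X t w) 0 i ^+ 2.
  by apply/funext => w; rewrite enorm_sqr_sum.
split; first by apply: intg_sum => i _; case: (coord i).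
rewrite Ex_sum; last by move=> i _; case: (coord i).
apply: (@le_trans _ _ (\sum_i (1 + h) * (Ex P (fun w => (y w 0 i - z w 0 i) ^+ 2)
    + h * (\sum_r (2 * EDg r i + 2 * (C1 * h)) + C1 * h)))).
  by apply: ler_sum => i _; case: (coord i).
rewrite -mulr_sumr; apply: ler_wpM2l; first by rewrite addr_ge0// ltW ?h0.
pose U w := \sum_i (y w 0 i - z w 0 i) ^+ 2
  + 2 * h * \sum_i \sum_r (g r t (y w) 0 i - g r t (z w) 0 i) ^+ 2.
have iU2 : intg P (fun w => \sum_i \sum_r (g r t (y w) 0 i - g r t (z w) 0 i) ^+ 2).
  by apply: intg_sum => i _; apply: intg_sum => r _.
have iU1 : intg P (fun w => \sum_i (y w 0 i - z w 0 i) ^+ 2) by exact: intg_sum.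
have EU : Ex P U = \sum_i Ex P (fun w => (y w 0 i - z w 0 i) ^+ 2) + 2 * h * \sum_i \sum_r EDg r i.
  rewrite (ExD iU1 (intgZ _ iU2)) (ExZ _ iU2) Ex_sum//; congr (_ + _ * _).
  rewrite Ex_sum; last by move=> i _; apply: intg_sum => r _.
  by apply: eq_bigr => i _; rewrite Ex_sum.
have Ue w : U w <= kap * enorm (e w) ^+ 2.
  apply: le_trans (stable w); rewrite enorm_sqr_sum; apply: lerD.
    by apply: ler_sum => i _; rewrite !mxE.
  apply: (@le_trans _ _ (2 * h * \sum_r enorm (Dg r w) ^+ 2)).
    rewrite exchange_big /=; apply: ler_wpM2l; first by apply: mulr_ge0 => //; exact: ltW.
    by apply: ler_sum => r _; rewrite enorm_sqr_sum; apply: ler_sum => i _; rewrite !mxE.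
  (* Only here is [eta1] used as a comparison with 1: 2h, its factor 2 coming from the splitting of
     the diffusion defect, is at most 2 h eta. *)
  apply: ler_wpM2r; first by apply: sumr_ge0 => r _; exact: sqr_ge0.
  by rewrite ler_peMr ?(ltW eta1)// mulr_ge0// ltW ?h0.
have iU : intg P U by apply: (intgD iU1); exact: intgZ.
have := Ex_le iU ik Ue; rewrite (ExZ _ ix) EU.
have -> : \sum_i (Ex P (fun w => (y w 0 i - z w 0 i) ^+ 2) +
      h * (\sum_r (2 * EDg r i + 2 * (C1 * h)) + C1 * h)) =
    \sum_i Ex P (fun w => (y w 0 i - z w 0 i) ^+ 2) + 2 * h * (\sum_i \sum_r EDg r i) +
    d%:R * (h * ((2 * m%:R + 1) * (C1 * h))).
  rewrite big_split /= -addrA; congr (_ + _).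
  have inner i : h * (\sum_r (2 * EDg r i + 2 * (C1 * h)) + C1 * h) =
      2 * h * (\sum_r EDg r i) + h * ((2 * m%:R + 1) * (C1 * h)).
    rewrite big_split /= -mulr_sumr sumr_const card_ord -[_ *+ m]mulr_natl; ring.
  rewrite (eq_bigr _ (fun i _ => inner i)) big_split /= -mulr_sumr; congr (_ + _).
  by rewrite sumr_const card_ord -[LHS]mulr_natl.
by move=> H; rewrite lerD2r.
Qed.
End step.

Lemma ssbe_step : exists2 C : R, 0 <= C & forall s h (x : Omega -> 'rV[R]_d),
  0 <= s -> 0 < h <= hbar -> s + h <= T -> vmeasurable_wrt (F s) x ->
  intg P (fun w => enorm (x w - X s w) ^+ 2) ->
  [/\ vmeasurable_wrt (F (s + h)) (fun w => ssbe f g W (x w) s h w),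
    intg P (fun w => enorm (ssbe f g W (x w) s h w - X (s + h) w) ^+ 2) &
    Ex P (fun w => enorm (ssbe f g W (x w) s h w - X (s + h) w) ^+ 2) <=
      (1 + C * h) * Ex P (fun w => enorm (x w - X s w) ^+ 2) + C * h ^+ 2].
Proof.
have [C1 C10 cons] := sode_consistency F_usual m_gt0 BW adm X_sol X_moment hbarL.
have iL0 : 0 < 1 - hbar * L by rewrite subr_gt0.
pose c := 2 * L / (1 - hbar * L) ^+ 2.
have c0 : 0 <= c by rewrite /c divr_ge0 ?mulr_ge0 ?sqr_ge0 ?ltW.
pose D := (1 + hbar) * (d%:R * ((2 * m%:R + 1) * C1)).
have hb0 := ltW hbar_gt0.
have D0 : 0 <= D by rewrite /D; do ![apply: mulr_ge0 => // | apply: addr_ge0 => //].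
(* (1 + h)(1 + c h) <= 1 + (1 + c + c hbar) h takes care of the propagation factor, and [D] of the
   consistency error. *)
exists (1 + c + c * hbar + D); first by do ![apply: addr_ge0 => //]; exact: mulr_ge0.
move=> s h x s0 hh' hT mx ix.
have [i e] := ssbe_step_sqr cons s0 hh' hT mx ix.
split => //; first exact: (ssbe_step_measurable s0 hh' hT mx).
have /andP[h0 hh] := hh'.
apply: le_trans e _; set E := Ex P _.
have E0 : 0 <= E by apply: Ex_ge0 => w; exact: sqr_ge0.
have kap : 1 + 2 * h * L / (1 - h * L) ^+ 2 <= 1 + c * h.
  have a1 a : 2 * h * L / a = 2 * L * h * a^-1 by ring.
  have a2 a : 2 * L / a * h = 2 * L * h * a^-1 by ring.
  rewrite lerD2l /c a1 a2; apply: ler_wpM2l.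
    by rewrite !mulr_ge0 ?ltW ?L0.
  have hL : 1 - hbar * L <= 1 - h * L by rewrite lerB// ler_pM2r.
  rewrite lef_pV2 ?posrE ?exprn_gt0//; last exact: lt_le_trans hL.
  by rewrite lerXn2r ?nnegrE ?(ltW iL0)// (le_trans (ltW iL0)).
have h1 : 0 <= 1 + h by rewrite addr_ge0// ltW.
have k1 := ler_wpM2l h1 (ler_wpM2r E0 kap).
have k2 : (1 + h) * (1 + c * h) <= 1 + (1 + c + c * hbar + D) * h.
  have k3 : 0 <= c * h * (hbar - h) by rewrite mulr_ge0 ?subr_ge0// mulr_ge0// ltW.
  have k4 : 0 <= D * h by rewrite mulr_ge0// ltW.
  by rewrite -subr_ge0; move: k3 k4; move: (D) => D' ? ?; nra.
have k5 := ler_wpM2r E0 k2.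
have k6 : (1 + h) * (d%:R * (h * ((2 * m%:R + 1) * (C1 * h)))) <= D * h ^+ 2.
  have -> : (1 + h) * (d%:R * (h * ((2 * m%:R + 1) * (C1 * h)))) =
    (1 + h) * (d%:R * ((2 * m%:R + 1) * C1)) * h ^+ 2 by ring.
  apply: ler_wpM2r; first exact: sqr_ge0.
  rewrite /D; apply: ler_wpM2r; last by rewrite lerD2l.
  by do ![apply: mulr_ge0 => // | apply: addr_ge0 => //].
have k7 : D * h ^+ 2 <= (1 + c + c * hbar + D) * h ^+ 2.
  by apply: ler_wpM2r; rewrite ?sqr_ge0// lerDr !addr_ge0// mulr_ge0.
rewrite mulrDr; apply: lerD; last exact: le_trans k6 k7.
by rewrite -mulrA in k5; exact: le_trans k1 k5.
Qed.
End OneStep.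

(** * Gronwall's inequality along the steps of the scheme *)

Section Recursion.
Context {disp : measure_display} {Omega : measurableType disp} {R : realType}.
Variable P : probability Omega R.
Variables (T : R) (F : R -> set (set Omega)).
Hypothesis F_usual : usual_filtration P T F.
Variables (d m : nat) (W : 'I_m -> R -> Omega -> R).
Variables (f : R -> 'rV[R]_d -> 'rV[R]_d) (g : 'I_m -> R -> 'rV[R]_d -> 'rV[R]_d).
Variables (X0 : Omega -> 'rV[R]_d) (X : R -> Omega -> 'rV[R]_d).
Hypothesis X_sol : sode_solution P T F W f g X0 X.
Hypothesis X0_meas : vmeasurable_wrt (F 0) X0.
Hypothesis T0 : 0 < T.

(** That X starts at X0 follows from the equation at time 0: simple integrals vanish there, hence so
    do their limits in probability. The almost sure equality is expressed as a zero second
    moment. *)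
Lemma initial_error : intg P (fun w => enorm (X0 w - X 0 w) ^+ 2) /\
  Ex P (fun w => enorm (X0 w - X 0 w) ^+ 2) <= 0.
Proof.
have T00 : (0 : R) <= 0 <= T by apply/andP; split; [exact: lexx|exact: ltW].
have [I [II XE]] := sol_eq X_sol.
have sqE (Z : Omega -> R) : (fun w => Z w ^+ 2) = fun w => `|Z w| `^ 2.
  by apply/funext => w; rewrite powR_mulrn// real_normK ?num_real.
have coord i : intg P (fun w => (X0 w - X 0 w) 0 i ^+ 2) /\
    Ex P (fun w => (X0 w - X 0 w) 0 i ^+ 2) <= 0.
  have cI r : cvg_prob P (fun _ => fun=> 0) (fun w => I r 0 w 0 i).
    have [_ [phi_ [_ /(_ 0 T00) c]]] := II r i.
    have := cvg0_cvg_prob c; congr (cvg_prob P _ _); apply/funext => n; apply/funext => w.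
    rewrite /sp_integral big1// => l _.
    have /andP[l0 _] := sp_time_range (ltnW (ltn_ord l)).
    have /andP[l1 _] := sp_time_range (ltn_ord l).
    by rewrite !min_r// subrr mulr0.
  rewrite sqE; apply: (@fatou_prob _ _ _ P 2 0 (fun _ => fun=> 0)) => //.
  - have -> : (fun w => (X0 w - X 0 w) 0 i) = fun w => X0 w 0 i - X 0 w 0 i.
      by apply/funext => w; rewrite !mxE.
    apply: measurable_funB; first exact: (filt_measurable F_usual T00 (X0_meas i)).
    exact: (filt_measurable F_usual T00 (sol_adapted X_sol T00 i)).
  - have := cvg_prob_cstB (fun=> 0) (cvg_prob_sum cI).
    have -> : (fun (n : nat) (w : Omega) => 0 - \sum_(r < m) 0) = (fun _ => fun=> 0 : R).
      by apply/funext => n; apply/funext => w; rewrite big1// subrr.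
    apply: cvg_prob_ae; apply: filterS XE => w /(_ 0 T00) ->.
    rewrite !mxE summxE set_itv1 Rintegral_set1; ring.
  - by move=> n; rewrite normr0 powR0// Ex_cst; split => //; exact: intg_cst.
have -> : (fun w => enorm (X0 w - X 0 w) ^+ 2) = fun w => \sum_i (X0 w - X 0 w) 0 i ^+ 2.
  by apply/funext => w; rewrite enorm_sqr_sum.
split; first by apply: intg_sum => i _; case: (coord i).
rewrite Ex_sum; last by move=> i _; case: (coord i).
by apply: sumr_le0 => i _; case: (coord i).
Qed.

(** The bound exp(C t) C t M reproduces itself: 1 + C h <= exp(C h) handles the propagation, and C
    h^2 <= C h M supplies the growth of the factor t. With M the mesh, the total error is of order M
    regardless of the number of steps. *)
Lemma gronwall_step (C a t h M b : R) : 0 <= C -> 0 <= t -> 0 <= h -> h <= M ->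
  a <= expR (C * t) * (C * t * M) -> b <= (1 + C * h) * a + C * h ^+ 2 ->
  b <= expR (C * (t + h)) * (C * (t + h) * M).
Proof.
move=> C0 t0 h0 hM aE bE; apply: le_trans bE _.
have Ch := mulr_ge0 C0 h0; have Ct := mulr_ge0 C0 t0; have M0 := le_trans h0 hM.
have -> : expR (C * (t + h)) * (C * (t + h) * M) =
    expR (C * h) * (expR (C * t) * (C * t * M)) + expR (C * (t + h)) * (C * h * M).
  by rewrite !mulrDr expRD; ring.
set X1 := expR (C * t) * (C * t * M) in aE *.
have X10 : 0 <= X1 by apply: mulr_ge0; [exact: expR_ge0|exact: mulr_ge0].
have Ch1 : 0 <= 1 + C * h by exact: addr_ge0.
apply: lerD.
  apply: le_trans (ler_wpM2l Ch1 aE) _; apply: (ler_wpM2r X10); exact: expR_ge1Dx.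
have e1 : 1 <= expR (C * (t + h)).
  by rewrite -[leLHS]expR0 ler_expR; apply: mulr_ge0 => //; exact: addr_ge0.
apply: (@le_trans _ _ (C * h * M)); first by rewrite expr2 mulrA; exact: ler_wpM2l.
by apply: ler_peMl => //; exact: mulr_ge0.
Qed.

Variables (C hbar M : R) (h : seq R) (N : nat).
Hypothesis C0 : 0 <= C.
Hypothesis h_range : forall i, (i < N)%N -> 0 < h`_i <= hbar.
Hypothesis h_sum : \sum_(i < N) h`_i = T.
Hypothesis hM : forall i, (i < N)%N -> h`_i <= M.
Hypothesis step : forall s h (x : Omega -> 'rV[R]_d),
  0 <= s -> 0 < h <= hbar -> s + h <= T -> vmeasurable_wrt (F s) x ->
  intg P (fun w => enorm (x w - X s w) ^+ 2) ->
  [/\ vmeasurable_wrt (F (s + h)) (fun w => ssbe f g W (x w) s h w),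
    intg P (fun w => enorm (ssbe f g W (x w) s h w - X (s + h) w) ^+ 2) &
    Ex P (fun w => enorm (ssbe f g W (x w) s h w - X (s + h) w) ^+ 2) <=
      (1 + C * h) * Ex P (fun w => enorm (x w - X s w) ^+ 2) + C * h ^+ 2].

Lemma grid_time_mem n : (n <= N)%N -> 0 <= grid_time h n <= T.
Proof.
have pos j k : (j + k <= N)%N -> grid_time h j <= grid_time h (j + k)%N.
  elim: k => [|k ih]; first by rewrite addn0.
  rewrite addnS => jk; apply: le_trans (ih (ltnW jk)) _.
  by rewrite /grid_time [leRHS]big_ord_recr /= lerDl; case/andP: (h_range jk) => /ltW.
move=> nN; have := pos 0%N n nN; rewrite add0n {1}/grid_time big_ord0 => -> /=.
by rewrite -h_sum; have := pos n (N - n)%N; rewrite subnKC //; apply.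
Qed.

Lemma grid_function_error n : (n <= N)%N ->
  let e w := grid_function (ssbe f g W) X0 h n w - X (grid_time h n) w in
  [/\ vmeasurable_wrt (F (grid_time h n)) (grid_function (ssbe f g W) X0 h n),
    intg P (fun w => enorm (e w) ^+ 2) &
    Ex P (fun w => enorm (e w) ^+ 2) <=
      expR (C * grid_time h n) * (C * grid_time h n * M)].
Proof.
elim: n => [_|n ih nN] /=.
  have t0 : grid_time h 0 = 0 by rewrite /grid_time big_ord0.
  rewrite t0; have [i e] := initial_error; split => //.
  by rewrite mulr0 expR0 !mul0r mulr0.
have [mx ix ex] := ih (ltnW nN).
have tS : grid_time h n.+1 = grid_time h n + h`_n by rewrite /grid_time big_ord_recr.
have /andP[t0 tT] := grid_time_mem (ltnW nN).
have /andP[_ tT1] := grid_time_mem nN.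
have hT : grid_time h n + h`_n <= T by rewrite -tS.
have hn := h_range nN.
have [mx' ix' ex'] := step t0 hn hT mx ix.
rewrite tS; split => //.
have hn0 : 0 <= h`_n by apply: ltW; case/andP: hn.
exact: gronwall_step C0 t0 hn0 (hM nN) ex ex'.
Qed.

End Recursion.

Theorem theorem5p8 (disp : measure_display) (Omega : measurableType disp)
    (R : realType) (P : probability Omega R) (d m : nat) (T : R)
    (F : R -> set (set Omega)) (W : 'I_m -> R -> Omega -> R)
    (f : R -> 'rV[R]_d -> 'rV[R]_d) (g : 'I_m -> R -> 'rV[R]_d -> 'rV[R]_d)
    (L eta q hbar p : R)
    (X0 : Omega -> 'rV[R]_d) (X : R -> Omega -> 'rV[R]_d)
    (d_gt0 : (0 < d)%N) (m_gt0 : (0 < m)%N) (T_gt0 : 0 < T)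
    (F_usual : usual_filtration P T F)
    (W_brownian : forall r, brownian P T F (W r))
    (W_indep : independent_processes P T W)
    (fg_adm : admissible T f g L eta q) (eta_gt1 : 1 < eta)
    (hbar_gt0 : 0 < hbar) (hbar_ltL : hbar < L^-1) (hbar_leT : hbar <= T)
    (X0_meas : vmeasurable_wrt (F 0) X0)
    (p_ge2 : 2 <= p) (X0_Lp : (Lp_norm P p X0 < +oo)%E)
    (X_sol : sode_solution P T F W f g X0 X)
    (X_moment : (ereal_sup
       [set Lp_norm P (4 * q - 2) (X tau) | tau in `[0%R, T]] < +oo)%E) :
  strongly_convergent P T (ssbe f g W) hbar X0 X (2^-1).
Proof.
have L0 : 0 < L := adm_L fg_adm.
have hbarL : hbar * L < 1 by rewrite -ltr_pdivlMr// div1r.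
have [C C0 step] := ssbe_step F_usual m_gt0 W_brownian W_indep fg_adm eta_gt1 X_sol X_moment
  hbar_gt0 hbarL.
(* Square root of the Gronwall constant at the final time T; the mean square error is that constant
   times the mesh. *)
exists (Num.sqrt (expR (C * T) * (C * T))) => N h h_range h_sum.
have h_range' i : (i < N)%N -> 0 < h`_i <= hbar by move=> iN; exact: (h_range (Ordinal iN)).
have hM i : (i < N)%N -> h`_i <= mesh h.
  move=> iN; apply: (le_bigmax_seq 0 h`_i xpredT (fun x => x)) => //.
  by apply: mem_nth; rewrite size_tuple.
have M0 : 0 <= mesh h by exact: bigmax_ge_id.
have CT0 : 0 <= expR (C * T) * (C * T).
  by apply: mulr_ge0; [exact: expR_ge0|apply: mulr_ge0 => //; exact: ltW].
have c0 : 0 <= Num.sqrt (expR (C * T) * (C * T)) * mesh h `^ 2^-1.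
  by apply: mulr_ge0; [exact: sqrtr_ge0|exact: powR_ge0].
apply: bigmax_le => [|n _]; first by rewrite lee_fin.
have nN : (n <= N)%N by rewrite -ltnS.
have [_ ie ee] := grid_function_error F_usual X_sol X0_meas T_gt0 C0 h_range' h_sum hM step nN.
apply: moment_Lp_norm => //; apply: le_trans ee _.
rewrite exprMn powR12_sqrt// !sqr_sqrtr//.
have /andP[t0 tT] := grid_time_mem h_range' h_sum nN.
have Ct : C * grid_time h n <= C * T by exact: ler_wpM2l.
have Ct0 : 0 <= C * grid_time h n by exact: mulr_ge0.
rewrite -[leRHS]mulrA; apply: ler_pM; [exact: expR_ge0|exact: mulr_ge0|by rewrite ler_expR|].
exact: ler_wpM2r.
Qed.
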